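(* Let $(M,g)$ be a closed Riemannian spin manifold of even dimension $n$ with spinor bundle $\Sigma M=\Sigma^+M\oplus\Sigma^-M$, let $p\in M$ and let $U_p$ be a normal geodesic neighborhood of $p$. Let $P\in\mathrm{Diff}(M,\Sigma M)$ be a differential operator which is geometric with respect to $g$, has Agmon angle $\theta$, and is even for the $\mathbb Z_2$-grading $\Sigma M=\Sigma^+M\oplus\Sigma^-M$. If $P$ is rescalable at $p$, then $$\widetilde\omega^{\rm Res}_{\log_\theta(\widetilde{\mathbb P}^{\lim})}(x)=(-2i)^{-n/2}\,\omega^{\rm sRes}_{\log_\theta(P)}(p)\qquad\text{for all }x\in U_p,$$ where $\widetilde{\mathbb P}^{\lim}:=\lim_{\lambda\to0}\widetilde{\mathbb P}^{\rm Ge}_\lambda$. (Both sides are multiples of $dx^1\wedge\dots\wedge dx^n$; the equality is between their coefficients.)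
   Context: **Coordinates.** Fix an oriented orthonormal basis $e_1(p),\dots,e_n(p)$ of $T_pM$ and $U_p=\exp_p(B_r)$ with normal geodesic coordinates $x=(x^1,\dots,x^n)\leftrightarrow\exp_p(\sum_i x^ie_i(p))$. For $0<\lambda<1$, $\mathfrak f_\lambda:U_p\to\exp_p(B_{\lambda r})$ is $x\mapsto\lambda x$. Let $e_1,\dots,e_n$ be the orthonormal frame on $U_p$ obtained by Levi-Civita parallel transport of $(e_i(p))$ along the geodesics from $p$, with dual coframe $e^1,\dots,e^n$. Vielbeins: $\partial_{x^i}=\sum_l a_i^l(\cdot,g) e_l$, $e_l=\sum_j b_l^j(\cdot,g)\partial_{x^j}$. **Operators on spinors.** Clifford multiplication $\cdot_g$ satisfies $v\cdot_g v\,\cdot_g=-|v|^2$, and $\mathrm{C}\ell(TM)\otimes\mathbb C\simeq\mathrm{End}(\Sigma M)$; $\Sigma^\pm M$ are the $\pm1$-eigenbundles of $i^{n/2}e^1\cdot_g\cdots\cdot_g e^n\cdot_g$. $\Sigma M$ is trivialised over $U_p$ by parallel transport (spin connection) along geodesics from $p$; in this trivialisation the operators $e^i\cdot_g$ are constant. For a multi-index $\gamma$, $D^\gamma$ denotes the corresponding coordinate partial derivative acting componentwise. $P$ of order $m$ is written $P=\sum_{|\gamma|\le m}\sum_I(P_\gamma)_I\,e^I\cdot_g D^\gamma$ with functions $(P_\gamma)_I$ on $U_p$ and $e^I=e^{i_1}\cdot_g\cdots\cdot_g e^{i_k}$, $i_1<\dots<i_k$, $|I|=k$. $P$ is geometric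 with respect to $g$ if each $(P_\gamma)_I$ is a constant-coefficient linear combination of finite products of factors $D^\beta a_i^t(\cdot,g)$ and $D^{\delta}b_n^l(\cdot,g)$ whose orders of differentiation add up to $m-|\gamma|$ in each product. $P$ is even if it maps sections of $\Sigma^\pm M$ to sections of $\Sigma^\pm M$. **Clifford map and rescaling.** $c^g:\mathrm{C}\ell(T_xM)\to\mathrm{End}(\Lambda T_x^*M)$ is the algebra morphism with $c^g(v)=v\wedge\cdot-v^{\sharp_g}\lrcorner\,\cdot$ for covectors $v$, and $c^g(P):=\sum_{\gamma,I}(P_\gamma)_I\,c^g(e^I)D^\gamma$, acting on sections of $\Lambda T^*M\otimes\mathbb C$ over $U_p$ trivialised by the parallel frame $e^{i_1}\wedge\dots\wedge e^{i_k}$, with $D^\gamma$ acting componentwise. $U_\lambda$ acts on $\Lambda^kT^*M$ as $\lambda^{-k}$, and $U_\lambda^\sharp Q=U_\lambda QU_\lambda^{-1}$. With $(\mathfrak f_\lambda^\sharp Q)s=Q(s\circ\mathfrak f_\lambda^{-1})\circ\mathfrak f_\lambda$ (componentwise), set $$\widetilde{\mathbb P}^{\rm Ge}_\lambda:=\lambda^m\mathfrak f_\lambda^\sharp U_\lambda^\sharp c^g(P)=\sum_{\gamma,I}\lambda^{m-|\gamma|}\big((P_\gamma)_I\circ\mathfrak f_\lambda\big)\,U_\lambda^\sharp(c^g(e^I))\,D^\gamma .$$ $P$ is rescalable at $p$ if $\widetilde{\mathbb P}^{\rm Ge}_\lambda$ has a limit $\widetilde{\mathbb P}^{\lim}$ as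 $\lambda\to0$ (convergence of coefficients on $U_p$, smoothly on compact sets). The limit acts on $\Lambda T_p^*M\otimes\mathbb C$-valued functions on $U_p$, with $e^i=e^i(p)$ identified with $dx^i$. **Agmon angle and logarithm.** An operator $Q$ of order $m>0$ has Agmon angle $\theta$ if its leading symbol $\sigma_m(Q)(x,\xi)$, $\xi\ne0$, has no eigenvalue on $L_\theta=\{re^{i\theta}:r\ge0\}$ and there is $\varepsilon>0$ such that $Q$ has no eigenvalue in $\{re^{i\alpha}:r\ge0,|\alpha-\theta|\le\varepsilon\}$. The homogeneous symbol components of $\log_\theta Q$ are determined by the local symbol of $Q$ (only the leading-symbol condition is needed, so they are also defined for operators on $U_p$): with $r_{-m}=(\sigma_m(Q)-\mu)^{-1}$ and $r_{-m-j}=-r_{-m}\sum_{a+b+|\alpha|=j,\,b<j}\frac{(-i)^{|\alpha|}}{\alpha!}\partial_\xi^\alpha\sigma_{m-a}(Q)\,\partial_x^\alpha r_{-m-b}$, one puts, for $\mathrm{Re}\,z<0$, $\sigma_{mz-j}(Q_\theta^z)=\frac{i}{2\pi}\int_{\Gamma_\theta}\mu_\theta^z\,r_{-m-j}\,d\mu$, where $\Gamma_\theta$ comes in from infinity along $L_\theta$ (argument $\theta$), goes clockwise around a small circle about $0$ and returns to infinity along the same ray (argument $\theta-2\pi$); this extends holomorphically to $z=0$, and $\sigma_{-j}(\log_\theta Q)(x,\xi)=|\xi|^{-j}\partial_z\big(\sigma_{mz-j}(Q_\theta^z)(x,\xi/|\xi|)\big)|_{z=0}$. **Densities.** With $|\xi|$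 the Euclidean norm in the coordinates and $d_S\xi$ the standard volume form on the unit sphere, $\omega^{\rm sRes}_{\log_\theta(P)}(x)=\frac1{(2\pi)^n}\Big(\int_{|\xi|=1}\mathrm{str}\big(\sigma_{-n}(\log_\theta P)(x,\xi)\big)d_S\xi\Big)dx^1\wedge\dots\wedge dx^n$, $\mathrm{str}=\mathrm{tr}^{\Sigma^+}-\mathrm{tr}^{\Sigma^-}$; and for $Q$ acting on forms $\widetilde\omega^{\rm Res}_{\log_\theta(Q)}(x)=\frac1{(2\pi)^n}\int_{|\xi|=1}\big[\sigma_{-n}(\log_\theta Q)(x,\xi)\mathbf 1_x\big]_{[n]}d_S\xi$, where $\mathbf 1_x\in\Lambda^0$ is the constant $1$ and $[\cdot]_{[n]}$ the degree-$n$ part. *)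

(* Defs.v *)
From HB Require Import structures.
From mathcomp Require Import all_boot all_order all_algebra.
From mathcomp Require Import complex.
From mathcomp Require Import all_classical all_reals all_analysis.

Set Implicit Arguments.
Unset Strict Implicit.
Unset Printing Implicit Defensive.

Import Order.TTheory GRing.Theory Num.Theory numFieldNormedType.Exports.
Local Open Scope classical_set_scope.
Local Open Scope ring_scope.
Local Open Scope complex_scope.

Definition mindex (n : nat) := {ffun 'I_n -> nat}.

Definition mdeg (n : nat) (a : mindex n) : nat := (\sum_(i < n) a i)%N.

Definition mfact (n : nat) (a : mindex n) : nat := (\prod_(i < n) (a i)`!)%N.

Definition mpow (R : realType) (n : nat) (xi : 'rV[R]_n) (a : mindex n) : R :=
  \prod_(i < n) xi 0 i ^+ a i.

(* Sum over all multi-indices of degree at most k: their entries are at most k,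
   so they are enumerated by a finite type. *)
Definition mindex_sum (V : nmodType) (n k : nat) (F : mindex n -> V) : V :=
  \sum_(a : {ffun 'I_n -> 'I_k.+1} | (\sum_(i < n) a i <= k)%N)
    F [ffun i => nat_of_ord (a i)].

Definition eucl (R : realType) (n : nat) (x : 'rV[R]_n) : R :=
  Num.sqrt (\sum_(i < n) x 0 i ^+ 2).

Definition euclball (R : realType) (n : nat) (r : R) : set 'rV[R]_n :=
  [set x | eucl x < r].
Arguments euclball {R} n r _.

Definition pderiv (R : realType) (n : nat) (i : 'I_n) (f : 'rV[R]_n -> R)
  : 'rV[R]_n -> R := fun x => 'D_(delta_mx 0 i) f x.

Definition mderiv (R : realType) (n : nat) (a : mindex n) (f : 'rV[R]_n -> R)
  : 'rV[R]_n -> R :=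
  foldr (fun i h => iter (a i) (pderiv i) h) f (enum 'I_n).

Definition mderivC (R : realType) (n : nat) (a : mindex n)
    (f : 'rV[R]_n -> R[i]) : 'rV[R]_n -> R[i] :=
  fun x => mderiv a (fun y => complex.Re (f y)) x
           +i* mderiv a (fun y => complex.Im (f y)) x.

Definition mderivM (R : realType) (n : nat) (a : mindex n) (p q : nat)
    (f : 'rV[R]_n -> 'M[R[i]]_(p, q)) : 'rV[R]_n -> 'M[R[i]]_(p, q) :=
  fun x => \matrix_(k, l) mderivC a (fun y => f y k l) x.

(* All iterated partial derivatives exist and are continuous on the open set
   U; the values of f outside U are irrelevant. *)
Definition smooth_on (R : realType) (n : nat) (U : set 'rV[R]_n)
    (f : 'rV[R]_n -> R) : Prop :=
  forall (s : seq 'I_n) x, U x ->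
    {for x, continuous (foldr (@pderiv R n) f s)} /\
    forall i, derivable (foldr (@pderiv R n) f s) x (delta_mx 0 i).

Definition smoothC_on (R : realType) (n : nat) (U : set 'rV[R]_n)
    (f : 'rV[R]_n -> R[i]) : Prop :=
  smooth_on U (fun x => complex.Re (f x)) /\
  smooth_on U (fun x => complex.Im (f x)).

Definition smoothM_on (R : realType) (n : nat) (U : set 'rV[R]_n) (p q : nat)
    (f : 'rV[R]_n -> 'M[R[i]]_(p, q)) : Prop :=
  forall k l, smoothC_on U (fun x => f x k l).

Definition cexp (R : realType) (z : R[i]) : R[i] :=
  (expR (complex.Re z) * cos (complex.Im z))
  +i* (expR (complex.Re z) * sin (complex.Im z)).

Definition polar (R : realType) (t phi : R) : R[i] :=
  (t * cos phi) +i* (t * sin phi).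

(* (t e^{i phi})^z, for the determination of the logarithm whose argument at
   that point is phi. *)
Definition polar_pow (R : realType) (t phi : R) (z : R[i]) : R[i] :=
  cexp (z * (ln t +i* phi)).

Definition cintegral (R : realType) (D : set R) (h : R -> R[i]) : R[i] :=
  (\int[lebesgue_measure]_(t in D) complex.Re (h t))
  +i* (\int[lebesgue_measure]_(t in D) complex.Im (h t)).

(* Integral of mu^z F(mu) d mu from rho e^{i phi} to infinity along the ray of
   argument phi. *)
Definition ray_integral (R : realType) (phi rho : R) (z : R[i])
    (F : R[i] -> R[i]) : R[i] :=
  cintegral `[rho, +oo[
    (fun t => polar_pow t phi z * F (polar t phi) * polar 1 phi).

(* Counterclockwise, the argument running from theta - 2 pi to theta. *)
Definition circle_integral (R : realType) (theta rho : R) (z : R[i])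
    (F : R[i] -> R[i]) : R[i] :=
  cintegral `[theta - 2 * pi, theta]
    (fun phi => polar_pow rho phi z * F (polar rho phi)
                * ('i%C * polar rho phi)).

(* Integral of mu_theta^z F(mu) over the contour Gamma_theta whose small
   circle has radius rho. *)
Definition contour_integral (R : realType) (theta rho : R) (z : R[i])
    (F : R[i] -> R[i]) : R[i] :=
  - ray_integral theta rho z F - circle_integral theta rho z F
  + ray_integral (theta - 2 * pi) rho z F.

(* d is the derivative at z = 0 of the holomorphic extension G of
   z |-> (i / 2 pi) int_{Gamma_theta} mu_theta^z F(mu) d mu, Re z < 0.
   "A small circle" is rendered as: any circle of small enough radius. *)
Definition is_dlog (R : realType) (theta : R) (F : R[i] -> R[i]) (d : R[i])
  : Prop :=
  exists delta : R, exists G : R[i] -> R[i],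
  [/\ 0 < delta,
      forall z : R[i], complex.Re z < delta ->
        @derivable R[i] R[i]^o R[i]^o G z 1,
      \forall rho \near (0 : R)^'+, forall z : R[i], complex.Re z < 0 ->
        G z = 'i%C / (2 * pi)%:C * contour_integral theta rho z F &
      @is_derive R[i] R[i]^o R[i]^o 0 1 G d].

Definition dlog (R : realType) (theta : R) (F : R[i] -> R[i]) : R[i] :=
  xget 0 [set d | is_dlog theta F d].

(* Integral over the unit sphere S^k of R^{k+1}, in spherical coordinates
   (cos phi, sin phi * omega), omega in S^{k-1}, whose volume element is
   sin^{k-1} phi d phi d omega; S^0 = {1, -1} has the counting measure. *)
Fixpoint sphere_integralS (R : realType) (k : nat)
  : ('rV[R]_k.+1 -> R) -> R :=
  match k with
  | 0 => fun f => f (const_mx 1) + f (const_mx (- 1))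
  | k'.+1 => fun f =>
      \int[lebesgue_measure]_(phi in `[0, pi])
        (sin phi ^+ k' *
         sphere_integralS (fun omega : 'rV[R]_k'.+1 =>
           f (row_mx (cos phi)%:M (sin phi *: omega) : 'rV[R]_(1 + k'.+1))))
  end.

(* The unit sphere of R^0 is empty. *)
Definition sphere_integral (R : realType) (n : nat)
  : ('rV[R]_n -> R) -> R :=
  match n with 0 => fun _ => 0 | k.+1 => @sphere_integralS R k end.

Definition sphere_integralC (R : realType) (n : nat) (f : 'rV[R]_n -> R[i])
  : R[i] :=
  sphere_integral (fun xi => complex.Re (f xi))
  +i* sphere_integral (fun xi => complex.Im (f xi)).

(* Coefficients A_gamma(x) of sum_{|gamma| <= m} A_gamma D^gamma, acting on
   C^N-valued functions; only the A_gamma with |gamma| <= m matter. *)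
Definition opcoefs (R : realType) (n N : nat) :=
  mindex n -> 'rV[R]_n -> 'M[R[i]]_N.

Definition opapply (R : realType) (n N m : nat) (A : opcoefs R n N)
    (s : 'rV[R]_n -> 'cV[R[i]]_N) : 'rV[R]_n -> 'cV[R[i]]_N :=
  fun x => mindex_sum m (fun a => A a x *m mderivM a s x).

(* sigma_{m-a}; the symbol of D^gamma = d^gamma/dx^gamma is (i xi)^gamma. *)
Definition opsymbol (R : realType) (n N m : nat) (A : opcoefs R n N) (a : nat)
    (x xi : 'rV[R]_n) : 'M[R[i]]_N :=
  if (a <= m)%N then
    mindex_sum m (fun g => if (mdeg g == m - a)%N
                     then ('i%C ^+ mdeg g * (mpow xi g)%:C) *: A g x else 0)
  else 0.

Definition symbol_family (R : realType) (n N : nat) :=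
  'rV[R]_n -> 'rV[R]_n -> R[i] -> 'M[R[i]]_N.

Definition resolvent0 (R : realType) (n N m : nat) (A : opcoefs R n N)
  : symbol_family R n N :=
  fun x xi mu => invmx (opsymbol m A 0 x xi - mu%:M).

(* r_{-m-j} in terms of the r_{-m-b}, b < j. *)
Definition resolvent_step (R : realType) (n N m : nat) (A : opcoefs R n N)
    (j : nat) (r : nat -> symbol_family R n N) : symbol_family R n N :=
  fun x xi mu =>
    - (resolvent0 m A x xi mu *m
       \sum_(a < j.+1) \sum_(b < j) mindex_sum j (fun al =>
         if (a + b + mdeg al == j)%N then
           ((- 'i%C) ^+ mdeg al / ((mfact al)%:R)) *:
           (mderivM al (fun eta => opsymbol m A a x eta) xi *m
            mderivM al (fun y => r b y xi mu) x)
         else 0)).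

(* resolvents m A k b is r_{-m-b} for every b <= k. *)
Fixpoint resolvents (R : realType) (n N m : nat) (A : opcoefs R n N) (k : nat)
  : nat -> symbol_family R n N :=
  match k with
  | 0 => fun _ => resolvent0 m A
  | k'.+1 => fun b =>
      if (b <= k')%N then resolvents m A k' b
      else resolvent_step m A k'.+1 (resolvents m A k')
  end.

Definition resolvent (R : realType) (n N m : nat) (A : opcoefs R n N) (j : nat)
  : symbol_family R n N := resolvents m A j j.

(* sigma_{-j}(log_theta A)(x, xi) *)
Definition log_symbol (R : realType) (n N m : nat) (theta : R)
    (A : opcoefs R n N) (j : nat) (x xi : 'rV[R]_n) : 'M[R[i]]_N :=
  (eucl xi ^- j)%:C *:
  \matrix_(k, l)
    dlog theta (fun mu => resolvent m A j x ((eucl xi)^-1 *: xi) mu k l).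

Definition spindim (n : nat) : nat := (2 ^ n./2)%N.

(* For n even these relations force the E_i to generate all matrices of size
   2^(n/2), i.e. they define an isomorphism from the complexified Clifford
   algebra of R^n onto End(Sigma). *)
Definition clifford_rep (R : realType) (n : nat)
    (E : 'I_n -> 'M[R[i]]_(spindim n)) : Prop :=
  forall i j, E i *m E j + E j *m E i = (- ((i == j)%:R *+ 2))%:M.

Definition cmul (R : realType) (n N : nat) (E : 'I_n -> 'M[R[i]]_N)
    (v : 'rV[R]_n) : 'M[R[i]]_N := \sum_(i < n) (v 0 i)%:C *: E i.

(* E_{i_1} ... E_{i_k} for I = {i_1 < ... < i_k} (enum I is increasing). *)
Definition cliff_prod (R : realType) (n N : nat) (E : 'I_n -> 'M[R[i]]_N)
    (I : {set 'I_n}) : 'M[R[i]]_N := \prod_(i <- enum I) E i.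

(* The group Spin(n) inside the Clifford algebra. *)
Definition is_spin (R : realType) (n N : nat) (E : 'I_n -> 'M[R[i]]_N)
    (S : 'M[R[i]]_N) : Prop :=
  exists vs : seq 'rV[R]_n,
    [/\ ~~ odd (size vs), forall v, v \in vs -> eucl v = 1 &
        S = \prod_(v <- vs) cmul E v].

Definition chirality (R : realType) (n N : nat) (E : 'I_n -> 'M[R[i]]_N)
  : 'M[R[i]]_N := 'i%C ^+ n./2 *: cliff_prod E finset.setT.

Definition supertrace (R : realType) (n N : nat) (E : 'I_n -> 'M[R[i]]_N)
    (A : 'M[R[i]]_N) : R[i] :=
  \tr ((2^-1 *: (1%:M + chirality E)) *m A)
  - \tr ((2^-1 *: (1%:M - chirality E)) *m A).

(* Endomorphisms of Lambda C^n are matrices acting on column vectors; the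
   basis vector of index enum_rank B is e^{i_1} /\ ... /\ e^{i_k} for
   B = {i_1 < ... < i_k}. *)
Definition formdim (n : nat) : nat := #|{: {set 'I_n}}|.

Definition form_mx (R : realType) (n : nat)
    (f : {set 'I_n} -> {set 'I_n} -> R[i]) : 'M[R[i]]_(formdim n) :=
  \matrix_(k, l) f (enum_val k) (enum_val l).

Definition wedge_sign (R : realType) (n : nat) (i : 'I_n) (B : {set 'I_n})
  : R[i] := (-1) ^+ #|[set j in B | (j < i)%N]%SET|.

(* e^i /\ _ *)
Definition wedge_mx (R : realType) (n : nat) (i : 'I_n)
  : 'M[R[i]]_(formdim n) :=
  form_mx (fun A B => if (i \notin B) && (A == i |: B)%SET
                      then wedge_sign R i B else 0).

(* interior product with e_i *)
Definition contract_mx (R : realType) (n : nat) (i : 'I_n)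
  : 'M[R[i]]_(formdim n) :=
  form_mx (fun A B => if (i \in B) && (A == B :\ i)%SET
                      then wedge_sign R i B else 0).

Definition cform (R : realType) (n : nat) (i : 'I_n)
  : 'M[R[i]]_(formdim n) := wedge_mx R i - contract_mx R i.

Definition degree_scaling (R : realType) (n : nat) (lambda : R)
  : 'M[R[i]]_(formdim n) :=
  form_mx (fun A B => if A == B then (lambda ^- #|A|)%:C else 0).

(* The coefficient of dx^1 /\ ... /\ dx^n in [Q 1]_{[n]}. *)
Definition top_of_one (R : realType) (n : nat) (Q : 'M[R[i]]_(formdim n))
  : R[i] :=
  Q (enum_rank (finset.setT : {set 'I_n})) (enum_rank (finset.set0 : {set 'I_n})).

(* Gamma^k_{ij}, for the metric g_{ij}(x) = g x i j. *)
Definition christoffel (R : realType) (n : nat) (g : 'rV[R]_n -> 'M[R]_n)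
    (x : 'rV[R]_n) (k i j : 'I_n) : R :=
  2^-1 * \sum_(l < n) invmx (g x) k l *
    (pderiv i (fun y => g y j l) x + pderiv j (fun y => g y i l) x
     - pderiv l (fun y => g y i j) x).

Definition velocity (R : realType) (n : nat) (c : R -> 'rV[R]_n) (t : R)
  : 'rV[R]_n := \row_k derive1 (fun u => c u 0 k) t.

(* Covariant derivative at time t along c of the vector field with
   components w. *)
Definition covderiv (R : realType) (n : nat) (g : 'rV[R]_n -> 'M[R]_n)
    (c w : R -> 'rV[R]_n) (t : R) : 'rV[R]_n :=
  \row_k (derive1 (fun u => w u 0 k) t +
    \sum_(i < n) \sum_(j < n)
      christoffel g (c t) k i j * velocity c t 0 i * w t 0 j).

(* The manifold is presented by an atlas; over each chart alpha an oriented
   orthonormal frame of TM is given, by its components in the coordinate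
   frame: e_l = sum_j (frame alpha x) l j d/dx^j.  The spin structure is a lift
   to Spin(n) of the SO(n)-valued cocycle of these frames.  The data attached
   to a chart are functions on R^n, meaningful on the image of the chart only.
   Vectors are rows: the Jacobian matrix J of a coordinate change sends the
   components v to v *m J. *)
Record spin_manifold (R : realType) (n : nat) := SpinManifold {
  points :> topologicalType;
  sm_compact : compact [set: points];
  sm_hausdorff : hausdorff_space points;
  chart_ix : Type;
  dom : chart_ix -> set points;
  chart_map : chart_ix -> points -> 'rV[R]_n;
  param : chart_ix -> 'rV[R]_n -> points;
  img : chart_ix -> set 'rV[R]_n := fun al => chart_map al @` dom al;
  overlap : chart_ix -> chart_ix -> set 'rV[R]_n :=
    fun al be => [set x | img al x /\ dom be (param al x)];
  trans : chart_ix -> chart_ix -> 'rV[R]_n -> 'rV[R]_n :=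
    fun al be x => chart_map be (param al x);
  dom_open : forall al, open (dom al);
  dom_cover : forall q, exists al, dom al q;
  img_open : forall al, open (img al);
  chart_mapK : forall al q, dom al q -> param al (chart_map al q) = q;
  chart_map_continuous : forall al q, dom al q -> {for q, continuous (chart_map al)};
  param_continuous : forall al x, img al x -> {for x, continuous (param al)};
  trans_smooth : forall al be k,
    smooth_on (overlap al be) (fun x => trans al be x 0 k);
  trans_jacobian : chart_ix -> chart_ix -> 'rV[R]_n -> 'M[R]_n :=
    fun al be x => \matrix_(i, j) pderiv i (fun y => trans al be y 0 j) x;
  metric : chart_ix -> 'rV[R]_n -> 'M[R]_n;
  metric_smooth : forall al i j, smooth_on (img al) (fun x => metric al x i j);
  metric_tr : forall al x, img al x -> (metric al x)^T = metric al x;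
  metric_pos : forall al x, img al x -> forall v : 'rV[R]_n, v != 0 ->
    0 < (v *m metric al x *m v^T) 0 0;
  metric_trans : forall al be x, overlap al be x ->
    metric al x = trans_jacobian al be x *m metric be (trans al be x)
                  *m (trans_jacobian al be x)^T;
  frame : chart_ix -> 'rV[R]_n -> 'M[R]_n;
  frame_smooth : forall al l j, smooth_on (img al) (fun x => frame al x l j);
  frame_orthonormal : forall al x, img al x ->
    frame al x *m metric al x *m (frame al x)^T = 1%:M;
  (* e^al_l = sum_k (frame_change al be x) l k e^be_k *)
  frame_change : chart_ix -> chart_ix -> 'rV[R]_n -> 'M[R]_n :=
    fun al be x => frame al x *m trans_jacobian al be x
                   *m invmx (frame be (trans al be x));
  frame_oriented : forall al be x, overlap al be x ->
    \det (frame_change al be x) = 1;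
  gen : 'I_n -> 'M[R[i]]_(spindim n);
  gen_clifford : clifford_rep gen;
  spin_lift : chart_ix -> chart_ix -> 'rV[R]_n -> 'M[R[i]]_(spindim n);
  spin_lift_smooth : forall al be, smoothM_on (overlap al be) (spin_lift al be);
  spin_lift_spin : forall al be x, overlap al be x ->
    is_spin gen (spin_lift al be x);
  spin_lift_covers : forall al be x, overlap al be x -> forall v : 'rV[R]_n,
    cmul gen v *m spin_lift al be x =
    spin_lift al be x *m cmul gen (v *m frame_change al be x);
  spin_lift_cocycle : forall al be ga x, overlap al be x -> overlap al ga x ->
    spin_lift al ga x = spin_lift al be x *m spin_lift be ga (trans al be x)
}.

Arguments chart_ix {R n} s.
Arguments img {R n} s _ _.
Arguments dom {R n} s _ _.
Arguments chart_map {R n} s _ _.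
Arguments overlap {R n} s _ _ _.
Arguments trans {R n} s _ _ _.
Arguments metric {R n} s _ _.
Arguments frame {R n} s _ _.
Arguments gen {R n} s _.
Arguments spin_lift {R n} s _ _ _.

(* Smooth sections of the spinor bundle, in the trivialisations given by the
   spin frames. *)
Definition spinor (R : realType) (n : nat) (M : spin_manifold R n) :=
  chart_ix M -> 'rV[R]_n -> 'cV[R[i]]_(spindim n).

Definition is_section (R : realType) (n : nat) (M : spin_manifold R n)
    (s : spinor M) : Prop :=
  (forall al, smoothM_on (img M al) (s al)) /\
  (forall al be x, overlap M al be x ->
     s al x = spin_lift M al be x *m s be (trans M al be x)).

(* Differential operators of order (at most) m on the spinor bundle. *)
Record diffop (R : realType) (n : nat) (M : spin_manifold R n) (m : nat) :=
  Diffop {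
    opcoef : chart_ix M -> opcoefs R n (spindim n);
    opcoef_smooth : forall al a, (mdeg a <= m)%N ->
      smoothM_on (img M al) (opcoef al a);
    opcoef_section : forall s : spinor M, is_section s ->
      is_section ((fun al => opapply m (opcoef al) (s al)) : spinor M)
  }.

Definition diffop_apply (R : realType) (n : nat) (M : spin_manifold R n)
    (m : nat) (P : diffop M m) (s : spinor M) : spinor M :=
  fun al => opapply m (opcoef P al) (s al).

Definition diffop_eigenvalue (R : realType) (n : nat) (M : spin_manifold R n)
    (m : nat) (P : diffop M m) (mu : R[i]) : Prop :=
  exists s : spinor M,
    [/\ is_section s, exists al x, img M al x /\ s al x != 0 &
        forall al x, img M al x -> diffop_apply P s al x = mu *: s al x].

Definition agmon_angle (R : realType) (n : nat) (M : spin_manifold R n)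
    (m : nat) (P : diffop M m) (theta : R) : Prop :=
  (forall al x (xi : 'rV[R]_n), img M al x -> xi != 0 -> forall t : R, 0 <= t ->
     ~~ eigenvalue (opsymbol m (opcoef P al) 0 x xi) (polar t theta)) /\
  (exists2 eps : R, 0 < eps & forall t alpha : R, 0 <= t ->
     `|alpha - theta| <= eps -> ~ diffop_eigenvalue P (polar t alpha)).

Definition chiral_section (R : realType) (n : nat) (M : spin_manifold R n)
    (sgn : R[i]) (s : spinor M) : Prop :=
  is_section s /\
  forall al x, img M al x -> chirality (gen M) *m s al x = sgn *: s al x.

Definition even_diffop (R : realType) (n : nat) (M : spin_manifold R n)
    (m : nat) (P : diffop M m) : Prop :=
  forall s : spinor M,
    (chiral_section 1 s -> chiral_section 1 (diffop_apply P s)) /\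
    (chiral_section (-1) s -> chiral_section (-1) (diffop_apply P s)).

(* The chart al0 is U_p = exp_p(B_r) with normal geodesic coordinates centered
   at p and frame the radially parallel orthonormal frame: the coordinate rays
   t |-> t v are the geodesics t |-> exp_p(t sum_i v^i e_i(p)), the frame is
   the coordinate frame at p and is parallel along these rays. *)
Definition normal_chart (R : realType) (n : nat) (M : spin_manifold R n)
    (p : M) (al0 : chart_ix M) (r : R) : Prop :=
  [/\ 0 < r, dom M al0 p, chart_map M al0 p = 0 & img M al0 = euclball n r] /\
  [/\ metric M al0 0 = 1%:M, frame M al0 0 = 1%:M,
      (forall (v : 'rV[R]_n) (t : R), euclball n r (t *: v) ->
         covderiv (metric M al0) (fun u => u *: v)
           (velocity (fun u : R => u *: v)) t = 0) &
      (forall (v : 'rV[R]_n) (t : R) (l : 'I_n), euclball n r (t *: v) ->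
         covderiv (metric M al0) (fun u => u *: v)
           (fun u => row l (frame M al0 (u *: v))) t = 0)].

(* Spin connection along a curve c, in the spin frame of the chart al:
   s' + 1/4 sum_{k,l} g(nabla e_k, e_l) e_k e_l s. *)
Definition spin_covderiv (R : realType) (n : nat) (M : spin_manifold R n)
    (al : chart_ix M) (c : R -> 'rV[R]_n)
    (s : R -> 'cV[R[i]]_(spindim n)) (t : R) : 'cV[R[i]]_(spindim n) :=
  (\col_k (derive1 (fun u => complex.Re (s u k 0)) t
           +i* derive1 (fun u => complex.Im (s u k 0)) t))
  + 4^-1 *: \sum_(k < n) \sum_(l < n)
      ((covderiv (metric M al) c (fun u => row k (frame M al (c u))) t
        *m metric M al (c t) *m (row l (frame M al (c t)))^T) 0 0)%:C *:
      (gen M k *m gen M l *m s t).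

(* In a normal chart the spin frame trivialises the spinor bundle by parallel
   transport along the geodesics from p. *)
Lemma normal_chart_spin_parallel (R : realType) (n : nat)
    (M : spin_manifold R n) (p : M) (al0 : chart_ix M) (r : R)
    (u : 'cV[R[i]]_(spindim n)) (v : 'rV[R]_n) (t : R) :
  normal_chart p al0 r -> euclball n r (t *: v) ->
  spin_covderiv al0 (fun w => w *: v) (fun _ => u) t = 0.
Proof.
move=> [_ [_ _ _ par]] tv; rewrite /spin_covderiv.
rewrite big1 ?scaler0 ?addr0; last first.
  by move=> k _; rewrite big1// => l _; rewrite par// !mul0mx mxE scale0r.
by apply/colP => k; rewrite !mxE !derive1_cst.
Qed.

(* q gamma I is the function (P_gamma)_I on U_p. *)
Definition clifford_coefs (R : realType) (n : nat) :=
  mindex n -> {set 'I_n} -> 'rV[R]_n -> R[i].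

Definition clifford_expansion (R : realType) (n : nat) (M : spin_manifold R n)
    (m : nat) (P : diffop M m) (al0 : chart_ix M) (q : clifford_coefs R n)
  : Prop :=
  forall a x, (mdeg a <= m)%N -> img M al0 x ->
    opcoef P al0 a x = \sum_(I : {set 'I_n}) q a I x *: cliff_prod (gen M) I.

(* The factor D^beta b_i^l if inverse = false, D^beta a_i^l otherwise, with
   e_i = sum_l b_i^l d/dx^l and d/dx^i = sum_l a_i^l e_l, i.e. a = b^-1. *)
Record vielbein_factor (n : nat) := VielbeinFactor {
  vf_inverse : bool;
  vf_deriv : mindex n;
  vf_row : 'I_n;
  vf_col : 'I_n
}.

Definition vf_eval (R : realType) (n : nat) (b : 'rV[R]_n -> 'M[R]_n)
    (f : vielbein_factor n) (x : 'rV[R]_n) : R :=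
  mderiv (vf_deriv f)
    (fun y => (if vf_inverse f then invmx (b y) else b y) (vf_row f) (vf_col f))
    x.

(* U is the domain U_p and b the vielbein of the radially parallel frame. *)
Definition geometric_op (R : realType) (n : nat) (U : set 'rV[R]_n)
    (b : 'rV[R]_n -> 'M[R]_n) (m : nat) (q : clifford_coefs R n) : Prop :=
  forall a I, (mdeg a <= m)%N ->
  exists ts : seq (R[i] * seq (vielbein_factor n)),
    all (fun t => sumn [seq mdeg (vf_deriv f) | f <- t.2] == m - mdeg a)%N ts /\
    forall x, U x ->
      q a I x = \sum_(t <- ts) t.1 * (\prod_(f <- t.2) vf_eval b f x)%:C.

(* Coefficients of lambda^m f_lambda^sharp U_lambda^sharp c^g(P). *)
Definition rescaled_op (R : realType) (n m : nat) (q : clifford_coefs R n)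
    (lambda : R) : opcoefs R n (formdim n) :=
  fun a x => \sum_(I : {set 'I_n})
    ((lambda ^+ (m - mdeg a))%:C * q a I (lambda *: x)) *:
    (degree_scaling n lambda *m cliff_prod (@cform R n) I
     *m invmx (degree_scaling n lambda)).

(* Smooth convergence of the coefficients, on compact subsets of U. *)
Definition is_rescaling_limit (R : realType) (n : nat) (U : set 'rV[R]_n)
    (m : nat) (q : clifford_coefs R n) (L : opcoefs R n (formdim n)) : Prop :=
  forall a, (mdeg a <= m)%N ->
  smoothM_on U (L a) /\
  forall (K : set 'rV[R]_n) (be : mindex n) (k l : 'I_(formdim n)) (eps : R),
    compact K -> K `<=` U -> 0 < eps ->
    \forall lambda \near (0 : R)^'+, forall x, K x ->
      `|mderivM be (rescaled_op m q lambda a) x k l - mderivM be (L a) x k l|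
      < eps%:C.

Definition sres_density (R : realType) (n N : nat) (E : 'I_n -> 'M[R[i]]_N)
    (m : nat) (theta : R) (A : opcoefs R n N) (x : 'rV[R]_n) : R[i] :=
  ((2 * pi) ^- n)%:C *
  sphere_integralC (fun xi => supertrace E (log_symbol m theta A n x xi)).

Definition form_res_density (R : realType) (n m : nat) (theta : R)
    (A : opcoefs R n (formdim n)) (x : 'rV[R]_n) : R[i] :=
  ((2 * pi) ^- n)%:C *
  sphere_integralC (fun xi => top_of_one (log_symbol m theta A n x xi)).

(* Main.v *)
(* The resolvent symbol r_{-m-j} is one fixed noncommutative polynomial in
   rho = (sigma_m - mu)^-1 and in the derivatives of the coefficients.  The
   Clifford map c^g is an algebra morphism, so it commutes with the evaluation
   of this polynomial, and conjugation by U_lambda together with x -> lambda x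
   and the factor lambda^m multiplies each monomial by lambda^j, the weight
   counting differentiations and the defect m - |gamma| of the order of a
   coefficient.  For j = n this power cancels the factor lambda^-n which
   U_lambda gives to the degree n part of its value on 1.  Letting lambda tend
   to 0, the top degree part of the resolvent symbol of the limit operator at
   any x, applied to 1, equals that of the Clifford image of the resolvent
   symbol of P at p, for every mu at which the latter is defined.  On End(Sigma)
   the supertrace is (-2i)^(n/2) times this top degree part.  It remains to
   integrate against mu^z and to differentiate at z = 0, which is a linear
   operation because each monomial of r_{-m-n} contains rho at least twice, so
   that the entries decay like mu^-2 along the ray, and are holomorphic near 0. *)
Require Import Defs.
From HB Require Import structures.
From mathcomp Require Import all_boot all_order all_algebra.
From mathcomp Require Import complex.
From mathcomp Require Import all_classical all_reals all_analysis.
From mathcomp Require Import measurable_realfun.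
From mathcomp Require Import ring lra.

Set Implicit Arguments.
Unset Strict Implicit.
Unset Printing Implicit Defensive.

Import Order.TTheory GRing.Theory Num.Theory numFieldNormedType.Exports.
Local Open Scope classical_set_scope.
Local Open Scope ring_scope.
Local Open Scope complex_scope.

(** * Clifford algebras and the supertrace *)

(** Three obstacles shape the proof. [dlog] is a choice with a default value, so it is linear only
    on functions whose derivative at z = 0 is known to exist. Existence is proved for the entries of
    the spinor resolvent symbol, and the form side inherits it, the top degree part of the Clifford
    image being a fixed linear combination of these entries. For one entry, Cauchy's theorem on
    annular sectors removes the dependence on the small radius. Second, inversion passes to a limit
    only if the limit is invertible, while U_lambda itself diverges; invertibility of the limit
    symbol is read off determinants, which conjugation preserves. Third, the convergence hypothesis
    concerns derivatives in one fixed order, while the recursion produces them in any order, whence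
    the symmetry of mixed partial derivatives. Finally no measurability is available for the
    integrands on the sphere. This is harmless because (-2i)^(-n/2) is a power of i/2: real scaling
    needs no measurability, and multiplication by i only exchanges real and imaginary parts up to
    sign. *)

Definition clifford_family (R : realType) (n N : nat)
    (E : 'I_n -> 'M[R[i]]_N) : Prop :=
  forall i j, E i *m E j + E j *m E i = (- ((i == j)%:R *+ 2))%:M.

Definition cliff_word (R : realType) (n N : nat) (E : 'I_n -> 'M[R[i]]_N)
    (s : seq 'I_n) : 'M[R[i]]_N := \prod_(i <- s) E i.

Section CliffordWords.
Variables (R : realType) (n : nat).
Implicit Types (i j : 'I_n) (s : seq 'I_n).

Let ltI : rel 'I_n := fun i j => (i < j)%N.

Lemma cliff_word_cons N (E : 'I_n -> 'M[R[i]]_N) i s :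
  cliff_word E (i :: s) = E i *m cliff_word E s.
Proof. by rewrite /cliff_word big_cons. Qed.

Lemma cliff_word_nil N (E : 'I_n -> 'M[R[i]]_N) : cliff_word E [::] = 1%:M.
Proof. by rewrite /cliff_word big_nil. Qed.

Lemma cliff_word_cat N (E : 'I_n -> 'M[R[i]]_N) s1 s2 :
  cliff_word E (s1 ++ s2) = cliff_word E s1 *m cliff_word E s2.
Proof. by rewrite /cliff_word big_cat. Qed.

Lemma clifford_sqr N (E : 'I_n -> 'M[R[i]]_N) i :
  clifford_family E -> E i *m E i = (-1)%:M.
Proof.
move=> /(_ i i); rewrite eqxx -mulr2n => h.
have -> : E i *m E i = 2^-1 *: ((E i *m E i) *+ 2).
  by rewrite -(scaler_nat 2 (E i *m E i)) scalerA mulVf ?pnatr_eq0// scale1r.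
rewrite h scale_scalar_mx; congr (_%:M).
by rewrite mulrN mulVf ?pnatr_eq0.
Qed.

Lemma clifford_anti N (E : 'I_n -> 'M[R[i]]_N) i j :
  clifford_family E -> i != j -> E i *m E j = - (E j *m E i).
Proof.
move=> /(_ i j) + /negbTE ij; rewrite ij mul0rn oppr0 => h.
by apply/eqP; rewrite -addr_eq0 h -scalemx1 scale0r.
Qed.

(* The same sign and the same index set serve every Clifford family: this is
   what makes the symbol map multiplicative. *)
Lemma clifford_insert i s : sorted ltI s ->
  exists (b : bool) s', [/\ sorted ltI s', {subset s' <= i :: s} &
    forall N (E : 'I_n -> 'M[R[i]]_N), clifford_family E ->
      E i *m cliff_word E s = (-1) ^+ b *: cliff_word E s'].
Proof.
have ltT : transitive ltI by move=> x y z; exact: ltn_trans.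
elim: s => [|j s IH] so.
  exists false, [:: i]; split => // N E _.
  by rewrite cliff_word_cons expr0 scale1r.
have [ij|ji|ij] := ltngtP i j.
- exists false, (i :: j :: s); split => //=; first by rewrite /ltI ij.
  by move=> N E _; rewrite scale1r -cliff_word_cons.
- have so' := path_sorted so.
  have [b [s' [so1 sub h]]] := IH so'.
  exists (~~ b), (j :: s'); split => //=.
  (* The inclusion in the statement exists for this point: all letters of the new word come from
     [i :: s], hence exceed [j]. *)
  + rewrite (path_sortedE ltT) so1 andbT; apply/allP => k /sub.
    rewrite inE => /predU1P[->//|ks].
    by move: so; rewrite /= (path_sortedE ltT) => /andP[/allP/(_ _ ks)].
  + by move=> k; rewrite !inE => /predU1P[->|/sub]; rewrite ?eqxx ?orbT// inE => /orP[->//|->]; rewrite !orbT.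
  + move=> N E cE; rewrite !cliff_word_cons mulmxA (clifford_anti cE); last first.
      by rewrite -val_eqE /= gtn_eqF.
    rewrite mulNmx -mulmxA h// -scalemxAr -scaleNr; congr (_ *: _).
    by case: (b) => /=; rewrite ?expr0 ?expr1 ?opprK.
- have -> : j = i by exact/val_inj.
  exists true, s; split => //; first exact: path_sorted so.
    by move=> k; rewrite !inE => ->; rewrite !orbT.
  move=> N E cE; rewrite cliff_word_cons mulmxA clifford_sqr// expr1.
  by rewrite -scalemx1 -scalemxAl mul1mx.
Qed.

Lemma enum_set_sorted (I : {set 'I_n}) : sorted ltI (enum I).
Proof.
rewrite {1}/enum_mem; apply: sorted_filter; first by move=> x y z; exact: ltn_trans.
rewrite -enumT.
have := iota_ltn_sorted 0 n; rewrite -val_enum_ord sorted_map.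
by [].
Qed.

Lemma cliff_word_sorted N (E : 'I_n -> 'M[R[i]]_N) s : sorted ltI s ->
  cliff_word E s = cliff_prod E [set x in s]%SET.
Proof.
move=> so; rewrite /cliff_word /cliff_prod; congr (\prod_(i <- _) _).
apply: (@irr_sorted_eq _ ltI).
- by move=> x y z; exact: ltn_trans.
- by move=> x; rewrite /ltI ltnn.
- exact: so.
- exact: enum_set_sorted.
- by move=> x; rewrite mem_enum inE.
Qed.

(** Insertion sort, one letter at a time; sign and set are chosen before the family [E]. *)
Lemma clifford_normal_order s : exists (b : bool) (I : {set 'I_n}),
  forall N (E : 'I_n -> 'M[R[i]]_N), clifford_family E ->
    cliff_word E s = (-1) ^+ b *: cliff_prod E I.
Proof.
suff [b [s' [so h]]] : exists (b : bool) s', sorted ltI s' /\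
    forall N (E : 'I_n -> 'M[R[i]]_N), clifford_family E ->
    cliff_word E s = (-1) ^+ b *: cliff_word E s'.
  exists b, [set x in s']%SET => N E cE.
  by rewrite h// cliff_word_sorted.
elim: s => [|i s [b [s' [so h]]]].
  by exists false, [::]; split => // N E _; rewrite scale1r.
have [b' [s'' [so' _ h']]] := clifford_insert i so.
exists (b (+) b'), s''; split => // N E cE.
by rewrite cliff_word_cons h// -scalemxAr h'// scalerA -signr_addb.
Qed.

(** Every letter other than [j] costs a sign. Their number is size minus count; the sum has the same
    parity and avoids truncated subtraction. *)
Lemma cliff_word_comm N (E : 'I_n -> 'M[R[i]]_N) j s : clifford_family E ->
  E j *m cliff_word E s =
  (-1) ^+ (size s + count_mem j s) *: (cliff_word E s *m E j).
Proof.
move=> cE; elim: s => [|i s IH]; first by rewrite cliff_word_nil mulmx1 mul1mx scale1r.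
rewrite cliff_word_cons /=; have [eij|ij] := eqVneq i j.
  subst i; rewrite -mulmxA {1}IH -scalemxAr; congr (_ *: _).
  by rewrite ?eqxx addSn add1n addnS !exprS mulrA mulrNN mulr1 mul1r.
have ji : E j *m E i = - (E i *m E j) by rewrite (clifford_anti cE)// eq_sym.
rewrite mulmxA ji mulNmx -(mulmxA (E i) (E j)) IH -scalemxAr.
by rewrite mulmxA -scaleNr addSn exprS mulN1r add0n.
Qed.

(** Each letter of [s] occurs exactly once in [t], so it anticommutes with size t - 1 letters, a
    number of the parity of [(size t).+1]. *)
Lemma cliff_word_commw N (E : 'I_n -> 'M[R[i]]_N) t s : clifford_family E ->
  uniq t -> {subset s <= t} ->
  cliff_word E t *m cliff_word E s =
  (-1) ^+ (size s * (size t).+1) *: (cliff_word E s *m cliff_word E t).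
Proof.
move=> cE ut; elim: s => [|i s IH] st.
  by rewrite cliff_word_nil mulmx1 mul1mx scale1r.
have it : i \in t by apply: st; rewrite mem_head.
rewrite cliff_word_cons mulmxA.
have -> : cliff_word E t *m E i = (-1) ^+ (size t).+1 *: (E i *m cliff_word E t).
  rewrite cliff_word_comm// count_uniq_mem// it addn1 scalerA -exprMn.
  by rewrite mulrNN mulr1 expr1n scale1r.
rewrite -scalemxAl -mulmxA IH; last by move=> x xs; apply: st; rewrite inE xs orbT.
by rewrite -scalemxAr scalerA -exprD mulmxA /= mulSn.
Qed.

(** For a word of length k there are 'C(k, 2) transpositions and k squares equal to -1, together
    'C(k+1, 2) signs. *)
Lemma cliff_word_sqr N (E : 'I_n -> 'M[R[i]]_N) s : clifford_family E ->
  uniq s ->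
  cliff_word E s *m cliff_word E s = (-1) ^+ 'C((size s).+1, 2) *: 1%:M.
Proof.
move=> cE; elim: s => [|i s IH]; first by rewrite cliff_word_nil mulmx1 scale1r.
move=> /= /andP[si us].
rewrite cliff_word_cons -mulmxA.
have -> : cliff_word E s *m (E i *m cliff_word E s) =
    (-1) ^+ size s *: (E i *m (cliff_word E s *m cliff_word E s)).
  rewrite mulmxA.
  have -> : cliff_word E s *m E i = (-1) ^+ size s *: (E i *m cliff_word E s).
    rewrite cliff_word_comm// count_uniq_mem// (negbTE si) addn0 scalerA.
    by rewrite -exprMn mulrNN mulr1 expr1n scale1r.
  by rewrite -scalemxAl -mulmxA.
rewrite IH// -!scalemxAr mulmx1 (clifford_sqr _ cE) !scale_scalar_mx mulr1.
by rewrite [in RHS]binS bin1 exprD exprS mulrN1 mulN1r !mulrN mulrC.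
Qed.

Lemma cliff_word_enumT N (E : 'I_n -> 'M[R[i]]_N) :
  cliff_word E (enum 'I_n) = cliff_prod E finset.setT.
Proof.
rewrite /cliff_word /cliff_prod; congr (\prod_(i <- _) _).
by apply: eq_enum => i; rewrite finset.in_setT.
Qed.

Hypothesis n_even : ~~ odd n.

(** A trace equal to its opposite vanishes. If I is odd, its product anticommutes with the top
    product and cyclicity of the trace gives the sign. If I is even, some [j] lies outside I; E_j
    commutes with the product over I and anticommutes with the top one, so multiplying by E_j on
    both sides fixes the product, while cyclicity turns it into multiplication by E_j^2 = -1. *)
Lemma trace_cliff_prod N (E : 'I_n -> 'M[R[i]]_N) (I : {set 'I_n}) :
  clifford_family E -> I != finset.setT ->
  \tr (cliff_prod E finset.setT *m cliff_prod E I) = 0.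
Proof.
move=> cE IT.
have tr0 : forall X : 'M[R[i]]_N, \tr X = - \tr X -> \tr X = 0.
  move=> X h; apply/eqP; have : \tr X *+ 2 == 0 by rewrite mulr2n {1}h addNr.
  by rewrite mulrn_eq0.
have cT : forall s, cliff_word E (enum 'I_n) *m cliff_word E s =
    (-1) ^+ size s *: (cliff_word E s *m cliff_word E (enum 'I_n)).
  move=> s; rewrite cliff_word_commw ?enum_uniq//; last first.
    by move=> x _; rewrite mem_enum.
  by rewrite size_enum_ord -signr_odd oddM /= n_even andbT signr_odd.
rewrite -cliff_word_enumT -[cliff_prod E I]/(cliff_word E (enum I)).
have [oI|eI] := boolP (odd #|I|).
  apply: tr0; rewrite {1}cT linearZ /= mxtrace_mulC -signr_odd -cardE oI.
  by rewrite expr1 mulN1r.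
have [j jI] : exists j, j \notin I.
  apply/existsP; rewrite -negb_forall; apply: contra IT => /forallP h.
  by apply/eqP/setP => j; rewrite inE h.
have jE : E j *m cliff_word E (enum I) = cliff_word E (enum I) *m E j.
  rewrite cliff_word_comm// count_uniq_mem ?enum_uniq// mem_enum (negbTE jI).
  by rewrite addn0 -cardE -signr_odd (negbTE eI) scale1r.
have jT : E j *m cliff_word E (enum 'I_n) = - (cliff_word E (enum 'I_n) *m E j).
  have -> : E j = cliff_word E [:: j].
    by rewrite cliff_word_cons cliff_word_nil mulmx1.
  by rewrite cT /= expr1 scaleN1r opprK.
apply: tr0; set X := _ *m _.
have h : E j *m (X *m E j) = X.
  rewrite /X -(mulmxA _ _ (E j)) -jE mulmxA mulmxA jT mulNmx -(mulmxA _ (E j) (E j)).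
  by rewrite (clifford_sqr _ cE) mulNmx mul_mx_scalar scaleN1r mulNmx opprK.
by rewrite -{1}h mxtrace_mulC -mulmxA (clifford_sqr _ cE) mul_mx_scalar scaleN1r linearN.
Qed.

(** For n even, n(n+1)/2 has the parity of n/2. *)
Lemma cliff_prod_setT_sqr N (E : 'I_n -> 'M[R[i]]_N) : clifford_family E ->
  cliff_prod E finset.setT *m cliff_prod E finset.setT = ((-1) ^+ n./2)%:M.
Proof.
move=> cE; rewrite -cliff_word_enumT cliff_word_sqr ?enum_uniq// size_enum_ord.
rewrite scale_scalar_mx mulr1; congr (_%:M).
rewrite -signr_odd -[in RHS]signr_odd; congr (_ ^+ nat_of_bool _).
rewrite -{1}(odd_double_half n) (negbTE n_even) add0n bin2 /= -doubleMr doubleK.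
by rewrite oddM /= odd_double.
Qed.

End CliffordWords.

(** * The Clifford action on exterior forms *)

Section FormRepresentation.
Variables (R : realType) (n : nat).
Implicit Types (i j : 'I_n) (A B I : {set 'I_n}).

(** Exactly one of the wedge and the contraction by index [i] acts nontrivially on a basis form, and
    either one toggles [i]. So [cform R i] is a signed permutation matrix along [flip i]. *)
Definition flip i B : {set 'I_n} := if i \in B then (B :\ i)%SET else (i |: B)%SET.

Definition cform_sign i B : R[i] :=
  (-1) ^+ (i \in B) * wedge_sign R i B.

Lemma in_flip i B k : (k \in flip i B) = (k == i) (+) (k \in B).
Proof.
rewrite /flip; case: ifP => iB; rewrite !inE; case: eqVneq => [->|] //=.
  by rewrite iB.
by rewrite iB.
Qed.

Lemma flipK i : involutive (flip i).
Proof. by move=> B; apply/setP => k; rewrite !in_flip addKb. Qed.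

Lemma flipC i j B : flip i (flip j B) = flip j (flip i B).
Proof. by apply/setP => k; rewrite !in_flip addbCA. Qed.

Lemma cformE i A B :
  cform R i (enum_rank A) (enum_rank B) =
  if A == flip i B then cform_sign i B else 0.
Proof.
rewrite /cform /wedge_mx /contract_mx /form_mx !mxE !enum_rankK /flip /cform_sign.
by case: (i \in B) => /=; case: eqP => _; rewrite ?subr0 ?sub0r ?expr1 ?mul1r ?mulN1r ?oppr0.
Qed.

Lemma form_mxP (X Y : 'M[R[i]]_(formdim n)) :
  (forall A B, X (enum_rank A) (enum_rank B) = Y (enum_rank A) (enum_rank B)) ->
  X = Y.
Proof. by move=> h; apply/matrixP => k l; rewrite -(enum_valK k) -(enum_valK l). Qed.

Lemma cform_mulE i (X : 'M[R[i]]_(formdim n)) A B :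
  (X *m cform R i) (enum_rank A) (enum_rank B) =
  X (enum_rank A) (enum_rank (flip i B)) * cform_sign i B.
Proof.
rewrite mxE (bigD1 (enum_rank (flip i B)))//= cformE eqxx big1 ?addr0// => k kB.
rewrite -(enum_valK k) cformE ifF ?mulr0//; apply: contra_neqF kB => /eqP <-.
by rewrite enum_valK.
Qed.

Lemma wedge_sign_flip i j B : i != j ->
  wedge_sign R i (flip j B) = (-1) ^+ (j < i)%N * wedge_sign R i B.
Proof.
move=> ij; rewrite /wedge_sign -signr_odd -[in RHS](signr_odd _ #|_|) -signr_addb.
congr (_ ^+ nat_of_bool _).
have [ji|ji] := ltnP j i; last first.
  congr (odd _); apply: eq_card => k; rewrite !inE in_flip.
  by case: eqVneq => [->|]//=; rewrite ltnNge ji/= andbF andbF.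
rewrite (cardsD1 j) [in RHS](cardsD1 j) !inE in_flip eqxx ji !andbT.
rewrite !oddD !oddb -addbA; congr (_ (+) (_ (+) odd _)).
by apply: eq_card => k; rewrite !inE in_flip; case: eqVneq.
Qed.

Lemma wedge_sign_flip_same i B : wedge_sign R i (flip i B) = wedge_sign R i B.
Proof.
rewrite /wedge_sign; congr (_ ^+ _); apply: eq_card => k; rewrite !inE in_flip.
by case: eqVneq => [->|]//=; rewrite ltnn !andbF.
Qed.

(** For i = j the two crossings have the same wedge sign, and one of them is a contraction, which
    carries the minus sign. For distinct indices both orders reach the same basis form, and since
    exactly one of i < j, j < i holds, exactly one wedge sign changes. *)
Lemma cform_clifford : clifford_family (@cform R n).
Proof.
move=> i j; apply: form_mxP => A B.
rewrite mxE !cform_mulE !cformE [in RHS]mxE (inj_eq enum_rank_inj).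
have [<-|ij] := eqVneq i j.
  rewrite flipK; case: eqVneq => _; last by rewrite !mul0r addr0.
  rewrite /cform_sign in_flip eqxx /= wedge_sign_flip_same mulr1n -mulr2n.
  rewrite mulrACA -signr_addb addNb addbb /= expr1 mulN1r /wedge_sign.
  by rewrite -exprMn mulrNN mulr1 expr1n mulNrn mulr1n.
rewrite mul0rn oppr0 mul0rn flipC; case: eqVneq => _; last by rewrite !mul0r addr0.
rewrite /cform_sign !in_flip (negbTE ij) eq_sym (negbTE ij) /=.
rewrite !wedge_sign_flip//; last by rewrite eq_sym.
have [ji|ij'|e] := ltngtP j i; last by move: ij; rewrite (val_inj e) eqxx.
  by rewrite /= expr1 expr0; ring.
by rewrite /= expr1 expr0; ring.
Qed.

Lemma mul_cformE i (X : 'M[R[i]]_(formdim n)) A B :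
  (cform R i *m X) (enum_rank A) (enum_rank B) =
  cform_sign i (flip i A) * X (enum_rank (flip i A)) (enum_rank B).
Proof.
rewrite mxE (bigD1 (enum_rank (flip i A)))//= cformE flipK eqxx big1 ?addr0// => k kB.
rewrite -(enum_valK k) cformE ifF ?mul0r//; apply: contra_neqF kB => /eqP ->.
by rewrite flipK enum_valK.
Qed.

(** The letters act from the right, so each new index is smaller than all those present: it is never
    contracted, and it is wedged in front with sign +1. *)
Lemma cform_word_one A (s : seq 'I_n) :
  sorted (fun i j : 'I_n => (i < j)%N) s ->
  cliff_word (@cform R n) s (enum_rank A) (enum_rank finset.set0) =
  (A == [set x in s]%SET)%:R.
Proof.
have ltT : transitive (fun i j : 'I_n => (i < j)%N) by move=> x y z; exact: ltn_trans.
elim: s A => [|i s IH] A so.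
  rewrite cliff_word_nil mxE (inj_eq enum_rank_inj); rewrite (_ : [set x in [::]]%SET = finset.set0)//.
have := so; rewrite /= (path_sortedE ltT) => /andP[/allP is_ so'].
have nis : i \notin s by apply/negP => /is_; rewrite ltnn.
rewrite cliff_word_cons mul_cformE IH//.
have -> : (flip i A == [set x in s]%SET) = (A == [set x in i :: s]%SET).
  rewrite -(inj_eq (inv_inj (flipK i))) flipK; congr (_ == _).
  by rewrite /flip inE (negbTE nis); apply/setP => k; rewrite !inE.
case: eqVneq => [->|_]; last by rewrite mulr0.
have -> : flip i [set x in i :: s]%SET = [set x in s]%SET.
  apply/setP => k; rewrite in_flip !inE; case: eqVneq => [->|]//=.
  by rewrite (negbTE nis).
rewrite /cform_sign inE (negbTE nis) mul1r mulr1 /wedge_sign.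
rewrite (_ : [set j in _ | _]%SET = finset.set0) ?cards0//.
apply/setP => k; rewrite !inE; apply/negP => /andP[/is_].
by move=> /ltn_trans h /h; rewrite ltnn.
Qed.

Lemma cform_prod_one A I :
  cliff_prod (@cform R n) I (enum_rank A) (enum_rank finset.set0) = (A == I)%:R.
Proof.
rewrite -[cliff_prod _ _]/(cliff_word _ (enum I)) cform_word_one ?enum_set_sorted//.
rewrite (_ : [set x in enum I]%SET = I)//.
by apply/setP => x; rewrite inE mem_enum.
Qed.

End FormRepresentation.

(** * The Clifford algebra as a matrix algebra and its symbol map *)

Section SymbolMap.
Variables (R : realType) (n : nat).

Lemma clifford_mul (I J : {set 'I_n}) : exists (b : bool) (K : {set 'I_n}),
  forall N (F : 'I_n -> 'M[R[i]]_N), clifford_family F ->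
    cliff_prod F I *m cliff_prod F J = (-1) ^+ b *: cliff_prod F K.
Proof.
have [b [K h]] := clifford_normal_order R (enum I ++ enum J).
by exists b, K => N F cF; rewrite -h// cliff_word_cat.
Qed.

Lemma cliff_prod0 N (F : 'I_n -> 'M[R[i]]_N) : cliff_prod F finset.set0 = 1%:M.
Proof. by rewrite /cliff_prod enum_set0 big_nil. Qed.

Lemma cliff_prod_sqr (I : {set 'I_n}) : exists b : bool,
  forall N (F : 'I_n -> 'M[R[i]]_N), clifford_family F ->
    cliff_prod F I *m cliff_prod F I = (-1) ^+ b *: 1%:M.
Proof.
exists (odd 'C((size (enum I)).+1, 2)) => N F cF.
by rewrite signr_odd -(cliff_word_sqr cF (enum_uniq I)).
Qed.

Hypothesis n_even : ~~ odd n.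
Variable E : 'I_n -> 'M[R[i]]_(spindim n).
Hypothesis cE : clifford_family E.

Let Etop := cliff_prod E finset.setT.

Lemma trace_cliff_prod_setT_sqr :
  \tr (Etop *m Etop) = (-2) ^+ n./2 :> R[i].
Proof.
rewrite /Etop cliff_prod_setT_sqr// mxtrace_scalar /spindim -[_ *+ (2 ^ _)]mulr_natr natrX.
by rewrite -exprMn mulN1r.
Qed.

(** For each I there is K with E_K E_I equal to the top product up to sign. Pairing the relation
    with the top product times E_K under the trace isolates the coefficient of I. *)
Lemma cliff_prod_free (a : {set 'I_n} -> R[i]) :
  \sum_I a I *: cliff_prod E I = 0 -> forall I, a I = 0.
Proof.
move=> a0 I.
have sgn b : (-1) ^+ nat_of_bool b * (-1) ^+ nat_of_bool b = 1 :> R[i].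
  by rewrite -exprMn mulrNN mulr1 expr1n.
have [b [K hK]] := clifford_mul finset.setT I.
have [bI sqI] := cliff_prod_sqr I.
have [bK sqK] := cliff_prod_sqr K.
(* E_K E_I = +- E_top, and E_K E_J = +- E_top only for J = I *)
have KI N (F : 'I_n -> 'M[R[i]]_N) : clifford_family F ->
    cliff_prod F K *m cliff_prod F I = (-1) ^+ (b (+) bI) *: cliff_prod F finset.setT.
  move=> cF; have -> : cliff_prod F K =
      (-1) ^+ b *: (cliff_prod F finset.setT *m cliff_prod F I).
    by rewrite hK// scalerA sgn scale1r.
  by rewrite -scalemxAl -mulmxA sqI// -scalemxAr mulmx1 scalerA -signr_addb.
have tr0 J : J != I -> \tr (Etop *m (cliff_prod E K *m cliff_prod E J)) = 0.
  move=> JI; have [c [L hL]] := clifford_mul K J.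
  rewrite hL// -scalemxAr linearZ /= trace_cliff_prod ?mulr0//.
  (* If J also completed K to the top product, this would hold in every Clifford family. On forms,
     cancelling the factor K makes the products over J and I equal up to sign; applied to 1 they
     give distinct basis forms. *)
  apply: contra JI => /eqP LT; subst L.
  have cF := @cform_clifford R n.
  have e : cliff_prod (@cform R n) J =
      (-1) ^+ (b (+) bI (+) c) *: cliff_prod (@cform R n) I.
    have h : cliff_prod (@cform R n) K *m cliff_prod (@cform R n) J =
        (-1) ^+ (b (+) bI (+) c) *: (cliff_prod (@cform R n) K *m cliff_prod (@cform R n) I).
      rewrite hL// KI// scalerA -signr_addb; congr ((-1) ^+ nat_of_bool _ *: _).
      by case: (b); case: (bI); case: (c).
    have := congr1 (fun X => (-1) ^+ bK *: (cliff_prod (@cform R n) K *m X)) h.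
    rewrite /= -scalemxAr !mulmxA sqK// -!scalemxAl !mul1mx.
    by rewrite !scalerA sgn scale1r mulrCA sgn mulr1.
  have := congr1 (fun X : 'M[R[i]]_(formdim n) => X (enum_rank J) (enum_rank finset.set0)) e.
  rewrite mxE !cform_prod_one eqxx; case: eqP => //= _ /eqP.
  by rewrite mulr0 oner_eq0.
have := congr1 (fun X => \tr (Etop *m (cliff_prod E K *m X))) a0.
rewrite /= !mulmx0 linear0 !mulmx_sumr linear_sum /= (bigD1 I)//= big1 ?addr0.
  rewrite -!scalemxAr linearZ /= KI// -scalemxAr linearZ /= trace_cliff_prod_setT_sqr.
  move=> /eqP; rewrite !mulf_eq0 signr_eq0 expf_eq0 oppr_eq0 pnatr_eq0 andbF orbF.
  by rewrite orbF => /eqP.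
by move=> J JI; rewrite -!scalemxAr linearZ /= tr0// mulr0.
Qed.

Let basis : 'M[R[i]]_(formdim n, spindim n * spindim n) :=
  \matrix_k mxvec (cliff_prod E (enum_val k)).

Let basis_mul (v : 'rV[R[i]]_(formdim n)) :
  v *m basis = mxvec (\sum_I v 0 (enum_rank I) *: cliff_prod E I).
Proof.
rewrite mulmx_sum_row linear_sum /= (reindex (@enum_rank _)) /=; last first.
  by apply: onW_bij; exact: enum_rank_bij.
by apply: eq_bigr => I _; rewrite rowK enum_rankK linearZ.
Qed.

Let basis_free : row_free basis.
Proof.
apply: inj_row_free => v; rewrite basis_mul => /eqP.
rewrite mxvec_eq0 => /eqP /cliff_prod_free h.
by apply/rowP => k; rewrite mxE -(enum_valK k) h.
Qed.

(** Dimension count: for n even, 2^n independent products fill a space of dimension (2^(n/2))^2. *)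
Let basis_full : row_full basis.
Proof.
rewrite /row_full; move/eqP: basis_free => ->; rewrite /formdim.
rewrite -cardsT -powersetT card_powerset cardsT card_ord /spindim -expnD addnn.
by rewrite -{1}(odd_double_half n) (negbTE n_even).
Qed.

Definition cliff_coef (I : {set 'I_n}) (X : 'M[R[i]]_(spindim n)) : R[i] :=
  (mxvec X *m pinvmx basis) 0 (enum_rank I).

Lemma cliff_coefE X : X = \sum_I cliff_coef I X *: cliff_prod E I.
Proof.
apply: (can_inj mxvecK); rewrite -basis_mul mulmxKpV//.
exact: submx_full.
Qed.

Lemma cliff_coef_sum (a : {set 'I_n} -> R[i]) I :
  cliff_coef I (\sum_J a J *: cliff_prod E J) = a I.
Proof.
set X := \sum_J _.
have h : \sum_J (cliff_coef J X - a J) *: cliff_prod E J = 0.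
  under eq_bigr do rewrite scalerBl.
  by rewrite sumrB -cliff_coefE /X subrr.
by have /eqP := cliff_prod_free h I; rewrite subr_eq0 => /eqP.
Qed.

Variables (N : nat) (F : 'I_n -> 'M[R[i]]_N).
Hypothesis cF : clifford_family F.

(* For F = cform this is the Clifford map c^g. *)
Definition cliff_map (X : 'M[R[i]]_(spindim n)) : 'M[R[i]]_N :=
  \sum_I cliff_coef I X *: cliff_prod F I.

Lemma cliff_map_sum (a : {set 'I_n} -> R[i]) :
  cliff_map (\sum_J a J *: cliff_prod E J) = \sum_J a J *: cliff_prod F J.
Proof. by apply: eq_bigr => J _; rewrite cliff_coef_sum. Qed.

Lemma cliff_map_is_linear : linear cliff_map.
Proof.
move=> k X Y; rewrite /cliff_map scaler_sumr -big_split /=.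
apply: eq_bigr => I _; rewrite /cliff_coef linearP mulmxDl -scalemxAl !mxE.
by rewrite scalerDl scalerA.
Qed.

HB.instance Definition _ :=
  GRing.isLinear.Build R[i] 'M[R[i]]_(spindim n) 'M[R[i]]_N _ cliff_map
    cliff_map_is_linear.

Lemma cliff_map_prod I : cliff_map (cliff_prod E I) = cliff_prod F I.
Proof.
have h (G : {set 'I_n} -> 'M[R[i]]_(spindim n)) N' (G' : {set 'I_n} -> 'M[R[i]]_N') :
    \sum_J (J == I)%:R *: G' J = G' I.
  rewrite (bigD1 I)//= eqxx scale1r big1 ?addr0// => J /negbTE ->.
  by rewrite scale0r.
by rewrite -(h (cliff_prod E) _ (cliff_prod E)) cliff_map_sum h.
Qed.

Lemma cliff_map1 : cliff_map 1%:M = 1%:M.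
Proof. by rewrite -(cliff_prod0 E) cliff_map_prod cliff_prod0. Qed.

(** By bilinearity it suffices to multiply basis products, and [clifford_mul] gives the same sign
    and the same set for [E] and for [F]. *)
Lemma cliff_mapM X Y : cliff_map (X *m Y) = cliff_map X *m cliff_map Y.
Proof.
have hI I : cliff_map (cliff_prod E I *m Y) = cliff_prod F I *m cliff_map Y.
  rewrite {1}(cliff_coefE Y) mulmx_sumr linear_sum /cliff_map mulmx_sumr.
  apply: eq_bigr => J _; rewrite -!scalemxAr linearZ /=; congr (_ *: _).
  have [b [K h]] := clifford_mul I J.
  by rewrite !h// linearZ /= -/(cliff_map _) cliff_map_prod.
rewrite {1}(cliff_coefE X) mulmx_suml linear_sum /= [in RHS]/cliff_map mulmx_suml.
by apply: eq_bigr => I _; rewrite -!scalemxAl linearZ /= hI.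
Qed.

Lemma supertraceE X : supertrace E X = \tr (chirality E *m X).
Proof.
rewrite /supertrace; move: (chirality E) => G.
rewrite -!scalemxAl !mxtraceZ -mulrBr.
rewrite mulmxDl mulmxBl mul1mx.
rewrite -(raddfB (@mxtrace R[i] (spindim n))) /=.
rewrite opprB addrC subrKA -mulr2n raddfMn /=.
by rewrite -[X in _ * X]mulr_natl mulrA mulVf ?mul1r// pnatr_eq0.
Qed.

End SymbolMap.

(** The trace against the chirality kills every basis product but the top one, whose trace is
    i^(n/2) (-1)^(n/2) 2^(n/2). On forms, the entry of [top_of_one] reads off the same
    coefficient. *)
Lemma supertrace_top (R : realType) (n : nat) (n_even : ~~ odd n)
    (E : 'I_n -> 'M[R[i]]_(spindim n)) (cE : clifford_family E) X :
  supertrace E X =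
  (- 2 * 'i%C) ^+ n./2 * top_of_one (cliff_map E (@cform R n) X).
Proof.
rewrite supertraceE /top_of_one summxE {1}(cliff_coefE n_even cE X).
rewrite mulmx_sumr linear_sum mulr_sumr /=; apply: eq_bigr => I _.
rewrite mxE cform_prod_one -scalemxAr linearZ /= /chirality -scalemxAl linearZ /=.
case: eqVneq => [<-|IT].
  by rewrite trace_cliff_prod_setT_sqr// -exprMn mulr1 mulrC [in RHS]mulrC mulrC (mulrC 'i%C).
by rewrite trace_cliff_prod// 1?eq_sym// !mulr0.
Qed.

(** * Limits and derivatives of matrix-valued functions *)

Section MatrixLimits.
Variables (K : numFieldType) (T : Type) (F : set_system T).
Hypothesis FF : Filter F.

Definition mx_cvg (m n : nat) (f : T -> 'M[K]_(m, n)) (a : 'M[K]_(m, n)) :=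
  forall i j, f t i j @[t --> F] --> a i j.

Lemma cvg_bigsum (I : Type) (r : seq I) (P : pred I) (f : I -> T -> K) (a : I -> K) :
  (forall i, P i -> f i t @[t --> F] --> a i) ->
  (\sum_(i <- r | P i) f i t) @[t --> F] --> \sum_(i <- r | P i) a i.
Proof.
move=> h; elim: r => [|i r IH].
  under eq_fun do rewrite big_nil; rewrite big_nil; exact: cvg_cst.
rewrite big_cons; under eq_fun do rewrite big_cons.
by case: ifP => Pi //; apply: cvgD => //; exact: h.
Qed.

Lemma cvg_bigprod (I : Type) (r : seq I) (P : pred I) (f : I -> T -> K) (a : I -> K) :
  (forall i, P i -> f i t @[t --> F] --> a i) ->
  (\prod_(i <- r | P i) f i t) @[t --> F] --> \prod_(i <- r | P i) a i.
Proof.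
move=> h; elim: r => [|i r IH].
  under eq_fun do rewrite big_nil; rewrite big_nil; exact: cvg_cst.
rewrite big_cons; under eq_fun do rewrite big_cons.
by case: ifP => Pi //; apply: cvgM => //; exact: h.
Qed.

Lemma mx_cvg_cst m n (a : 'M[K]_(m, n)) : mx_cvg (fun=> a) a.
Proof. by move=> i j; exact: cvg_cst. Qed.

Lemma mx_cvgD m n (f g : T -> 'M[K]_(m, n)) a b :
  mx_cvg f a -> mx_cvg g b -> mx_cvg (fun t => f t + g t) (a + b).
Proof.
by move=> fa gb i j; rewrite mxE; under eq_fun do rewrite mxE; exact: cvgD.
Qed.

Lemma mx_cvgN m n (f : T -> 'M[K]_(m, n)) a :
  mx_cvg f a -> mx_cvg (fun t => - f t) (- a).
Proof.
by move=> fa i j; rewrite mxE; under eq_fun do rewrite mxE; exact: cvgN.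
Qed.

Lemma mx_cvgB m n (f g : T -> 'M[K]_(m, n)) a b :
  mx_cvg f a -> mx_cvg g b -> mx_cvg (fun t => f t - g t) (a - b).
Proof. by move=> fa gb; apply: mx_cvgD => //; exact: mx_cvgN. Qed.

Lemma mx_cvgZ m n (c : T -> K) (f : T -> 'M[K]_(m, n)) (d : K) a :
  c t @[t --> F] --> d -> mx_cvg f a -> mx_cvg (fun t => c t *: f t) (d *: a).
Proof.
by move=> cd fa i j; rewrite mxE; under eq_fun do rewrite mxE; exact: cvgM.
Qed.

Lemma mx_cvgM m n p (f : T -> 'M[K]_(m, n)) (g : T -> 'M[K]_(n, p)) a b :
  mx_cvg f a -> mx_cvg g b -> mx_cvg (fun t => f t *m g t) (a *m b).
Proof.
move=> fa gb i j; rewrite mxE; under eq_fun do rewrite mxE.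
by apply: cvg_bigsum => k _; exact: cvgM.
Qed.

Lemma mx_cvg_sum m n (I : Type) (r : seq I) (P : pred I)
    (f : I -> T -> 'M[K]_(m, n)) (a : I -> 'M[K]_(m, n)) :
  (forall i, P i -> mx_cvg (f i) (a i)) ->
  mx_cvg (fun t => \sum_(i <- r | P i) f i t) (\sum_(i <- r | P i) a i).
Proof.
move=> h i j; rewrite summxE; under eq_fun do rewrite summxE.
by apply: cvg_bigsum => k Pk; exact: h.
Qed.

Lemma mx_cvg_det n (f : T -> 'M[K]_n) a :
  mx_cvg f a -> \det (f t) @[t --> F] --> \det a.
Proof.
move=> fa; apply: cvg_bigsum => s _; apply: cvgM; first exact: cvg_cst.
by apply: cvg_bigprod => i _; exact: fa.
Qed.

Lemma mx_cvg_adj n (f : T -> 'M[K]_n) a :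
  mx_cvg f a -> mx_cvg (fun t => \adj (f t)) (\adj a).
Proof.
move=> fa i j; rewrite mxE /cofactor; under eq_fun do rewrite mxE /cofactor.
apply: cvgM; first exact: cvg_cst.
by apply: mx_cvg_det => k l; rewrite !mxE; under eq_fun do rewrite !mxE; exact: fa.
Qed.

Lemma mx_cvg_unit n (f : T -> 'M[K]_n) a :
  mx_cvg f a -> a \in unitmx -> \forall t \near F, f t \in unitmx.
Proof.
move=> fa; rewrite unitmxE unitfE => a0.
have /cvgrPdist_lt/(_ `|\det a|) := mx_cvg_det fa.
rewrite normr_gt0 a0 => /(_ isT).
apply: filterS => t; apply: contraPT; rewrite unitmxE unitfE negbK => /eqP ->.
by rewrite subr0 ltxx.
Qed.

(** By Cramer's formula the inverse is the adjugate over the determinant, but [invmx] has this value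
    only on invertible matrices, so the two functions are compared near the limit. *)
Lemma mx_cvgV n (f : T -> 'M[K]_n) a :
  mx_cvg f a -> a \in unitmx -> mx_cvg (fun t => invmx (f t)) (invmx a).
Proof.
move=> fa au i j; have fu := mx_cvg_unit fa au.
have h : mx_cvg (fun t => (\det (f t))^-1 *: \adj (f t)) ((\det a)^-1 *: \adj a).
  apply: mx_cvgZ; last exact: mx_cvg_adj.
  apply: cvgV; last exact: mx_cvg_det.
  by rewrite -unitfE -unitmxE.
rewrite /invmx au; apply: cvg_trans (h i j).
apply: near_eq_cvg; near=> t; rewrite ifT//; near: t; exact: fu.
Unshelve. all: by end_near. Qed.

Lemma near_eq_mx_cvg m n (f g : T -> 'M[K]_(m, n)) a :
  (\forall t \near F, f t = g t) -> mx_cvg f a -> mx_cvg g a.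
Proof.
move=> fg fa i j; apply: cvg_trans (fa i j); apply: near_eq_cvg.
by apply: filterS fg => t ->.
Qed.

Lemma mx_cvg_linear m n p q (L : {linear 'M[K]_(m, n) -> 'M[K]_(p, q)})
    (f : T -> 'M[K]_(m, n)) a :
  mx_cvg f a -> mx_cvg (fun t => L (f t)) (L a).
Proof.
move=> fa.
have LE X : L X = \sum_i \sum_j X i j *: L (delta_mx i j).
  rewrite {1}(matrix_sum_delta X) linear_sum; apply: eq_bigr => i _.
  by rewrite linear_sum; apply: eq_bigr => j _; rewrite linearZ.
rewrite LE; under [X in mx_cvg X]funext do rewrite LE.
apply: mx_cvg_sum => i _; apply: mx_cvg_sum => j _; apply: mx_cvgZ; first exact: fa.
exact: mx_cvg_cst.
Qed.

End MatrixLimits.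

Section MatrixDerivatives.
Variables (K : numFieldType) (T : Type) (F : set_system T).
Hypothesis FF : Filter F.
Variable c : T -> K.

(* With c h = h^-1 and f h = u (x + h *: v) this is the derivative of u at x in
   the direction v; both the real and the complex parameters occur below. *)
Definition mx_der (m n : nat) (f : T -> 'M[K]_(m, n)) (a d : 'M[K]_(m, n)) :=
  mx_cvg F f a /\ mx_cvg F (fun t => c t *: (f t - a)) d.

Lemma mx_der_cst m n (a : 'M[K]_(m, n)) : mx_der (fun=> a) a 0.
Proof.
split; first exact: mx_cvg_cst.
by under [X in mx_cvg _ X]funext do rewrite subrr scaler0; exact: mx_cvg_cst.
Qed.

Lemma mx_derD m n (f g : T -> 'M[K]_(m, n)) a b d e :
  mx_der f a d -> mx_der g b e -> mx_der (fun t => f t + g t) (a + b) (d + e).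
Proof.
move=> [fa fd] [gb ge]; split; first exact: mx_cvgD.
under [X in mx_cvg _ X]funext do rewrite opprD addrACA scalerDr.
exact: mx_cvgD.
Qed.

Lemma mx_derZ m n (k : K) (f : T -> 'M[K]_(m, n)) a d :
  mx_der f a d -> mx_der (fun t => k *: f t) (k *: a) (k *: d).
Proof.
move=> [fa fd]; split; first by apply: mx_cvgZ => //; exact: cvg_cst.
under [X in mx_cvg _ X]funext do rewrite -scalerBr scalerA mulrC -scalerA.
by apply: mx_cvgZ => //; exact: cvg_cst.
Qed.

Lemma mx_derN m n (f : T -> 'M[K]_(m, n)) a d :
  mx_der f a d -> mx_der (fun t => - f t) (- a) (- d).
Proof.
move=> /(mx_derZ (-1)); rewrite !scaleN1r.
by under [X in mx_der X]funext do rewrite scaleN1r.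
Qed.

Lemma mx_derM m n p (f : T -> 'M[K]_(m, n)) (g : T -> 'M[K]_(n, p)) a b d e :
  mx_der f a d -> mx_der g b e ->
  mx_der (fun t => f t *m g t) (a *m b) (d *m b + a *m e).
Proof.
move=> [fa fd] [gb ge]; split; first exact: mx_cvgM.
have -> : (fun t => c t *: (f t *m g t - a *m b)) =
    (fun t => (c t *: (f t - a)) *m g t + a *m (c t *: (g t - b))).
  apply/funext => t; rewrite -scalemxAl -scalemxAr -scalerDr; congr (_ *: _).
  by rewrite mulmxBl mulmxBr addrA subrK.
by apply: mx_cvgD => //; apply: mx_cvgM => //; exact: mx_cvg_cst.
Qed.

Lemma mx_der_sum m n (I : Type) (r : seq I) (P : pred I)
    (f : I -> T -> 'M[K]_(m, n)) (a d : I -> 'M[K]_(m, n)) :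
  (forall i, P i -> mx_der (f i) (a i) (d i)) ->
  mx_der (fun t => \sum_(i <- r | P i) f i t) (\sum_(i <- r | P i) a i)
    (\sum_(i <- r | P i) d i).
Proof.
move=> h; elim: r => [|i r IH].
  rewrite !big_nil; under [X in mx_der X]funext do rewrite big_nil.
  exact: mx_der_cst.
rewrite !big_cons; under [X in mx_der X]funext do rewrite big_cons.
by case: ifP => Pi //; apply: mx_derD => //; exact: h.
Qed.

Lemma mx_der_linear m n p q (L : {linear 'M[K]_(m, n) -> 'M[K]_(p, q)})
    (f : T -> 'M[K]_(m, n)) a d :
  mx_der f a d -> mx_der (fun t => L (f t)) (L a) (L d).
Proof.
move=> [fa fd]; split; first exact: mx_cvg_linear.
under [X in mx_cvg _ X]funext do rewrite -linearB -linearZ.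
exact: mx_cvg_linear.
Qed.

(** From the identity f^-1 - a^-1 = - f^-1 (f - a) a^-1, valid where f is invertible. *)
Lemma mx_derV n (f : T -> 'M[K]_n) a d :
  a \in unitmx -> mx_der f a d ->
  mx_der (fun t => invmx (f t)) (invmx a) (- (invmx a *m d *m invmx a)).
Proof.
move=> au [fa fd]; split; first exact: mx_cvgV.
have h : mx_cvg F (fun t => - (invmx (f t) *m (c t *: (f t - a)) *m invmx a))
    (- (invmx a *m d *m invmx a)).
  apply: mx_cvgN; apply: mx_cvgM; last exact: mx_cvg_cst.
  by apply: mx_cvgM => //; exact: mx_cvgV.
apply: near_eq_mx_cvg h; apply: filterS (mx_cvg_unit FF fa au) => t fu.
rewrite -scalemxAr -scalemxAl -scalerN; congr (_ *: _).
by rewrite mulmxBr mulVmx// mulmxBl mul1mx -mulmxA mulmxV// mulmx1 opprB.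
Qed.

Lemma mx_der_continuous m n (f : T -> 'M[K]_(m, n)) a d :
  (\forall t \near F, c t != 0) -> (c t)^-1 @[t --> F] --> (0 : K) ->
  mx_cvg F (fun t => c t *: (f t - a)) d -> mx_der f a d.
Proof.
move=> c0 ci fd; split=> //.
have h : mx_cvg F (fun t => a + (c t)^-1 *: (c t *: (f t - a))) (a + 0 *: d).
  by apply: mx_cvgD; [exact: mx_cvg_cst|exact: mx_cvgZ].
rewrite scale0r addr0 in h; apply: near_eq_mx_cvg h; apply: filterS c0 => t ct.
by rewrite scalerA mulVf// scale1r addrC subrK.
Qed.

End MatrixDerivatives.

Definition fcvg (K : numFieldType) (T : Type) (F : set_system T) (f : T -> K)
  (a : K) : Prop := f t @[t --> F] --> a.

Lemma fcvgP (K : numFieldType) (T : Type) (F : set_system T) (FF : Filter F)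
    (f : T -> K) (a : K) :
  fcvg F f a <-> forall e : K, 0 < e -> \forall t \near F, `|a - f t| < e.
Proof. exact: cvgrPdist_lt. Qed.

(** * Complex limits through real and imaginary parts *)

Section ComplexLimits.
Variable R : realType.

Lemma normc_le_ReIm (z : R[i]) : `|z| <= (`|complex.Re z| + `|complex.Im z|)%:C.
Proof.
rewrite {1}[z]complexE; apply: le_trans (ler_normD _ _) _.
rewrite normrM (_ : `|'i%C : R[i]| = 1); last first.
  by rewrite normc_def /= expr0n /= expr1n add0r sqrtr1.
by rewrite mul1r !normc_def /= expr0n /= !addr0 !sqrtr_sqr rmorphD.
Qed.

Lemma normc_ge_Im (z : R[i]) : `|complex.Im z|%:C <= `|z|.
Proof.
by rewrite normc_def lecR -[leLHS]sqrtr_sqr ler_sqrt ?addr_ge0 ?sqr_ge0// ?lerDr ?sqr_ge0.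
Qed.

Variables (T : Type) (F : set_system T).
Hypothesis FF : Filter F.

Lemma cvg_ReIm (h : T -> R[i]) (z : R[i]) :
  fcvg F h z <->
  (complex.Re (h t) @[t --> F] --> complex.Re z) /\
  (complex.Im (h t) @[t --> F] --> complex.Im z).
Proof.
split=> [hz|[hr hi]].
  split; apply/cvgrPdist_lt => e e0;
    have /fcvgP/(_ e%:C) := hz; rewrite ltcR => /(_ e0); apply: filterS => t ht;
    rewrite -ltcR; apply: le_lt_trans ht.
  - by rewrite -raddfB; exact: normc_ge_Re.
  - by rewrite -raddfB; exact: normc_ge_Im.
apply/fcvgP => e; rewrite ltcE => /= /andP[/eqP ie re].
have re2 : 0 < complex.Re e / 2 by rewrite divr_gt0.
move/cvgrPdist_lt/(_ _ re2) : hr; move/cvgrPdist_lt/(_ _ re2) : hi.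
apply: filterS2 => t hi hr; apply: le_lt_trans (normc_le_ReIm _) _.
rewrite (_ : e = (complex.Re e)%:C); last by rewrite [LHS]complexE ie mulr0 addr0.
by rewrite ltcR (splitr (complex.Re e)) !raddfB ltrD.
Qed.

Lemma cvg_real_complex (u : T -> R) (a : R) :
  u t @[t --> F] --> a -> fcvg F (fun t => (u t)%:C) a%:C.
Proof. by move=> ua; apply/cvg_ReIm; split => //=; exact: cvg_cst. Qed.

End ComplexLimits.

(** * Partial derivatives of complex matrix-valued functions *)

Section DirectionalDerivatives.
Variables (R : realType) (n : nat).
Implicit Types (x v : 'rV[R]_n) (U W : set 'rV[R]_n).

Lemma is_derive_cvg (f : 'rV[R]_n -> R) x v (d : R) :
  is_derive x v f d <->
  (h^-1 * (f (h *: v + x) - f x) @[h --> (0:R)^'] --> d).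
Proof.
split=> [[/cvg_ex[l fl] <-]|fd].
  by rewrite (_ : 'D_v f x = l)//; exact/cvg_lim.
by apply: DeriveDef; [apply/cvg_ex; exists d|exact/cvg_lim].
Qed.

Definition mder (p q : nat) (f : 'rV[R]_n -> 'M[R[i]]_(p, q)) x v
    (d : 'M[R[i]]_(p, q)) :=
  mx_der (0:R)^' (fun h => (h^-1)%:C) (fun h => f (h *: v + x)) (f x) d.

Lemma mderP (p q : nat) (f : 'rV[R]_n -> 'M[R[i]]_(p, q)) x v d :
  mder f x v d <-> forall k l,
    is_derive x v (fun y => complex.Re (f y k l)) (complex.Re (d k l)) /\
    is_derive x v (fun y => complex.Im (f y k l)) (complex.Im (d k l)).
Proof.
have E k l h : (((h^-1)%:C : R[i]) *: (f (h *: v + x) - f x)) k l =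
    (h^-1 * (complex.Re (f (h *: v + x) k l) - complex.Re (f x k l))) +i*
    (h^-1 * (complex.Im (f (h *: v + x) k l) - complex.Im (f x k l))).
  rewrite !mxE; case: (f _ k l) => a b; case: (f _ k l) => a' b' /=.
  by rewrite [LHS]complexE /= mul0r mul0r subr0 addr0 [RHS]complexE.
split=> [[_ fd] k l|fd].
  have /cvg_ReIm[hr hi] := fd k l; split; apply/is_derive_cvg;
    [apply: cvg_trans hr|apply: cvg_trans hi]; apply: near_eq_cvg;
    by near=> h; rewrite E.
apply: mx_der_continuous => [||k l].
- near=> h; rewrite (inj_eq (@complexI R)) invr_eq0; near: h.
  exact: nbhs_dnbhs_neq.
- rewrite (_ : (fun t : R => _) = (fun t : R => t%:C)); last first.
    by apply/funext => t; rewrite -fmorphV invrK.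
  by apply: cvg_real_complex; exact: cvg_within.
- apply/cvg_ReIm; have [/is_derive_cvg hr /is_derive_cvg hi] := fd k l.
  split; [apply: cvg_trans hr|apply: cvg_trans hi]; apply: near_eq_cvg;
    by near=> h; rewrite E.
Unshelve. all: by end_near. Qed.

Definition pderivM (p q : nat) (i : 'I_n) (f : 'rV[R]_n -> 'M[R[i]]_(p, q))
    : 'rV[R]_n -> 'M[R[i]]_(p, q) :=
  fun x => \matrix_(k, l) (pderiv i (fun y => complex.Re (f y k l)) x
                           +i* pderiv i (fun y => complex.Im (f y k l)) x).

(** The order in which [mderiv] differentiates, outermost first; as a list it allows induction on a
    single derivative. *)
Definition mindex_seq (a : mindex n) : seq 'I_n :=
  flatten [seq nseq (a i) i | i <- enum 'I_n].

Lemma foldr_pderiv_mindex (a : mindex n) (f : 'rV[R]_n -> R) :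
  foldr (@pderiv R n) f (mindex_seq a) = mderiv a f.
Proof.
rewrite /mderiv /mindex_seq; elim: (enum 'I_n) => //= i s <-.
by rewrite foldr_cat; elim: (a i) => //= k ->.
Qed.

Lemma foldr_pderivM (p q : nat) (f : 'rV[R]_n -> 'M[R[i]]_(p, q)) s x k l :
  foldr (@pderivM p q) f s x k l =
  foldr (@pderiv R n) (fun y => complex.Re (f y k l)) s x +i*
  foldr (@pderiv R n) (fun y => complex.Im (f y k l)) s x.
Proof.
elim: s x => [|i s IH] x /=; first by case: (f x k l).
rewrite mxE; congr (pderiv i _ x +i* pderiv i _ x); apply/funext => y;
  by rewrite IH.
Qed.

Lemma mderivM_foldr (p q : nat) (f : 'rV[R]_n -> 'M[R[i]]_(p, q)) a :
  mderivM a f = foldr (@pderivM p q) f (mindex_seq a).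
Proof.
apply/funext => x; apply/matrixP => k l.
by rewrite foldr_pderivM mxE /mderivC !foldr_pderiv_mindex.
Qed.

Lemma pderivM_mder (p q : nat) (f : 'rV[R]_n -> 'M[R[i]]_(p, q)) i x d :
  mder f x (delta_mx 0 i) d -> pderivM i f x = d.
Proof.
move=> /mderP h; apply/matrixP => k l; rewrite mxE.
by have [[_ h1] [_ h2]] := h k l; rewrite /pderiv h1 h2; case: (d k l).
Qed.

Lemma smoothM_mder (p q : nat) U (f : 'rV[R]_n -> 'M[R[i]]_(p, q)) s i x :
  smoothM_on U f -> U x ->
  mder (foldr (@pderivM p q) f s) x (delta_mx 0 i)
    (foldr (@pderivM p q) f (i :: s) x).
Proof.
move=> sf Ux; apply/mderP => k l; have [sr si] := sf k l.
have [_ dr] := sr s x Ux; have [_ di] := si s x Ux.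
rewrite foldr_pderivM /=.
split.
  rewrite (_ : (fun y => _) = foldr (@pderiv R n) (fun y => complex.Re (f y k l)) s).
    by apply: DeriveDef; [exact: dr|].
  by apply/funext => y; rewrite foldr_pderivM.
rewrite (_ : (fun y => _) = foldr (@pderiv R n) (fun y => complex.Im (f y k l)) s).
  by apply: DeriveDef; [exact: di|].
by apply/funext => y; rewrite foldr_pderivM.
Qed.

Lemma smoothM_cvg (p q : nat) U (f : 'rV[R]_n -> 'M[R[i]]_(p, q)) s x :
  smoothM_on U f -> U x ->
  mx_cvg (nbhs x) (foldr (@pderivM p q) f s) (foldr (@pderivM p q) f s x).
Proof.
move=> sf Ux k l; have [sr si] := sf k l.
have [cr _] := sr s x Ux; have [ci _] := si s x Ux.
apply/cvg_ReIm; rewrite foldr_pderivM /=; split.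
  apply: cvg_trans cr; apply: near_eq_cvg; apply: nearW => y.
  by rewrite foldr_pderivM.
apply: cvg_trans ci; apply: near_eq_cvg; apply: nearW => y.
by rewrite foldr_pderivM.
Qed.

Lemma near_eq_pderivM (p q : nat) (f g : 'rV[R]_n -> 'M[R[i]]_(p, q)) i x :
  (\forall y \near x, f y = g y) -> pderivM i f x = pderivM i g x.
Proof.
move=> fg; apply/matrixP => k l; rewrite !mxE; congr (_ +i* _);
  by apply: near_eq_derive; apply: filterS fg => y ->.
Qed.

Lemma eq_on_foldr_pderivM (p q : nat) U (f g : 'rV[R]_n -> 'M[R[i]]_(p, q)) s :
  open U -> {in U, f =1 g} ->
  {in U, foldr (@pderivM p q) f s =1 foldr (@pderivM p q) g s}.
Proof.
move=> oU fg; elim: s => [//|i s IH] x /set_mem Ux /=.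
apply: near_eq_pderivM; have := open_nbhs_nbhs (conj oU Ux).
by apply: filterS => y Uy; apply: IH; exact/mem_set.
Qed.

End DirectionalDerivatives.

(** * Symmetry of mixed partial derivatives *)

Section MixedPartials.
Variables (R : realType) (n : nat).
Implicit Types (x u v : 'rV[R]_n) (U : set 'rV[R]_n).

Lemma is_derive_line (f : 'rV[R]_n -> R) x v (s d : R) :
  is_derive (s *: v + x) v f d -> is_derive s 1 (fun r => f (r *: v + x)) d.
Proof.
move=> /is_derive_cvg fd.
suff h : h^-1 *: (f ((h *: 1 + s) *: v + x) - f (s *: v + x)) @[h --> (0:R)^'] --> d.
  by apply: DeriveDef; [apply/cvg_ex; exists d|exact/cvg_lim].
apply: cvg_trans fd; apply: near_eq_cvg; apply: nearW => h.
by rewrite /= scalerDl addrA [h *: 1]mulr1.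
Qed.

(** The mean value theorem is used twice: along u, for the difference of f between two sides of the
    parallelogram, then along v, for the derivative of f in the direction u. *)
Lemma mixed_difference (f : 'rV[R]_n -> R) x u v (h : R) : 0 < h ->
  (forall s t, 0 <= s <= h -> 0 <= t <= h ->
     derivable f (s *: u + t *: v + x) u /\
     derivable ('D_u f) (s *: u + t *: v + x) v) ->
  exists s t, [/\ 0 <= s <= h, 0 <= t <= h &
    f (h *: u + h *: v + x) - f (h *: u + x) - (f (h *: v + x) - f x) =
    'D_v ('D_u f) (s *: u + t *: v + x) * h * h].
Proof.
move=> h0 df.
have hh : 0 <= h <= h by rewrite ltW//=.
have h00 : 0 <= (0 : R) <= h by rewrite lexx ltW.
pose phi s := f (s *: u + (h *: v + x)) - f (s *: u + x).
pose dphi s := 'D_u f (s *: u + (h *: v + x)) - 'D_u f (s *: u + x).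
have dphiE s : 0 <= s <= h -> is_derive s 1 phi (dphi s).
  move=> sh; have [d1 _] := df s h sh hh; have [d2 _] := df s 0 sh h00.
  rewrite scale0r addr0 in d2; rewrite -addrA in d1.
  exact: (is_deriveB (is_derive_line (derivableP d1)) (is_derive_line (derivableP d2))).
have [s sh E1] : exists2 s, s \in `]0, h[ & phi h - phi 0 = dphi s * (h - 0).
  apply: (@MVT _ phi dphi 0 h h0).
    by move=> s; rewrite in_itv/= => /andP[s0 s1]; apply: dphiE; rewrite !ltW.
  by apply: derivable_within_continuous => s; rewrite in_itv/= => sh; have [] := dphiE s sh.
have {}sh : 0 <= s <= h by move: sh; rewrite in_itv/= => /andP[s0 s1]; rewrite !ltW.
pose psi t := 'D_u f (t *: v + (s *: u + x)).
pose dpsi t := 'D_v ('D_u f) (t *: v + (s *: u + x)).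
have dpsiE t : 0 <= t <= h -> is_derive t 1 psi (dpsi t).
  move=> th; have [_ d1] := df s t sh th.
  rewrite [s *: u + _]addrC -addrA in d1.
  exact: (@is_derive_line ('D_u f : 'rV[R]_n -> R) _ _ _ _ (derivableP d1)).
have [t th E2] : exists2 t, t \in `]0, h[ & psi h - psi 0 = dpsi t * (h - 0).
  apply: (@MVT _ psi dpsi 0 h h0).
    by move=> t; rewrite in_itv/= => /andP[t0 t1]; apply: dpsiE; rewrite !ltW.
  by apply: derivable_within_continuous => t; rewrite in_itv/= => th; have [] := dpsiE t th.
have {}th : 0 <= t <= h by move: th; rewrite in_itv/= => /andP[t0 t1]; rewrite !ltW.
exists s, t; split=> //.
rewrite [s *: u + _]addrC -(addrA (t *: v)) -(addrA (h *: u)).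
move: E1 E2; rewrite /phi /dphi /psi /dpsi !scale0r !add0r !subr0 => -> <-.
by rewrite [s *: u + (h *: v + x)]addrCA.
Qed.

Lemma near_parallelogram x u v (P : set 'rV[R]_n) : nbhs x P ->
  exists2 h : R, 0 < h & forall s t, 0 <= s <= h -> 0 <= t <= h ->
    P (s *: u + t *: v + x).
Proof.
move=> /nbhs_ballP[e /= e0 eP].
have C0 : 0 < `|u| + `|v| + 1 by rewrite ltr_wpDl// addr_ge0.
(* The summand 1 keeps the denominator positive when u = v = 0. *)
exists (e / (`|u| + `|v| + 1)); first by rewrite divr_gt0.
move=> s t /andP[s0 sh] /andP[t0 th]; apply: eP; rewrite -ball_normE /=.
rewrite opprD addrC subrK normrN; apply: le_lt_trans (ler_normD _ _) _.
rewrite !normrZ !ger0_norm//.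
have : e / (`|u| + `|v| + 1) * (`|u| + `|v|) < e.
  by rewrite mulrAC ltr_pdivrMr// ltr_pM2l// ltrDl.
by apply: le_lt_trans; rewrite mulrDr lerD// ler_wpM2r.
Qed.

(** The second difference over a parallelogram is symmetric in u and v, and it equals h^2 times
    either mixed derivative at some point of the parallelogram. If the two values at [x] differed by
    e > 0, a parallelogram on which both vary by less than e/2 would give a contradiction. *)
Lemma schwarz (f : 'rV[R]_n -> R) U x u v : open U -> U x ->
  (forall y, U y -> derivable f y u /\ derivable f y v) ->
  (forall y, U y -> derivable ('D_u f) y v /\ derivable ('D_v f) y u) ->
  {for x, continuous ('D_v ('D_u f))} -> {for x, continuous ('D_u ('D_v f))} ->
  'D_v ('D_u f) x = 'D_u ('D_v f) x.
Proof.
move=> oU Ux d1 d2 c1 c2; apply/eqP; rewrite -subr_eq0 -normr_eq0; apply/negPn/negP => ne.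
set e := `| _ | in ne; have e0 : 0 < e / 2 by rewrite divr_gt0// lt_def ne normr_ge0.
have [h h0 hP] : exists2 h : R, 0 < h & forall s t, 0 <= s <= h -> 0 <= t <= h ->
    [set y | [/\ U y, `|'D_v ('D_u f) x - 'D_v ('D_u f) y| < e / 2 &
              `|'D_u ('D_v f) x - 'D_u ('D_v f) y| < e / 2]] (s *: u + t *: v + x).
  apply: near_parallelogram.
  have n1 : \forall y \near x, `|'D_v ('D_u f) x - 'D_v ('D_u f) y| < e / 2.
    by move/cvgrPdist_lt/(_ _ e0) : c1.
  have n2 : \forall y \near x, `|'D_u ('D_v f) x - 'D_u ('D_v f) y| < e / 2.
    by move/cvgrPdist_lt/(_ _ e0) : c2.
  by apply: filterS3 (open_nbhs_nbhs (conj oU Ux)) n1 n2 => y.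
have [|s [t [sh th E1]]] := @mixed_difference f x u v h h0.
  move=> s t sh th; have [Uy _ _] := hP s t sh th.
  by have [? _] := d1 _ Uy; have [? _] := d2 _ Uy.
have [|t' [s' [th' sh' E2]]] := @mixed_difference f x v u h h0.
  move=> t' s' th' sh'; have [Uy _ _] := hP s' t' sh' th'.
  rewrite [t' *: v + _]addrC.
  exact: (conj (proj2 (d1 _ Uy)) (proj2 (d2 _ Uy))).
have fin (a b c k : R) : `|a - c| < k / 2 -> `|b - c| < k / 2 -> `|a - b| < k.
  move=> h1 h2; rewrite (splitr k) -(subrKA c) -(opprB b c).
  exact: le_lt_trans (ler_normB _ _) (ltrD h1 h2).
have swap (a b c d : R) : a - b - (c - d) = a - c - (b - d) by ring.
have E : 'D_v ('D_u f) (s *: u + t *: v + x) = 'D_u ('D_v f) (s' *: u + t' *: v + x).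
  apply: (mulIf (lt0r_neq0 h0)); apply: (mulIf (lt0r_neq0 h0)).
  rewrite [s' *: u + _]addrC; apply: (etrans (esym E1)); apply: (etrans _ E2).
  rewrite [h *: v + h *: u]addrC; exact: swap.
have [_ h1 _] := hP s t sh th; have [_ _ h2] := hP s' t' sh' th'.
rewrite -E in h2.
by have := fin _ _ _ _ h1 h2; rewrite ltxx.
Qed.

Lemma smooth_pderivC (f : 'rV[R]_n -> R) U s i j x : open U -> smooth_on U f ->
  U x -> foldr (@pderiv R n) f [:: i, j & s] x = foldr (@pderiv R n) f [:: j, i & s] x.
Proof.
move=> oU sf Ux; apply: (@schwarz (foldr (@pderiv R n) f s) U x) => //.
- move=> y Uy; have [_ d] := sf s y Uy; split; exact: d.
- move=> y Uy; have [_ d1] := sf (i :: s) y Uy; have [_ d2] := sf (j :: s) y Uy.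
  by split; [exact: d2|exact: d1].
- by have [] := sf [:: i, j & s] x Ux.
- by have [] := sf [:: j, i & s] x Ux.
Qed.

Lemma eq_on_foldr_pderiv (f g : 'rV[R]_n -> R) U s : open U -> {in U, f =1 g} ->
  {in U, foldr (@pderiv R n) f s =1 foldr (@pderiv R n) g s}.
Proof.
move=> oU fg; elim: s => [//|i s IH] x /set_mem Ux /=.
apply: near_eq_derive; have := open_nbhs_nbhs (conj oU Ux).
by apply: filterS => y Uy; apply: IH; exact/mem_set.
Qed.

(** Links the lists of derivatives accumulated by the recursion to the ordered ones of [mderiv]. *)
Lemma smooth_pderiv_perm (f : 'rV[R]_n -> R) U s s' : open U -> smooth_on U f ->
  perm_eq s s' ->
  {in U, foldr (@pderiv R n) f s =1 foldr (@pderiv R n) f s'}.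
Proof.
move=> oU sf.
have front i s1 s2 : {in U, foldr (@pderiv R n) f (s1 ++ i :: s2) =1
    foldr (@pderiv R n) f (i :: s1 ++ s2)}.
  elim: s1 => [//|j s1 IH] x xU /=.
  rewrite -[RHS](@smooth_pderivC f U (s1 ++ s2) j i x oU sf (set_mem xU)).
  exact: (eq_on_foldr_pderiv [:: j] oU IH).
elim: s s' => [|i s IH] s' ss'.
  by move: ss'; rewrite perm_sym => /perm_nilP ->.
have is' : i \in s' by rewrite -(perm_mem ss') mem_head.
case/splitPr: is' ss' => s1 s2 ss' x xU.
rewrite front//; apply: (eq_on_foldr_pderiv [:: i] oU _ xU).
apply: IH; move: ss'; rewrite perm_sym (perm_catCA s1 [:: i] s2) /= perm_cons.
by rewrite perm_sym.
Qed.

Lemma smoothM_pderivM_perm (p q : nat) (f : 'rV[R]_n -> 'M[R[i]]_(p, q)) U s s' :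
  open U -> smoothM_on U f -> perm_eq s s' ->
  {in U, foldr (@pderivM R n p q) f s =1 foldr (@pderivM R n p q) f s'}.
Proof.
move=> oU sf ss' x xU; apply/matrixP => k l; rewrite !foldr_pderivM.
by have [sr si] := sf k l; congr (_ +i* _); exact: (smooth_pderiv_perm oU _ ss').
Qed.

Definition mindex_of_seq (s : seq 'I_n) : mindex n := [ffun i => count_mem i s].

Lemma mindex_of_seqP s : perm_eq s (mindex_seq (mindex_of_seq s)).
Proof.
apply/allP => i _ /=; apply/eqP; rewrite /mindex_seq count_flatten -map_comp.
rewrite (eq_map (g := fun j => if j == i then count_mem i s else 0%N)); last first.
  by move=> j; rewrite /= count_nseq ffunE /=; case: eqVneq => [->|]; rewrite ?mul1n.
rewrite sumnE big_map (bigD1_seq i) ?enum_uniq ?mem_enum//= eqxx.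
by rewrite big1 ?addn0// => j /negbTE ->.
Qed.

End MixedPartials.

(** * Resolvent symbols *)

Section MonomialDerivatives.
Variables (R : realType) (n : nat).

Lemma mder_intro (p q : nat) (f : 'rV[R]_n -> 'M[R[i]]_(p, q)) (x v : 'rV[R]_n) d :
  mx_cvg (0:R)^' (fun h : R => (h^-1)%:C *: (f (h *: v + x) - f x)) d ->
  mder f x v d.
Proof.
move=> fd; apply: mx_der_continuous => //.
- near=> h; rewrite (inj_eq (@complexI R)) invr_eq0; near: h.
  exact: nbhs_dnbhs_neq.
- rewrite (_ : (fun t : R => _) = (fun t : R => t%:C)); last first.
    by apply/funext => t; rewrite -fmorphV invrK.
  by apply: cvg_real_complex; exact: cvg_within.
Unshelve. all: by end_near. Qed.

Lemma mder_scale (p q : nat) (u : 'rV[R]_n -> R) (X : 'M[R[i]]_(p, q)) x v d :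
  is_derive x v u d -> mder (fun y => (u y)%:C *: X) x v (d%:C *: X).
Proof.
move=> /is_derive_cvg ud; apply: mder_intro.
rewrite (_ : (fun h => _) = fun h => (h^-1 * (u (h *: v + x) - u x))%:C *: X).
  apply: mx_cvgZ; last exact: mx_cvg_cst.
  exact: (cvg_real_complex _ ud).
by apply/funext => h; rewrite -scalerBl scalerA rmorphM rmorphB.
Qed.

(** If the exponent at [i] is 0, the truncated predecessor does not matter, because the factor
    [(g i)%:R] vanishes. *)
Lemma mpow_derive (g : mindex n) i x :
  is_derive x (delta_mx 0 i) (fun xi : 'rV[R]_n => mpow xi g)
    ((g i)%:R * mpow x [ffun j => if j == i then (g j).-1 else g j]).
Proof.
apply/is_derive_cvg.
have E h : mpow (h *: delta_mx 0 i + x) g =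
    (h + x 0 i) ^+ g i * \prod_(j | j != i) x 0 j ^+ g j.
  rewrite /mpow (bigD1 i)//= !mxE !eqxx mulr1; congr (_ * _).
  by apply: eq_bigr => j /negbTE ji; rewrite !mxE ji andbF mulr0 add0r.
have -> : mpow x [ffun j => if j == i then (g j).-1 else g j] =
    x 0 i ^+ (g i).-1 * \prod_(j | j != i) x 0 j ^+ g j.
  rewrite /mpow (bigD1 i)//= ffunE eqxx; congr (_ * _).
  by apply: eq_bigr => j /negbTE ji; rewrite ffunE ji.
have -> : mpow x g = (0 + x 0 i) ^+ g i * \prod_(j | j != i) x 0 j ^+ g j.
  by rewrite -E scale0r add0r.
set C := \prod_(_ | _) _.
have D : is_derive (x 0 i) 1 (fun y : R => y ^+ g i) ((g i)%:R * x 0 i ^+ (g i).-1).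
  apply: DeriveDef; first exact: exprn_derivable.
  by rewrite exp_derive /GRing.scale /= mulr1 mulr_natl.
have {}D : h^-1 *: ((h *: 1 + x 0 i) ^+ g i - x 0 i ^+ g i) @[h --> (0:R)^'] -->
    (g i)%:R * x 0 i ^+ (g i).-1.
  by case: D => dD <-; exact: dD.
rewrite mulrA (_ : (fun h : R => _) =
    (fun h : R => (h^-1 *: ((h *: 1 + x 0 i) ^+ g i - x 0 i ^+ g i)) * C)).
  exact: (@cvgM _ _ _ _ _ (fun=> C) _ _ D (cvg_cst C)).
by apply/funext => h; rewrite E add0r -mulrBl mulrA [h *: 1]mulr1.
Qed.

Lemma mpow_continuous (g : mindex n) : continuous (fun xi : 'rV[R]_n => mpow xi g).
Proof.
move=> x; apply: (@cvg_bigprod _ _ _ (nbhs_filter x)) => i _.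
rewrite (_ : (fun t : 'rV[R]_n => t 0 i ^+ g i) =
   (fun y => y ^+ g i) \o (fun t : 'rV[R]_n => t 0 i))//.
apply: (@continuous_comp _ _ _ (fun t : 'rV[R]_n => t 0 i) (fun y : R => y ^+ g i)); first exact: coord_continuous.
exact: exprn_continuous.
Qed.

Lemma foldr_pderiv_mpow (g : mindex n) s : exists (c : R) (g' : mindex n),
  foldr (@pderiv R n) (fun xi => mpow xi g) s = fun xi => c * mpow xi g'.
Proof.
elim: s => [|i s [c [g' E]]] /=.
  by exists 1, g; apply/funext => x; rewrite mul1r.
rewrite E; exists (c * (g' i)%:R), [ffun j => if j == i then (g' j).-1 else g' j].
apply/funext => x; rewrite /pderiv.
have [d e] := mpow_derive g' i x.
by rewrite (deriveZ c d) e /GRing.scale /= mulrA.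
Qed.

Lemma mpow_smooth (g : mindex n) : smooth_on setT (fun xi : 'rV[R]_n => mpow xi g).
Proof.
move=> s x _; have [c [g' ->]] := foldr_pderiv_mpow g s; split.
  exact: (@cvgM _ _ _ _ (fun=> c) _ _ _ (cvg_cst c) (@mpow_continuous g' x)).
by move=> i; apply: (@derivableZ _ _ _ (fun xi => mpow xi g') c); have [] := mpow_derive g' i x.
Qed.

Lemma foldr_pderivM_scale_sum (p q : nat) (I : Type) (r : seq I) (P : pred I)
    (u : I -> 'rV[R]_n -> R) (X : I -> 'M[R[i]]_(p, q)) s :
  (forall i, smooth_on setT (u i)) ->
  foldr (@pderivM R n p q) (fun x => \sum_(i <- r | P i) (u i x)%:C *: X i) s =
  fun x => \sum_(i <- r | P i) (foldr (@pderiv R n) (u i) s x)%:C *: X i.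
Proof.
move=> su; elim: s => [//|k s IH] /=; rewrite IH; apply/funext => x.
apply: pderivM_mder; apply: mx_der_sum => i _; apply: mder_scale.
have [_ d] := su i s x Logic.I; apply: DeriveDef => //; exact: d.
Qed.

End MonomialDerivatives.

(* SRho stands for (sigma_m - mu)^-1 and SCoef g s for the derivative along s of
   the coefficient A_g. *)
Inductive sterm (R : realType) (n : nat) :=
  | SRho
  | SCoef of mindex n & seq 'I_n
  | SZero
  | SAdd of sterm R n & sterm R n
  | SMul of sterm R n & sterm R n
  | SScale of R[i] & sterm R n.
Arguments SRho {R n}.
Arguments SCoef {R n} _ _.
Arguments SZero {R n}.

Section SymbolTerms.
Variables (R : realType) (n m : nat).
Local Notation sterm := (sterm R n).

Fixpoint teval (N : nat) (rho : 'M[R[i]]_N) (l : mindex n -> seq 'I_n -> 'M[R[i]]_N)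
    (t : sterm) : 'M[R[i]]_N :=
  match t with
  | SRho => rho
  | SCoef g s => l g s
  | SZero => 0
  | SAdd a b => teval rho l a + teval rho l b
  | SMul a b => teval rho l a *m teval rho l b
  | SScale c a => c *: teval rho l a
  end.

(** The exponent of lambda produced by rescaling. It is a relation rather than a function since
    [SZero] is homogeneous of every weight; it also records [mdeg g <= m], the range in which the
    coefficients are known to be smooth. *)
Fixpoint tweight (t : sterm) (w : nat) : Prop :=
  match t with
  | SRho => w = 0%N
  | SCoef g s => (mdeg g <= m)%N /\ w = (m - mdeg g + size s)%N
  | SZero => True
  | SAdd a b => tweight a w /\ tweight b w
  | SMul a b => exists w1 w2, [/\ w = (w1 + w2)%N, tweight a w1 & tweight b w2]
  | SScale _ a => tweight a w
  end.

(* Lower bound on the number of factors SRho in each monomial. *)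
Fixpoint tdecay (t : sterm) (k : nat) : Prop :=
  match t with
  | SRho => (k <= 1)%N
  | SCoef _ _ => k = 0%N
  | SZero => True
  | SAdd a b => tdecay a k /\ tdecay b k
  | SMul a b => exists k1 k2, [/\ k = (k1 + k2)%N, tdecay a k1 & tdecay b k2]
  | SScale _ a => tdecay a k
  end.

Lemma tdecay0 t : tdecay t 0.
Proof. by elim: t => //= a IHa b IHb; exists 0%N, 0%N. Qed.

Lemma tdecay_le t k k' : (k' <= k)%N -> tdecay t k -> tdecay t k'.
Proof.
elim: t k k' => //= [k k'|g s k k'|a IHa b IHb k k' kk|a IHa b IHb k k' kk].
- exact: leq_trans.
- by move=> + k0; rewrite k0 leqn0 => /eqP.
- by move=> [ha hb]; split; [exact: IHa ha|exact: IHb hb].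
- move=> [k1 [k2 [E h1 h2]]]; exists (minn k1 k'), (k' - minn k1 k')%N; split.
  + by rewrite subnKC// geq_minr.
  + by apply: IHa h1; exact: geq_minl.
  + apply: IHb h2; rewrite leq_subLR; case: (leqP k1 k') => h; last exact: leq_addr.
    by rewrite -E.
Qed.

Definition tsum (I : Type) (r : seq I) (P : pred I) (F : I -> sterm) : sterm :=
  \big[@SAdd R n/SZero]_(i <- r | P i) F i.

Lemma teval_tsum N rho l (I : Type) (r : seq I) (P : pred I) (F : I -> sterm) :
  @teval N rho l (tsum r P F) = \sum_(i <- r | P i) teval rho l (F i).
Proof. by apply: (big_morph (teval rho l)). Qed.

Lemma tweight_tsum (I : Type) (r : seq I) (P : pred I) (F : I -> sterm) w :
  (forall i, P i -> tweight (F i) w) -> tweight (tsum r P F) w.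
Proof. by move=> h; apply: (big_ind (fun t => tweight t w)). Qed.

Lemma tdecay_tsum (I : Type) (r : seq I) (P : pred I) (F : I -> sterm) k :
  (forall i, P i -> tdecay (F i) k) -> tdecay (tsum r P F) k.
Proof. by move=> h; apply: (big_ind (fun t => tdecay t k)). Qed.

Definition mi (k : nat) (g : {ffun 'I_n -> 'I_k.+1}) : mindex n :=
  [ffun i => nat_of_ord (g i)].

Variable xi : 'rV[R]_n.

Definition symbol_coef (al g : mindex n) : R[i] :=
  'i%C ^+ mdeg g * (mderiv al (fun eta => mpow eta g) xi)%:C.

(* The derivative of order al in xi and s in x of sigma_{m-a}. *)
Definition tsymbol (a : nat) (al : mindex n) (s : seq 'I_n) : sterm :=
  tsum (index_enum _) (fun g : {ffun 'I_n -> 'I_m.+1} =>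
      [&& (a <= m)%N, (\sum_(i < n) g i <= m)%N & mdeg (mi g) == (m - a)%N])
    (fun g => SScale (symbol_coef al (mi g)) (SCoef (mi g) s)).

Definition mindex0 : mindex n := [ffun=> 0%N].

(** Formal derivative in x at fixed mu; the case [SRho] is d rho = - rho (d sigma_m) rho. *)
Fixpoint tderiv (i : 'I_n) (t : sterm) : sterm :=
  match t with
  | SRho => SScale (-1) (SMul (SMul SRho (tsymbol 0 mindex0 [:: i])) SRho)
  | SCoef g s => SCoef g (i :: s)
  | SZero => SZero
  | SAdd a b => SAdd (tderiv i a) (tderiv i b)
  | SMul a b => SAdd (SMul (tderiv i a) b) (SMul a (tderiv i b))
  | SScale c a => SScale c (tderiv i a)
  end.

Lemma tweight_tsymbol a al s : tweight (tsymbol a al s) (a + size s).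
Proof.
apply: tweight_tsum => g /and3P[am _ /eqP gE] /=; rewrite gE leq_subr.
by rewrite subKn.
Qed.

Lemma tweight_tderiv i t w : tweight t w -> tweight (tderiv i t) w.+1.
Proof.
elim: t w => //= [w ->|g s w [-> ->]|a IHa b IHb w [ha hb]|a IHa b IHb w].
- exists 1%N, 0%N; split=> //; exists 0%N, 1%N; split=> //; exact: (tweight_tsymbol 0 _ [:: i]).
- by rewrite addnS.
- by split; [exact: IHa|exact: IHb].
- move=> [w1 [w2 [-> h1 h2]]]; split.
    by exists w1.+1, w2; split=> //; exact: IHa.
  by exists w1, w2.+1; split; [rewrite addnS| |exact: IHb].
Qed.

Lemma tdecay_tderiv i t k : tdecay t k -> tdecay (tderiv i t) k.
Proof.
elim: t k => //= [k k1|a IHa b IHb k [ha hb]|a IHa b IHb k].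
- exists k, 0%N; split=> //; first by rewrite addn0.
  by exists k, 0%N; split=> //; [rewrite addn0|exact: tdecay0].
- by split; [exact: IHa|exact: IHb].
- move=> [k1 [k2 [-> h1 h2]]]; split.
    by exists k1, k2; split=> //; exact: IHa.
  by exists k1, k2; split=> //; exact: IHb.
Qed.

Lemma tweight_foldr_tderiv s t w :
  tweight t w -> tweight (foldr tderiv t s) (w + size s).
Proof.
by move=> h; elim: s => [|i s IH] /=; rewrite ?addn0// addnS; exact: tweight_tderiv.
Qed.

Lemma tdecay_foldr_tderiv s t k : tdecay t k -> tdecay (foldr tderiv t s) k.
Proof. by move=> h; elim: s => [//|i s IH] /=; exact: tdecay_tderiv. Qed.

(** Mirrors [resolvent_step]: derivatives in xi are absorbed by [tsymbol], those in x by
    [tderiv]. *)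
Definition tstep (j : nat) (w : nat -> sterm) : sterm :=
  SScale (-1) (SMul SRho (
    tsum (index_enum _) xpredT (fun a : 'I_j.+1 =>
    tsum (index_enum _) xpredT (fun b : 'I_j =>
    tsum (index_enum _) (fun al : {ffun 'I_n -> 'I_j.+1} =>
        (\sum_(i < n) al i <= j)%N && (a + b + mdeg (mi al) == j)%N)
      (fun al => SScale ((- 'i%C) ^+ mdeg (mi al) / ((mfact (mi al))%:R))
         (SMul (tsymbol a (mi al) [::]) (foldr tderiv (w b) (mindex_seq (mi al))))))))).

Fixpoint tresolvents (k : nat) : nat -> sterm :=
  match k with
  | 0 => fun _ => SRho
  | k'.+1 => fun b =>
      if (b <= k')%N then tresolvents k' b else tstep k'.+1 (tresolvents k')
  end.

Lemma size_mindex_seq (a : mindex n) : size (mindex_seq a) = mdeg a.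
Proof.
rewrite /mindex_seq size_flatten /shape -map_comp sumnE big_map /mdeg big_enum.
by apply: eq_bigr => i _ /=; rewrite size_nseq.
Qed.

Lemma tweight_tresolvents k b : (b <= k)%N -> tweight (tresolvents k b) b.
Proof.
elim: k b => [|k IH] b /=; first by rewrite leqn0 => /eqP.
rewrite leq_eqVlt => /predU1P[->|]; last by rewrite ltnS => bk; rewrite bk; exact: IH.
rewrite ltnn; exists 0%N, k.+1; split=> //.
apply: tweight_tsum => a _; apply: tweight_tsum => c _; apply: tweight_tsum => al.
move=> /andP[_ /eqP E]; exists (a + 0)%N, (c + size (mindex_seq (mi al)))%N; split.
- by rewrite addn0 size_mindex_seq addnA E.
- exact: (tweight_tsymbol a _ [::]).
- by apply: tweight_foldr_tderiv; apply: IH; rewrite -ltnS.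
Qed.

(** The bound is 1 for b = 0 and 2 otherwise: the recursion puts one factor in front, and each
    earlier resolvent term brings at least one more, which formal differentiation does not
    remove. *)
Lemma tdecay_tresolvents k b : (b <= k)%N -> tdecay (tresolvents k b) (b != 0%N).+1.
Proof.
elim: k b => [|k IH] b /=; first by rewrite leqn0 => /eqP ->.
rewrite leq_eqVlt => /predU1P[->|]; last by rewrite ltnS => bk; rewrite bk; exact: IH.
rewrite ltnn /=; exists 1%N, 1%N; split=> //.
apply: tdecay_tsum => a _; apply: tdecay_tsum => c _; apply: tdecay_tsum => al _.
exists 0%N, 1%N; split=> //; first exact: tdecay0.
apply: tdecay_foldr_tderiv.
by apply: tdecay_le (IH c _); rewrite // -ltnS.
Qed.

End SymbolTerms.

(** * Resolvent symbols as values of formal terms *)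

Section ResolventTerms.
Variables (R : realType) (n N m : nat) (A : opcoefs R n N) (xi : 'rV[R]_n) (mu : R[i]).
Local Notation coefs := (fun y => (fun g s => foldr (@pderivM R n N N) (A g) s y)).

Definition tvalue (y : 'rV[R]_n) (t : sterm R n) : 'M[R[i]]_N :=
  teval (resolvent0 m A y xi mu) (fun g s => foldr (@pderivM R n N N) (A g) s y) t.

Lemma mderiv0 (f : 'rV[R]_n -> R) : mderiv (mindex0 n) f = f.
Proof.
by rewrite /mderiv; elim: (enum 'I_n) => //= i s ->; rewrite ffunE.
Qed.

Lemma mderivM_opsymbol (al : mindex n) a y : (a <= m)%N ->
  mderivM al (fun eta => opsymbol m A a y eta) xi =
  tvalue y (tsymbol m xi a al [::]).
Proof.
move=> am; rewrite /tvalue teval_tsum am /= mderivM_foldr.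
have E : (fun eta => opsymbol m A a y eta) = (fun eta =>
    \sum_(g : {ffun 'I_n -> 'I_m.+1} | (\sum_(i < n) g i <= m)%N &&
       (mdeg (mi g) == m - a)%N) (mpow eta (mi g))%:C *: ('i%C ^+ mdeg (mi g) *: A (mi g) y)).
  apply/funext => eta; rewrite /opsymbol am /mindex_sum -big_mkcondr /=.
  by apply: eq_bigr => g _; rewrite scalerA mulrC.
rewrite E foldr_pderivM_scale_sum; last by move=> g; exact: mpow_smooth.
by apply: eq_bigr => g _; rewrite foldr_pderiv_mindex scalerA mulrC.
Qed.

Lemma mderivM_opsymbol_gt (al : mindex n) a y : (m < a)%N ->
  mderivM al (fun eta => opsymbol m A a y eta) xi =
  tvalue y (tsymbol m xi a al [::]).
Proof.
move=> ma; rewrite /tvalue teval_tsum big_pred0; last by move=> g; rewrite leqNgt ma.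
rewrite mderivM_foldr (_ : (fun eta => _) = fun eta => \sum_(i <- [::] : seq 'I_n) (0:R)%:C *: 0); last first.
  by apply/funext => eta; rewrite big_nil /opsymbol leqNgt ma.
rewrite (@foldr_pderivM_scale_sum R n N N 'I_n [::] xpredT (fun _ _ => 0) (fun=> 0)) ?big_nil//.
move=> i s x _.
have -> : foldr (@pderiv R n) (fun=> 0) s = fun=> 0.
  by elim: s => //= j s ->; apply/funext => z; rewrite /pderiv (derive_cst (0:R)).
by split; [exact: cst_continuous|move=> j; exact: derivable_cst].
Qed.

Variable W : set 'rV[R]_n.
Hypothesis oW : open W.
Hypothesis sA : forall g, (mdeg g <= m)%N -> smoothM_on W (A g).
Hypothesis inv : forall y, W y -> opsymbol m A 0 y xi - mu%:M \in unitmx.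

Lemma opsymbol_mder y i : W y ->
  mder (fun z => opsymbol m A 0 z xi) y (delta_mx 0 i)
    (tvalue y (tsymbol m xi 0 (mindex0 n) [:: i])).
Proof.
move=> Wy; rewrite /tvalue teval_tsum /=.
have E z : opsymbol m A 0 z xi = 
    \sum_(g : {ffun 'I_n -> 'I_m.+1} | (\sum_(i < n) g i <= m)%N &&
       (mdeg (mi g) == m - 0)%N) symbol_coef xi (mindex0 n) (mi g) *: A (mi g) z.
  rewrite /opsymbol /mindex_sum -big_mkcondr /=.
  by apply: eq_bigr => g _; rewrite /symbol_coef mderiv0.
rewrite /mder E; under [X in mx_der _ _ X]funext do rewrite E.
apply: mx_der_sum => g /andP[gm _]; apply: mx_derZ.
by apply: (@smoothM_mder _ _ _ _ W _ [::]) => //; apply: sA; rewrite /mdeg; under eq_bigr do rewrite ffunE.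
Qed.

Lemma tvalue_mder t w y i : tweight m t w -> W y ->
  mder (tvalue ^~ t) y (delta_mx 0 i) (tvalue y (tderiv m xi i t)).
Proof.
move=> + Wy; elim: t w => /= [w _|g s w [gm _]|w _|a IHa b IHb w [ha hb]|a IHa b IHb w [w1 [w2 [_ ha hb]]]|c a IHa w ha].
- rewrite /tvalue /= scaleN1r.
  apply: mx_derV; first exact: inv.
  have := mx_derD _ (opsymbol_mder i Wy) (mx_derN _ (mx_der_cst _ _ mu%:M)).
  by rewrite oppr0 addr0; apply.
- by apply: (@smoothM_mder _ _ _ _ W) => //; exact: sA.
- exact: mx_der_cst.
- by apply: mx_derD; [exact: IHa ha|exact: IHb hb].
- by apply: mx_derM; [exact: IHa ha|exact: IHb hb].
- by apply: mx_derZ; exact: IHa ha.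
Qed.

Lemma foldr_pderivM_tvalue t w s : tweight m t w ->
  {in W, foldr (@pderivM R n N N) (tvalue ^~ t) s =1
    tvalue ^~ (foldr (tderiv m xi) t s)}.
Proof.
move=> tw; elim: s => [//|i s IH] y yW /=.
rewrite -[LHS]/(foldr _ (foldr (@pderivM R n N N) (tvalue ^~ t) s) [:: i] y).
rewrite (eq_on_foldr_pderivM [:: i] oW IH)//=.
by apply: pderivM_mder; apply: (tvalue_mder i (tweight_foldr_tderiv xi s tw)); exact: set_mem.
Qed.

(** The equality has to hold on an open set, not at one point: the recursion differentiates the
    earlier resolvent symbols in x. *)
Lemma resolvents_tvalue k b : (b <= k)%N ->
  {in W, (fun y => resolvents m A k b y xi mu) =1 tvalue ^~ (tresolvents m xi k b)}.
Proof.
elim: k b => [//|k IH] b.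
rewrite leq_eqVlt => /predU1P[->|]; last first.
  by rewrite ltnS => bk y yW /=; rewrite bk; exact: IH.
move=> y yW /=; rewrite ltnn /tvalue /= scaleN1r; congr (- (_ *m _)).
rewrite teval_tsum; apply: eq_bigr => a _; rewrite teval_tsum; apply: eq_bigr => c _.
rewrite teval_tsum /mindex_sum -big_mkcondr /=; apply: eq_bigr => al _.
congr (_ *: (_ *m _)).
  by have [am|am] := leqP a m; [exact: mderivM_opsymbol|exact: mderivM_opsymbol_gt].
have ck : (c <= k)%N by rewrite -ltnS.
rewrite mderivM_foldr (eq_on_foldr_pderivM _ oW (IH c ck))//.
exact: (foldr_pderivM_tvalue _ (tweight_tresolvents m xi ck)).
Qed.

Lemma resolvent_tvalue j y : W y ->
  resolvent m A j y xi mu = tvalue y (tresolvents m xi j j).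
Proof. by move=> Wy; apply: resolvents_tvalue => //; exact/mem_set. Qed.

End ResolventTerms.

(** * The rescaling limit *)

Section DegreeScaling.
Variables (R : realType) (n : nat).
Implicit Types (X : 'M[R[i]]_(formdim n)).

Lemma degree_scaling_mulE (lam : R) X (A B : {set 'I_n}) :
  (degree_scaling n lam *m X) (enum_rank A) (enum_rank B) =
  (lam ^- #|A|)%:C * X (enum_rank A) (enum_rank B).
Proof.
rewrite mxE (bigD1 (enum_rank A))//= mxE !enum_rankK eqxx big1 ?addr0// => k kA.
rewrite mxE enum_rankK ifF ?mul0r//; apply: contra_neqF kA => /eqP ->.
by rewrite enum_valK.
Qed.

Lemma mul_degree_scalingE (lam : R) X (A B : {set 'I_n}) :
  (X *m degree_scaling n lam) (enum_rank A) (enum_rank B) =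
  X (enum_rank A) (enum_rank B) * (lam ^- #|B|)%:C.
Proof.
rewrite mxE (bigD1 (enum_rank B))//= mxE !enum_rankK eqxx big1 ?addr0// => k kB.
rewrite mxE enum_rankK ifF ?mulr0//; apply: contra_neqF kB => /eqP <-.
by rewrite enum_valK.
Qed.

Lemma degree_scalingV (lam : R) : lam != 0 ->
  degree_scaling n lam *m degree_scaling n lam^-1 = 1%:M.
Proof.
move=> l0; apply: form_mxP => A B; rewrite degree_scaling_mulE !mxE !enum_rankK.
rewrite (inj_eq enum_rank_inj); case: eqVneq => [->|_]; last by rewrite mulr0.
by rewrite -rmorphM exprVn invrK mulVf ?rmorph1// expf_neq0.
Qed.

Lemma degree_scaling_unit (lam : R) : lam != 0 ->
  degree_scaling n lam \in unitmx.
Proof. by move=> /degree_scalingV /mulmx1_unit[]. Qed.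

Lemma invmx_degree_scaling (lam : R) : lam != 0 ->
  invmx (degree_scaling n lam) = degree_scaling n lam^-1.
Proof.
move=> l0; have := degree_scalingV l0.
by move=> /(congr1 (mulmx (invmx (degree_scaling n lam)))); rewrite mulKmx ?degree_scaling_unit// mulmx1.
Qed.

Lemma top_of_one_scaling (lam : R) X : lam != 0 ->
  top_of_one (degree_scaling n lam *m X *m invmx (degree_scaling n lam)) =
  (lam ^- n)%:C * top_of_one X.
Proof.
move=> l0; rewrite /top_of_one invmx_degree_scaling// mul_degree_scalingE.
by rewrite degree_scaling_mulE cards0 cardsT card_ord expr0 invr1 mulr1.
Qed.

End DegreeScaling.

Section ConjugatedMap.
Variables (R : realType) (p N : nat) (C : {linear 'M[R[i]]_p -> 'M[R[i]]_N}).
Variable U : 'M[R[i]]_N.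

Definition conj_map (X : 'M[R[i]]_p) : 'M[R[i]]_N := U *m C X *m invmx U.

Lemma conj_map_is_linear : linear conj_map.
Proof.
by move=> k X Y; rewrite /conj_map linearP mulmxDr mulmxDl -scalemxAr -scalemxAl.
Qed.

HB.instance Definition _ :=
  GRing.isLinear.Build R[i] 'M[R[i]]_p 'M[R[i]]_N _ conj_map conj_map_is_linear.

Hypothesis U_unit : U \in unitmx.
Hypothesis C1 : C 1%:M = 1%:M.
Hypothesis CM : forall X Y, C (X *m Y) = C X *m C Y.

Lemma conj_mapM X Y : conj_map (X *m Y) = conj_map X *m conj_map Y.
Proof. by rewrite /conj_map CM !mulmxA mulmxKV. Qed.

Lemma conj_map1 : conj_map 1%:M = 1%:M.
Proof. by rewrite /conj_map C1 mulmx1 mulmxV. Qed.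

Lemma morph_unit X : X \in unitmx -> C X \in unitmx.
Proof.
by move=> Xu; have /mulmx1_unit[] : C X *m C (invmx X) = 1%:M by rewrite -CM mulmxV// C1.
Qed.

Lemma conj_map_inv X : X \in unitmx -> conj_map (invmx X) = invmx (conj_map X).
Proof.
move=> Xu; have h : conj_map X *m conj_map (invmx X) = 1%:M.
  by rewrite -conj_mapM mulmxV// conj_map1.
have [cu _] := mulmx1_unit h.
by rewrite -[LHS](mulKmx cu) h mulmx1.
Qed.

(** This survives lambda -> 0 although [U], then the degree scaling, diverges. *)
Lemma conj_map_det X : \det (conj_map X) = \det (C X).
Proof.
by rewrite /conj_map !det_mulmx det_inv mulrAC mulfV ?mul1r// -unitfE -unitmxE.
Qed.

End ConjugatedMap.

Section TermEvaluation.
Variables (R : realType) (n m : nat).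

(** Terms contain neither a unit nor an inversion, so linearity and multiplicativity suffice; that
    [phi] of a resolvent is again a resolvent is settled where the lemma is applied. *)
Lemma teval_homogeneous p N (phi : {linear 'M[R[i]]_p -> 'M[R[i]]_N}) (lam : R[i])
    (rho : 'M[R[i]]_p) (l : mindex n -> seq 'I_n -> 'M[R[i]]_p) t w :
  (forall X Y, phi (X *m Y) = phi X *m phi Y) -> tweight m t w ->
  teval (phi rho) (fun g s => lam ^+ (m - mdeg g + size s) *: phi (l g s)) t =
  lam ^+ w *: phi (teval rho l t).
Proof.
move=> phiM; elim: t w => /= [w ->|g s w [_ ->]|w _|a IHa b IHb w [ha hb]|a IHa b IHb w [w1 [w2 [-> ha hb]]]|c a IHa w ha].
- by rewrite scale1r.
- by [].
- by rewrite linear0 scaler0.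
- by rewrite (IHa w)// (IHb w)// linearD scalerDr.
- by rewrite (IHa w1)// (IHb w2)// -scalemxAl -scalemxAr scalerA -exprD phiM.
- by rewrite (IHa w)// [phi (c *: _)]linearZ /= !scalerA (mulrC c).
Qed.

Lemma teval_cvg N (T : Type) (F : set_system T) (FF : Filter F)
    (rho : T -> 'M[R[i]]_N) (l : T -> mindex n -> seq 'I_n -> 'M[R[i]]_N) rho0 l0 t w :
  mx_cvg F rho rho0 ->
  (forall g s, (mdeg g <= m)%N -> mx_cvg F (fun x => l x g s) (l0 g s)) ->
  tweight m t w -> mx_cvg F (fun x => teval (rho x) (l x) t) (teval rho0 l0 t).
Proof.
move=> hr hl; elim: t w => /= [//|g s w [gm _]|w _|a IHa b IHb w [ha hb]|a IHa b IHb w [w1 [w2 [_ ha hb]]]|c a IHa w ha].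
- exact: hl.
- exact: mx_cvg_cst.
- by apply: mx_cvgD; [exact: IHa ha|exact: IHb hb].
- by apply: mx_cvgM; [exact: IHa ha|exact: IHb hb].
- by apply: mx_cvgZ; [exact: cvg_cst|exact: IHa ha].
Qed.

End TermEvaluation.

Section ScalingDerivatives.
Variables (R : realType) (n : nat).

Lemma scale_dnbhs0 (lam : R) : lam != 0 -> (fun h : R => lam * h) @ (0:R)^' --> (0:R)^'.
Proof.
move=> l0 P; rewrite /dnbhs /within /= => /nbhs_ballP[e /= e0 eP].
apply/nbhs_ballP; exists (e / `|lam|); first by rewrite /= divr_gt0// normr_gt0.
move=> h; rewrite -ball_normE /= sub0r normrN => he h0; apply: eP.
  by rewrite -ball_normE /= sub0r normrN normrM mulrC -ltr_pdivlMr// normr_gt0.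
by rewrite mulf_neq0.
Qed.

Lemma mder_dilation (p q : nat) (f : 'rV[R]_n -> 'M[R[i]]_(p, q)) (lam : R) x v d :
  lam != 0 -> mder f (lam *: x) v d ->
  mder (fun y => f (lam *: y)) x v (lam%:C *: d).
Proof.
move=> l0 [_ fd]; apply: mder_intro.
have fd' : mx_cvg (0:R)^' (fun h : R => ((lam * h)^-1)%:C *: (f ((lam * h) *: v + lam *: x) - f (lam *: x))) d.
  by move=> k l; exact: (cvg_comp _ _ (scale_dnbhs0 l0) (fd k l)).
rewrite (_ : (fun h => _) = fun h => lam%:C *:
    (((lam * h)^-1)%:C *: (f ((lam * h) *: v + lam *: x) - f (lam *: x)))).
  by apply: mx_cvgZ => //; exact: cvg_cst.
apply/funext => h; rewrite scalerA -rmorphM invfM mulrA mulfV// mul1r.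
by rewrite [lam *: (_ + _)]scalerDr [lam *: (h *: v)]scalerA.
Qed.

Lemma foldr_pderivM_dilation p N (phi : {linear 'M[R[i]]_p -> 'M[R[i]]_N})
    (f : 'rV[R]_n -> 'M[R[i]]_p) (lam : R) (k : nat) (U V : set 'rV[R]_n) s :
  lam != 0 -> open V -> smoothM_on U f -> (forall y, V y -> U (lam *: y)) ->
  {in V, foldr (@pderivM R n N N) (fun y => lam%:C ^+ k *: phi (f (lam *: y))) s =1
    fun y => lam%:C ^+ (k + size s) *: phi (foldr (@pderivM R n p p) f s (lam *: y))}.
Proof.
move=> l0 oV sf VU; elim: s => [|i s IH] x xV /=; first by rewrite addn0.
rewrite -[LHS]/(foldr _ (foldr (@pderivM R n N N)
  (fun y => lam%:C ^+ k *: phi (f (lam *: y))) s) [:: i] x).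
rewrite (eq_on_foldr_pderivM [:: i] oV IH)//=.
apply: pderivM_mder; rewrite addnS exprSr -scalerA; apply: mx_derZ.
rewrite -linearZ; apply: (mx_der_linear _ phi).
apply: (mder_dilation l0).
by apply: (smoothM_mder s i sf); apply: VU; exact: set_mem.
Qed.

End ScalingDerivatives.

Lemma fcvg_unique (K : numFieldType) (T : Type) (F : set_system T)
    (FF : ProperFilter F) (f : T -> K) (a b : K) : fcvg F f a -> fcvg F f b -> a = b.
Proof. exact: (@cvg_unique _ (@norm_hausdorff _ _)). Qed.

Section EuclideanBall.
Variables (R : realType) (n : nat).

Lemma open_euclball (r : R) : open (@euclball R n r).
Proof.
have c : continuous (@eucl R n).
  move=> x; rewrite /eucl.
  apply: (@continuous_comp _ _ _ (fun x : 'rV[R]_n => \sum_(i < n) x 0 i ^+ 2) Num.sqrt); last exact: sqrt_continuous.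
  apply: (@cvg_bigsum _ _ _ (nbhs_filter x)) => i _.
  apply: (@continuous_comp _ _ _ (fun t : 'rV[R]_n => t 0 i) (fun y : R => y ^+ 2)).
    exact: coord_continuous.
  exact: exprn_continuous.
by apply: (@open_comp _ _ (@eucl R n) [set y | y < r]) => // x _; exact: c.
Qed.

Lemma euclZ (c : R) (x : 'rV[R]_n) : eucl (c *: x) = `|c| * eucl x.
Proof.
rewrite /eucl; under eq_bigr do rewrite mxE exprMn.
by rewrite -mulr_sumr sqrtrM ?sqr_ge0// sqrtr_sqr.
Qed.

Lemma eucl_ge0 (x : 'rV[R]_n) : 0 <= eucl x.
Proof. exact: sqrtr_ge0. Qed.

Lemma euclball0 (r : R) : 0 < r -> euclball n r (0 : 'rV[R]_n).
Proof.
by move=> r0; rewrite /euclball /= -(scale0r (0 : 'rV[R]_n)) euclZ normr0 mul0r.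
Qed.

Lemma euclballZ (r c : R) (x : 'rV[R]_n) : 0 <= c <= 1 -> euclball n r x ->
  euclball n r (c *: x).
Proof.
move=> /andP[c0 c1]; rewrite /euclball /= euclZ ger0_norm//.
by apply: le_lt_trans; rewrite ler_piMl// eucl_ge0.
Qed.

Lemma scale_cvg0 (x : 'rV[R]_n) : (fun c : R => c *: x) @ (0:R)^'+ --> (0 : 'rV[R]_n).
Proof.
rewrite -[X in _ --> X](scale0r x); apply: cvg_at_right_filter.
exact: (@scalel_continuous _ _ x 0).
Qed.

Lemma mx_cvg_scale0 (K : numFieldType) p q (f : 'rV[R]_n -> 'M[K]_(p, q)) y :
  mx_cvg (nbhs (0 : 'rV[R]_n)) f (f 0) ->
  mx_cvg (0:R)^'+ (fun c => f (c *: y)) (f 0).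
Proof.
move=> fc k l.
exact: (@cvg_comp _ _ _ (fun c : R => c *: y) (fun z => f z k l) _ _ _ (scale_cvg0 y) (fc k l)).
Qed.

End EuclideanBall.

Section RescalingLimit.
Variables (R : realType) (n : nat) (n_even : ~~ odd n).
Variables (E : 'I_n -> 'M[R[i]]_(spindim n)) (cE : clifford_family E).
Variables (m : nat) (A : opcoefs R n (spindim n)) (q : clifford_coefs R n).
Variables (L : opcoefs R n (formdim n)) (r : R).
Hypothesis r_gt0 : 0 < r.
Hypothesis sA : forall a, (mdeg a <= m)%N -> smoothM_on (euclball n r) (A a).
Hypothesis Aq : forall a x, (mdeg a <= m)%N -> euclball n r x ->
  A a x = \sum_(I : {set 'I_n}) q a I x *: cliff_prod E I.
Hypothesis limL : is_rescaling_limit (euclball n r) m q L.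

Let B := euclball n r.
Let C : {linear 'M[R[i]]_(spindim n) -> 'M[R[i]]_(formdim n)} :=
  cliff_map E (@cform R n).
Let phi (lam : R) : {linear 'M[R[i]]_(spindim n) -> 'M[R[i]]_(formdim n)} :=
  conj_map C (degree_scaling n lam).

Let C1 : C 1%:M = 1%:M. Proof. exact: cliff_map1. Qed.
Let CM X Y : C (X *m Y) = C X *m C Y.
Proof. by apply: cliff_mapM => //; exact: cform_clifford. Qed.

Lemma rescaled_opE lam a : 0 < lam <= 1 -> (mdeg a <= m)%N ->
  {in B, rescaled_op m q lam a =1
    fun y => lam%:C ^+ (m - mdeg a) *: phi lam (A a (lam *: y))}.
Proof.
move=> /andP[l0 l1] am y /set_mem By.
have Bly : B (lam *: y) by apply: euclballZ => //; rewrite ltW.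
have CA : C (A a (lam *: y)) = \sum_I q a I (lam *: y) *: cliff_prod (@cform R n) I.
  by rewrite Aq//; exact: cliff_map_sum.
rewrite -[phi lam _]/(degree_scaling n lam *m C _ *m invmx _) CA.
rewrite mulmx_sumr mulmx_suml scaler_sumr.
apply: eq_bigr => I _; rewrite -scalemxAr -scalemxAl scalerA rmorphXn.
by [].
Qed.

Lemma foldr_pderivM_rescaled lam a s : 0 < lam <= 1 -> (mdeg a <= m)%N ->
  {in B, foldr (@pderivM R n _ _) (rescaled_op m q lam a) s =1
   fun y => lam%:C ^+ (m - mdeg a + size s) *:
     phi lam (foldr (@pderivM R n _ _) (A a) s (lam *: y))}.
Proof.
move=> l01 am y By.
have oB : open B by exact: open_euclball.
rewrite (eq_on_foldr_pderivM s oB (rescaled_opE l01 am))//.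
case/andP: l01 => l0 l1.
have l0' : lam != 0 by rewrite gt_eqF.
apply: (@foldr_pderivM_dilation R n _ _ (phi lam) (A a) lam _ B B s l0' oB (sA am)) => //.
by move=> z Bz; apply: euclballZ => //; rewrite ltW.
Qed.

Lemma near_pos_le1 : \forall lam \near (0:R)^'+, 0 < lam <= 1.
Proof.
near=> lam; apply/andP; split; near: lam; first exact: nbhs_right_gt.
exact: nbhs_right_le.
Unshelve. all: by end_near. Qed.

(** Convergence is given for derivatives indexed by multi-indices, so [s] is reordered into its
    multi-index, both in the rescaled coefficients and in the limit. *)
Lemma coef_limit a s y : (mdeg a <= m)%N -> B y ->
  mx_cvg (0:R)^'+ (fun lam => lam%:C ^+ (m - mdeg a + size s) *:
      phi lam (foldr (@pderivM R n _ _) (A a) s (lam *: y)))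
    (foldr (@pderivM R n _ _) (L a) s y).
Proof.
move=> am By; have [sL cL] := limL am.
have oB : open B by exact: open_euclball.
have ps := mindex_of_seqP s.
rewrite (smoothM_pderivM_perm oB sL ps (mem_set By)) -mderivM_foldr.
have h : mx_cvg (0:R)^'+ (fun lam => mderivM (mindex_of_seq s) (rescaled_op m q lam a) y)
    (mderivM (mindex_of_seq s) (L a) y).
  move=> k l; apply/fcvgP => e e0.
  have [e1 ie] : 0 < complex.Re e /\ e = (complex.Re e)%:C.
    move: e0; rewrite ltcE => /= /andP[/eqP ie re]; split=> //.
    by rewrite [LHS]complexE ie mulr0 addr0.
  (* The compact set is the single point [y]. A positive element of [R[i]] is real, so its real part
     is a valid threshold. *)
  rewrite ie; have := cL [set y] (mindex_of_seq s) k l (complex.Re e) (@compact_set1 _ y).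
  move=> /(_ _ e1)[]; first by move=> _ ->.
  move=> d d0 h; exists d => // lam dl l0; rewrite distrC; exact: (h _ dl l0 y).
apply: near_eq_mx_cvg h; apply: filterS near_pos_le1 => lam l01.
rewrite mderivM_foldr (foldr_pderivM_rescaled _ l01 am (mem_set By)) -(perm_size ps).
congr (_ *: phi _ _); apply/esym; apply: (smoothM_pderivM_perm oB (sA am) ps).
by apply: mem_set; apply: euclballZ => //; case/andP: l01 => /ltW -> ->.
Qed.

Variables (xi : 'rV[R]_n) (mu : R[i]).

(** Only coefficients of order exactly m enter the leading symbol, and these carry the power
    lambda^0. *)
Lemma symbol_phi lam y : opsymbol m (fun a z => lam%:C ^+ (m - mdeg a) *: phi lam (A a (lam *: z))) 0 y xi =
  phi lam (opsymbol m A 0 (lam *: y) xi).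
Proof.
rewrite /opsymbol /mindex_sum [RHS]linear_sum; apply: eq_bigr => g _.
case: ifP => [/eqP gm|_]; last by rewrite linear0.
by rewrite [phi lam (_ *: _)]linearZ /= gm subn0 subnn scale1r.
Qed.

Lemma opsymbol_cvg N (T : Type) (F : set_system T) (FF : Filter F)
    (D : T -> opcoefs R n N) (D0 : opcoefs R n N) (y : T -> 'rV[R]_n) y0 :
  (forall a, (mdeg a <= m)%N -> mx_cvg F (fun t => D t a (y t)) (D0 a y0)) ->
  mx_cvg F (fun t => opsymbol m (D t) 0 (y t) xi) (opsymbol m D0 0 y0 xi).
Proof.
move=> h; apply: mx_cvg_sum => g gm.
case: ifP => _; last exact: mx_cvg_cst.
apply: mx_cvgZ; first exact: cvg_cst.
by apply: h; rewrite /mdeg; under eq_bigr do rewrite ffunE.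
Qed.

(** Invertibility at one point suffices: by continuity of the determinant it holds on an open set,
    to which the formal computation is applied. *)
Lemma resolvent_tvalue_unit N (D : opcoefs R n N) j y :
  (forall a, (mdeg a <= m)%N -> smoothM_on B (D a)) -> B y ->
  opsymbol m D 0 y xi - mu%:M \in unitmx ->
  resolvent m D j y xi mu = tvalue m D xi mu y (tresolvents m xi j j).
Proof.
move=> sD By uy; have oB : open B by exact: open_euclball.
pose W := [set z | B z /\ opsymbol m D 0 z xi - mu%:M \in unitmx].
have symD z : B z -> mx_cvg (nbhs z) (fun w => opsymbol m D 0 w xi - mu%:M) (opsymbol m D 0 z xi - mu%:M).
  move=> Bz; apply: mx_cvgB; last exact: mx_cvg_cst.
  apply: (@opsymbol_cvg _ _ _ _ (fun=> D) D) => a am.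
  exact: (smoothM_cvg (s := [::]) (sD a am) Bz).
have oW : open W.
  rewrite openE => z [Bz uz]; have uw := mx_cvg_unit _ (symD z Bz) uz.
  by apply: filterS2 (open_nbhs_nbhs (conj oB Bz)) (uw _) => w Bw {}uw; split.
have sDW a : (mdeg a <= m)%N -> smoothM_on W (D a).
  by move=> am k l; split=> s z [Bz _]; have [h1 h2] := sD a am k l; [exact: h1|exact: h2].
have uW w : W w -> opsymbol m D 0 w xi - mu%:M \in unitmx by case.
exact: (@resolvent_tvalue R n N m D xi mu W oW sDW uW j y).
Qed.

Hypothesis unit0 : opsymbol m A 0 0 xi - mu%:M \in unitmx.

Let B0 : B 0. Proof. exact: euclball0. Qed.

Lemma symbol_cvg0 y : B y ->
  mx_cvg (0:R)^'+ (fun lam => opsymbol m A 0 (lam *: y) xi) (opsymbol m A 0 0 xi).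
Proof.
move=> By; apply: (@opsymbol_cvg _ _ _ _ (fun=> A) A) => a am.
exact: (mx_cvg_scale0 y (smoothM_cvg (s := [::]) (sA am) B0)).
Qed.

Lemma limit_symbol_cvg y : B y ->
  mx_cvg (0:R)^'+ (fun lam => phi lam (opsymbol m A 0 (lam *: y) xi - mu%:M))
    (opsymbol m L 0 y xi - mu%:M).
Proof.
move=> By; have h : mx_cvg (0:R)^'+ (fun lam => phi lam (opsymbol m A 0 (lam *: y) xi) - mu%:M)
    (opsymbol m L 0 y xi - mu%:M).
  apply: mx_cvgB; last exact: mx_cvg_cst.
  under [X in mx_cvg _ X]funext do rewrite -symbol_phi.
  apply: (@opsymbol_cvg _ _ _ _ _ L (fun=> y)) => a am.
  have := coef_limit (s := [::]) am By.
  by under [X in mx_cvg _ X _ -> _]funext do rewrite addn0.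
apply: near_eq_mx_cvg h; apply: filterS near_pos_le1 => lam /andP[l0 l1].
(* The map [phi lam] preserves the identity, so it leaves the spectral parameter in place. *)
rewrite linearB /= -[mu%:M in RHS]scalemx1 linearZ /= -/(phi lam).
by rewrite /phi conj_map1 ?scalemx1// degree_scaling_unit// gt_eqF.
Qed.

(** Its determinant is the limit of those of the conjugated Clifford images, hence of the
    unconjugated ones, which tend to that of the Clifford image at 0; the latter is invertible since
    an algebra morphism preserves inverses. *)
Lemma limit_symbol_unit y : B y -> opsymbol m L 0 y xi - mu%:M \in unitmx.
Proof.
move=> By; rewrite unitmxE unitfE.
have h1 := mx_cvg_det _ (limit_symbol_cvg By).
have h2 : fcvg (0:R)^'+ (fun lam => \det (phi lam (opsymbol m A 0 (lam *: y) xi - mu%:M)))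
   (\det (C (opsymbol m A 0 0 xi - mu%:M))).
  have h : fcvg (0:R)^'+ (fun lam => \det (C (opsymbol m A 0 (lam *: y) xi - mu%:M)))
   (\det (C (opsymbol m A 0 0 xi - mu%:M))).
    apply: mx_cvg_det; apply: mx_cvg_linear; apply: mx_cvgB; first exact: symbol_cvg0.
    exact: mx_cvg_cst.
  apply: cvg_trans h; apply: near_eq_cvg; apply: filterS near_pos_le1 => lam /andP[l0 l1].
  by rewrite /phi conj_map_det// degree_scaling_unit// gt_eqF.
rewrite (fcvg_unique _ (h1 _) h2) -unitfE -unitmxE.
exact: morph_unit.
Qed.

Lemma resolvent_top y : B y ->
  top_of_one (resolvent m L n y xi mu) = top_of_one (C (resolvent m A n 0 xi mu)).
Proof.
move=> By; have oB : open B by exact: open_euclball.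
have tw := tweight_tresolvents m xi (leqnn n).
set t := tresolvents m xi n n in tw.
have -> : resolvent m L n y xi mu = tvalue m L xi mu y t.
  have sL a : (mdeg a <= m)%N -> smoothM_on B (L a) by move=> /limL[].
  exact: (@resolvent_tvalue R n _ m L xi mu B oB sL limit_symbol_unit n y By).
rewrite (resolvent_tvalue_unit n sA B0 unit0) -/t.
(* both sides are the limit of the top entry of C (tvalue A (lam y)) *)
have cA : mx_cvg (0:R)^'+ (fun lam => tvalue m A xi mu (lam *: y) t) (tvalue m A xi mu 0 t).
  apply: (teval_cvg _ _ _ tw).
    by apply: mx_cvgV => //; apply: mx_cvgB; [exact: symbol_cvg0|exact: mx_cvg_cst].
  by move=> g s gm; exact: (mx_cvg_scale0 y (smoothM_cvg (s := s) (sA gm) B0)).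
have h1 : fcvg (0:R)^'+ (fun lam => top_of_one (C (tvalue m A xi mu (lam *: y) t)))
    (top_of_one (C (tvalue m A xi mu 0 t))).
  have cC : mx_cvg (0:R)^'+ (fun lam => C (tvalue m A xi mu (lam *: y) t)) (C (tvalue m A xi mu 0 t)).
    exact: mx_cvg_linear.
  exact: (cC _ _).
have cL : mx_cvg (0:R)^'+ (fun lam => teval (invmx (phi lam (opsymbol m A 0 (lam *: y) xi - mu%:M)))
     (fun a s => lam%:C ^+ (m - mdeg a + size s) *:
      phi lam (foldr (@pderivM R n _ _) (A a) s (lam *: y))) t)
   (tvalue m L xi mu y t).
  apply: (teval_cvg _ _ _ tw).
    by apply: mx_cvgV; [exact: limit_symbol_cvg|exact: limit_symbol_unit].
  by move=> g s gm; exact: coef_limit.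
have h2 : fcvg (0:R)^'+ (fun lam => top_of_one (C (tvalue m A xi mu (lam *: y) t)))
    (top_of_one (tvalue m L xi mu y t)).
  have uA : \forall lam \near (0:R)^'+, opsymbol m A 0 (lam *: y) xi - mu%:M \in unitmx.
    have h : mx_cvg (0:R)^'+ (fun lam => opsymbol m A 0 (lam *: y) xi - mu%:M)
        (opsymbol m A 0 0 xi - mu%:M).
      by apply: mx_cvgB; [exact: symbol_cvg0|exact: mx_cvg_cst].
    exact: (mx_cvg_unit _ h unit0).
  apply: cvg_trans (cL _ _); apply: near_eq_cvg.
  apply: filterS2 near_pos_le1 uA => lam /andP[l0 l1] ul.
  have lu : degree_scaling n lam \in unitmx by rewrite degree_scaling_unit// gt_eqF.
  (* The weight of [t] is n, and lambda^n cancels the lambda^-n of [top_of_one_scaling]: along this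
     path the top entry is that of the unconjugated Clifford image. *)
  rewrite -conj_map_inv// (teval_homogeneous _ _ _ _ tw); last exact: conj_mapM.
  rewrite mxE -/(top_of_one _) top_of_one_scaling ?gt_eqF// mulrA -rmorphXn -rmorphM.
  by rewrite mulfV ?mul1r// expf_neq0// gt_eqF.
exact: (fcvg_unique _ h2 h1).
Qed.

End RescalingLimit.

(** * Contour integrals *)

Section ComplexEstimates.
Variable R : realType.
Implicit Types (z w : R[i]) (x : R).

(** Indexing both parts by a boolean lets one statement treat them together. *)
Definition cpart (b : bool) (z : R[i]) : R :=
  if b then complex.Im z else complex.Re z.

(** The norm of [R[i]] takes values in [R[i]]; estimates and integrals need a real modulus. *)
Definition cabs (z : R[i]) : R := complex.Re `|z|.

Lemma cabsE z : `|z| = (cabs z)%:C.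
Proof. by rewrite /cabs normc_def. Qed.

Lemma cabs_ge0 z : 0 <= cabs z.
Proof. by rewrite -ler0c -cabsE. Qed.

Lemma cabsM z w : cabs (z * w) = cabs z * cabs w.
Proof. by apply: (@complexI R); rewrite rmorphM -!cabsE normrM. Qed.

Lemma cabsD z w : cabs (z + w) <= cabs z + cabs w.
Proof. by rewrite -lecR rmorphD -!cabsE ler_normD. Qed.

Lemma cabsN z : cabs (- z) = cabs z.
Proof. by rewrite /cabs normrN. Qed.

Lemma cabsB z w : cabs (z - w) = cabs (w - z).
Proof. by rewrite -cabsN opprB. Qed.

Lemma cabs0 : cabs 0 = 0.
Proof. by rewrite /cabs normr0. Qed.

Lemma cabs_real x : cabs x%:C = `|x|.
Proof. by rewrite /cabs normc_def /= expr0n addr0 sqrtr_sqr. Qed.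

Lemma cabs_part b z : `|cpart b z| <= cabs z.
Proof.
by rewrite -lecR -cabsE; case: b => /=; [exact: normc_ge_Im|exact: normc_ge_Re].
Qed.

Lemma cabs_le z : cabs z <= `|complex.Re z| + `|complex.Im z|.
Proof. by rewrite -lecR -cabsE normc_le_ReIm. Qed.

Lemma cabs_eq0 z : (cabs z == 0) = (z == 0).
Proof. by rewrite -(inj_eq (@complexI R)) -cabsE normr_eq0. Qed.

Lemma cabsV z : cabs z^-1 = (cabs z)^-1.
Proof. by apply: (@complexI R); rewrite -cabsE normfV cabsE fmorphV. Qed.

Lemma cpartD b z w : cpart b (z + w) = cpart b z + cpart b w.
Proof. by case: b; rewrite /= raddfD. Qed.

Lemma cpartB b z w : cpart b (z - w) = cpart b z - cpart b w.
Proof. by case: b; rewrite /= raddfB. Qed.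

Lemma cpart_inj z w : (forall b, cpart b z = cpart b w) -> z = w.
Proof.
by move=> h; apply/eqP; rewrite eq_complex; apply/andP; split; apply/eqP;
  [exact: (h false)|exact: (h true)].
Qed.

Lemma cexpD z w : cexp (z + w) = cexp z * cexp w.
Proof.
case: z w => [a b] [c d]; rewrite /cexp /= expRD cosD sinD.
by apply/eqP; rewrite eq_complex /=; apply/andP; split; apply/eqP; ring.
Qed.

Lemma cabs_cexp z : cabs (cexp z) = expR (complex.Re z).
Proof.
rewrite /cabs normc_def /= !exprMn -mulrDr cos2Dsin2 mulr1 sqrtr_sqr.
by rewrite ger0_norm// expR_ge0.
Qed.

Lemma mvt0 (f df : R -> R) x : (forall y : R, is_derive y 1 f (df y)) ->
  exists2 c, `|c| <= `|x| & f x - f 0 = df c * x.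
Proof.
move=> fd; have cf a b : {within `[a, b], continuous f}.
  by apply: derivable_within_continuous => y _; have [] := fd y.
have [x0|x0|->] := ltgtP x 0; last by exists 0; rewrite // subrr mulr0.
  have [c] := MVT x0 (fun y _ => fd y) (cf x 0).
  rewrite in_itv/= => /andP[xc c0] E; exists c.
    by rewrite !ltr0_norm// lerN2 ltW.
  by rewrite -opprB E sub0r mulrN opprK.
have [c] := MVT x0 (fun y _ => fd y) (cf 0 x).
rewrite in_itv/= => /andP[c0 cx] E; exists c.
  by rewrite !gtr0_norm// ltW.
by rewrite E subr0.
Qed.

Lemma abs_sin_le x : `|sin x| <= `|x|.
Proof.
have [c _] := mvt0 x (@is_derive_sin R); rewrite sin0 subr0 => ->.
by rewrite normrM ler_piMl// cos_max.
Qed.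

Lemma abs_cosB1_le x : `|cos x - 1| <= x ^+ 2.
Proof.
have [c cx] := mvt0 x (@is_derive_cos R); rewrite cos0 => ->.
rewrite -real_normK ?num_real// normrM normrN expr2 ler_wpM2r//.
exact: le_trans (abs_sin_le c) cx.
Qed.

Lemma abs_sinBx_le x : `|sin x - x| <= x ^+ 2.
Proof.
have fd (y : R) : is_derive y 1 (fun u : R => sin u - u) (cos y - 1) by exact: is_deriveB.
have [c cx] := mvt0 x fd; rewrite /= sin0 subr0 subr0 => ->.
rewrite -[x ^+ 2]real_normK ?num_real// normrM expr2 ler_wpM2r//.
have [d dc] := mvt0 c (@is_derive_cos R); rewrite cos0 => ->.
rewrite normrM normrN; apply: le_trans cx; rewrite ler_piMl//.
exact: sin_max.
Qed.

Lemma abs_expRB1_le x : `|expR x - 1| <= `|x| * expR `|x|.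
Proof.
have h1 := expR_ge1Dx x.
have h2 : expR x - 1 <= x * expR x.
  have := expR_ge1Dx (- x); rewrite -(ler_pM2r (expR_gt0 x)) [expR (- x) * _]mulrC expRxMexpNx_1.
  by rewrite mulrDl mul1r mulNr => h; lra.
have h3 : expR x <= expR `|x| by rewrite ler_expR ler_norm.
have h4 : 1 <= expR `|x| by rewrite -expR0 ler_expR.
rewrite ler_norml; apply/andP; split.
  have : - `|x| <= x by rewrite lerNl -normrN ler_norm.
  have : 0 <= `|x| * (expR `|x| - 1) by rewrite mulr_ge0// subr_ge0.
  by rewrite mulrBr mulr1 => ? ?; lra.
apply: le_trans h2 _; apply: (@le_trans _ _ (`|x| * expR x)).
  by rewrite ler_wpM2r ?expR_ge0// ler_norm.
by rewrite ler_wpM2l.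
Qed.

Lemma abs_expRB1x_le x : `|expR x - 1 - x| <= x ^+ 2 * expR `|x|.
Proof.
have fd (y : R) : is_derive y 1 (fun u : R => expR u - u) (expR y - 1) by exact: is_deriveB.
have [c cx] := mvt0 x fd; rewrite /= expR0 subr0 => E.
have -> : expR x - 1 - x = (expR c - 1) * x by rewrite -E; ring.
rewrite normrM -[x ^+ 2]real_normK ?num_real// expr2 mulrAC ler_wpM2r//.
apply: le_trans (abs_expRB1_le c) _.
by apply: ler_pM; rewrite ?expR_ge0// ler_expR.
Qed.

(** Second order remainder, from real estimates after splitting e^a cos b - 1 - a as (e^a - 1 - a) +
    e^a (cos b - 1), and e^a sin b - b as (e^a - 1) sin b + (sin b - b). It is the basis of
    differentiation in z under the integral. *)
Lemma cexp_taylor w (s := `|complex.Re w| + `|complex.Im w|) :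
  cabs (cexp w - 1 - w) <= 4 * s ^+ 2 * expR s.
Proof.
apply: le_trans (cabs_le _) _; rewrite /s; case: w {s} => a b /=.
set A : R := `|a|; set B : R := `|b|; set X := expR (A + B).
have A0 : 0 <= A by exact: normr_ge0.
have B0 : 0 <= B by exact: normr_ge0.
have X1 : 1 <= X by rewrite -expR0 ler_expR addr_ge0.
have aX : expR a <= X by rewrite ler_expR (le_trans (ler_norm a))// lerDl.
have AX : expR A <= X by rewrite ler_expR lerDl.
have a2 : a ^+ 2 = A ^+ 2 by rewrite real_normK ?num_real.
have b2 : b ^+ 2 = B ^+ 2 by rewrite real_normK ?num_real.
have re : `|expR a * cos b - 1 - a| <= (A ^+ 2 + B ^+ 2) * X.
  have -> : expR a * cos b - 1 - a = (expR a - 1 - a) + expR a * (cos b - 1) by ring.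
  apply: le_trans (ler_normD _ _) _; rewrite [leRHS]mulrDl; apply: lerD.
    apply: le_trans (abs_expRB1x_le a) _; rewrite a2 ler_wpM2l ?sqr_ge0//.
  rewrite normrM ger0_norm ?expR_ge0// mulrC; apply: ler_pM => //.
  by rewrite -b2 abs_cosB1_le.
have im : `|expR a * sin b - 0 - b| <= (A * B + B ^+ 2) * X.
  have -> : expR a * sin b - 0 - b = (expR a - 1) * sin b + (sin b - b) by ring.
  apply: le_trans (ler_normD _ _) _; rewrite [leRHS]mulrDl; apply: lerD.
    rewrite normrM mulrAC; apply: ler_pM => //; last exact: abs_sin_le.
    by apply: le_trans (abs_expRB1_le a) _; rewrite ler_wpM2l.
  by apply: le_trans (abs_sinBx_le b) _; rewrite b2 ler_peMr// sqr_ge0.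
apply: le_trans (lerD re im) _; rewrite -mulrDl ler_wpM2r ?(le_trans ler01)//.
nra.
Qed.

End ComplexEstimates.

Definition kder (K : numFieldType) (f : K -> K) (z d : K) : Prop :=
  fcvg (0 : K)^' (fun h => h^-1 * (f (h + z) - f z)) d.

Lemma kderP (K : numFieldType) (f : K -> K) (z d : K) :
  kder f z d <-> @is_derive K K^o K^o z 1 f d.
Proof.
rewrite /kder /fcvg; split=> [fd|[dd <-]].
  have fd' : h^-1 *: ((f \o shift z) (h *: (1 : K^o)) - f z) @[h --> (0:K)^'] --> (d : K^o).
    by under eq_fun do rewrite /= [_ *: 1]mulr1.
  by apply: DeriveDef; [apply/cvg_ex; exists d|exact/cvg_lim].
rewrite /derivable in dd.
by move: dd; rewrite /derive /=; under eq_fun do rewrite [_ *: 1]mulr1.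
Qed.

Lemma near_dnbhs0P (K : numFieldType) (P : K -> Prop) :
  (\forall h \near (0 : K)^', P h) <->
  exists2 d : K, 0 < d & forall h, `|h| < d -> h != 0 -> P h.
Proof.
rewrite /prop_near1 /nbhs /= /dnbhs /within /=; split.
  move=> /nbhs_ballP[d /= d0 dP]; exists d => // h hd h0; apply: dP => //.
  by rewrite -ball_normE /= sub0r normrN.
move=> [d d0 dP]; apply/nbhs_ballP; exists d => // h.
by rewrite -ball_normE /= sub0r normrN => hd h0; exact: dP.
Qed.

(** * Complex-valued Lebesgue integrals depending on a complex exponent *)

Section ComplexIntegrals.
Variable R : realType.
Local Notation mu := (@lebesgue_measure R).
Local Notation TR := (measurableTypeR R).
Implicit Types (D : set TR) (h g : R -> R[i]).

Definition cmeas D h := forall b, measurable_fun D (fun t : TR => cpart b (h t)).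

Definition cintble D h :=
  forall b, mu.-integrable D (EFin \o (fun t : TR => cpart b (h t))).

Lemma cpart_cintegral b D h :
  cpart b (cintegral D h) = \int[mu]_(t in D) cpart b (h t).
Proof. by case: b. Qed.

Lemma cpartM b (z w : R[i]) : cpart b (z * w) =
  if b then cpart false z * cpart true w + cpart true z * cpart false w
  else cpart false z * cpart false w - cpart true z * cpart true w.
Proof. by case: z w b => [a b'] [c d] [] /=; ring. Qed.

Lemma cmeasM D h g : cmeas D h -> cmeas D g -> cmeas D (fun t => h t * g t).
Proof.
move=> mh mg [].
  under eq_fun do rewrite cpartM.
  by apply: measurable_funD; apply: measurable_funM.
under eq_fun do rewrite cpartM.
by apply: measurable_funB; apply: measurable_funM.
Qed.

Lemma cmeasB D h g : cmeas D h -> cmeas D g -> cmeas D (fun t => h t - g t).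
Proof.
by move=> mh mg b; under eq_fun do rewrite cpartB; exact: measurable_funB.
Qed.

Lemma cmeas_cst D (z : R[i]) : cmeas D (fun=> z).
Proof. by move=> b; exact: measurable_cst. Qed.

Lemma cmeas_cexp D h : cmeas D h -> cmeas D (fun t => cexp (h t)).
Proof.
move=> mh b.
have me : measurable_fun D (fun t : TR => expR (cpart false (h t))).
  exact: (measurableT_comp (@measurable_expR R) (mh false)).
have mc : measurable_fun D (fun t : TR => cos (cpart true (h t))).
  exact: (measurableT_comp (continuous_measurable_fun (@continuous_cos R)) (mh true)).
have ms : measurable_fun D (fun t : TR => sin (cpart true (h t))).
  exact: (measurableT_comp (continuous_measurable_fun (@continuous_sin R)) (mh true)).
by case: b; [exact: (measurable_funM me ms)|exact: (measurable_funM me mc)].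
Qed.

Lemma cintble_dom D h (B : R -> R) : measurable D -> cmeas D h ->
  mu.-integrable D (EFin \o B) -> (forall t, D t -> cabs (h t) <= B t) ->
  cintble D h.
Proof.
move=> mD mh iB hB b; apply: (le_integrable mD _ _ iB).
  by apply/measurable_EFinP; exact: (mh b).
move=> t Dt /=; rewrite lee_fin; apply: le_trans (cabs_part b _) _.
by apply: le_trans (hB t Dt) _; exact: ler_norm.
Qed.

Lemma cintegralD D h g : measurable D -> cintble D h -> cintble D g ->
  cintegral D (fun t => h t + g t) = cintegral D h + cintegral D g.
Proof.
move=> mD ih ig; apply: cpart_inj => b; rewrite cpartD !cpart_cintegral -RintegralD//.
by apply: eq_Rintegral => t _; rewrite cpartD.
Qed.

Lemma cintegralB D h g : measurable D -> cintble D h -> cintble D g ->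
  cintegral D (fun t => h t - g t) = cintegral D h - cintegral D g.
Proof.
move=> mD ih ig; apply: cpart_inj => b; rewrite cpartB !cpart_cintegral -RintegralB//.
by apply: eq_Rintegral => t _; rewrite cpartB.
Qed.

Lemma cintegralZ D h (c : R[i]) : measurable D -> cintble D h ->
  cintegral D (fun t => c * h t) = c * cintegral D h.
Proof.
move=> mD ih.
have iZ b k : mu.-integrable D (EFin \o (fun t => k * cpart b (h t))).
  exact: (integrableZl mD k (ih b)).
apply: cpart_inj => b; rewrite cpart_cintegral cpartM !cpart_cintegral.
rewrite -!RintegralZl//; case: b.
  by rewrite -RintegralD//; apply: eq_Rintegral => t _; rewrite cpartM.
by rewrite -RintegralB//; apply: eq_Rintegral => t _; rewrite cpartM.
Qed.

Lemma cintbleZ D h (c : R[i]) : measurable D -> cintble D h ->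
  cintble D (fun t => c * h t).
Proof.
move=> mD ih.
have iZ b k : mu.-integrable D (EFin \o (fun t => k * cpart b (h t))).
  exact: (integrableZl mD k (ih b)).
move=> [].
  apply: (@eq_integrable _ _ _ mu D mD _ _ _ (integrableD mD (iZ true (cpart false c)) (iZ false (cpart true c)))).
  by move=> t _; rewrite /comp cpartM EFinD.
apply: (@eq_integrable _ _ _ mu D mD _ _ _ (integrableB mD (iZ false (cpart false c)) (iZ true (cpart true c)))).
by move=> t _; rewrite /comp cpartM EFinB.
Qed.

Lemma cintbleD D h g : measurable D -> cintble D h -> cintble D g ->
  cintble D (fun t => h t + g t).
Proof.
move=> mD ih ig b.
apply: (@eq_integrable _ _ _ mu D mD _ _ _ (integrableD mD (ih b) (ig b))).
by move=> t _; rewrite /comp cpartD EFinD.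
Qed.

Lemma cintbleB D h g : measurable D -> cintble D h -> cintble D g ->
  cintble D (fun t => h t - g t).
Proof.
move=> mD ih ig b.
apply: (@eq_integrable _ _ _ mu D mD _ _ _ (integrableB mD (ih b) (ig b))).
by move=> t _; rewrite /comp cpartB EFinB.
Qed.

(** The factor 2 comes from bounding the real and imaginary parts separately. *)
Lemma cabs_cintegral_le D h (B : R -> R) : measurable D -> cintble D h ->
  mu.-integrable D (EFin \o B) -> (forall t, D t -> cabs (h t) <= B t) ->
  cabs (cintegral D h) <= 2 * \int[mu]_(t in D) B t.
Proof.
move=> mD ih iB hB; apply: le_trans (cabs_le _) _; rewrite mulr_natl mulr2n.
have part b : `|cpart b (cintegral D h)| <= \int[mu]_(t in D) B t.
  rewrite cpart_cintegral; apply: le_trans (le_normr_Rintegral mD (ih b)) _.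
  apply: le_Rintegral => //; first exact: (integrable_norm (ih b)).
  by move=> t /= Dt; apply: le_trans (cabs_part b _) (hB t Dt).
by apply: lerD; [exact: (part false)|exact: (part true)].
Qed.

Definition csum (z : R[i]) : R := `|complex.Re z| + `|complex.Im z|.

Lemma csum_ge0 z : 0 <= csum z.
Proof. exact: addr_ge0. Qed.

Lemma csumM (z w : R[i]) : csum (z * w) <= csum z * csum w.
Proof.
case: z w => [a b] [c d]; rewrite /csum /=.
apply: le_trans (lerD (ler_normB _ _) (ler_normD _ _)) _.
rewrite !normrM le_eqVlt; apply/orP; left; apply/eqP; ring.
Qed.

Lemma csum_cabs (z : R[i]) : csum z <= 2 * cabs z.
Proof. by rewrite mulr_natl mulr2n; apply: lerD; [exact: (cabs_part false)|exact: (cabs_part true)]. Qed.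

(** In the domination hypothesis 1 serves the integrand, l^2 the Taylor remainder, 1 + l^2 >= l the
    derivative, and the exponential the shift of [z0] by h with [csum h <= e]. *)
Lemma cintegral_cexp_derive (D : set TR) (L g : R -> R[i]) (B : R -> R) (e : R) (z0 : R[i])
    (l := fun t => csum (L t)) :
  measurable D -> cmeas D L -> cmeas D g -> 0 < e ->
  mu.-integrable D (EFin \o B) ->
  (forall t, D t -> (1 + l t ^+ 2) * expR (e * l t) * cabs (cexp (z0 * L t) * g t) <= B t) ->
  kder (fun z => cintegral D (fun t => cexp (z * L t) * g t)) z0
    (cintegral D (fun t => L t * (cexp (z0 * L t) * g t))).
Proof.
move=> mD mL mg e0 iB hB.
have l0 t : 0 <= l t by exact: csum_ge0.
have le1sqr (x : R) : x <= 1 + x ^+ 2 by nra.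
have el1 t : 1 <= expR (e * l t) by rewrite -expR0 ler_expR mulr_ge0// ltW.
have l21 t : 1 <= 1 + l t ^+ 2 by rewrite lerDl sqr_ge0.
have c0 t : 0 <= cabs (cexp (z0 * L t) * g t) by exact: cabs_ge0.
have mz z : cmeas D (fun t => cexp (z * L t) * g t).
  by apply: cmeasM => //; apply: cmeas_cexp; apply: cmeasM => //; exact: cmeas_cst.
have i0 : cintble D (fun t => cexp (z0 * L t) * g t).
  apply: (cintble_dom mD (mz z0) iB) => t Dt; apply: le_trans (hB t Dt).
  by rewrite ler_peMl// mulr_ege1.
have i1 : cintble D (fun t => L t * (cexp (z0 * L t) * g t)).
  apply: (cintble_dom mD _ iB); first exact: cmeasM.
  move=> t Dt; apply: le_trans (hB t Dt); rewrite cabsM; apply: ler_wpM2r => //.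
  apply: (@le_trans _ _ (1 + l t ^+ 2)).
    exact: le_trans (cabs_le _) (le1sqr _).
  by rewrite ler_peMr// (le_trans ler01).
have hl (h : R[i]) t : csum h <= e -> csum (h * L t) <= e * l t.
  by move=> he; apply: le_trans (csumM _ _) _; apply: ler_wpM2r => //; exact: csum_ge0.
have ih (h : R[i]) : csum h <= e -> cintble D (fun t => cexp ((h + z0) * L t) * g t).
  move=> he; apply: (cintble_dom mD (mz _) iB) => t Dt; apply: le_trans (hB t Dt).
  rewrite mulrDl cexpD -mulrA cabsM; apply: ler_wpM2r => //.
  rewrite cabs_cexp; apply: (@le_trans _ _ (expR (e * l t))).
    rewrite ler_expR; apply: le_trans (hl _ _ he); apply: le_trans (ler_norm _) _.
    by rewrite lerDl.
  by rewrite ler_peMl// expR_ge0.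
have IB0 : 0 <= \int[mu]_(t in D) B t.
  apply: Rintegral_ge0 => t Dt; apply: le_trans (hB t Dt).
  by rewrite !mulr_ge0 ?expR_ge0// addr_ge0// sqr_ge0.
(* Origin of 32: [cexp_taylor] gives 4, squaring csum (h L) <= 2 |h| l gives another 4, and
   [cabs_cintegral_le] gives 2. *)
have est (h : R[i]) : csum h <= e ->
    cabs (cintegral D (fun t => cexp ((h + z0) * L t) * g t) -
          cintegral D (fun t => cexp (z0 * L t) * g t) -
          h * cintegral D (fun t => L t * (cexp (z0 * L t) * g t))) <=
    32 * cabs h ^+ 2 * \int[mu]_(t in D) B t.
  move=> he.
  have ihh := ih h he.
  have ih1 := cintbleB mD ihh i0.
  have ih2 := cintbleZ h mD i1.
  rewrite -(cintegralB mD ihh i0) -(cintegralZ h mD i1) -(cintegralB mD ih1 ih2).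
  set k := (X in cintegral D X).
  have kB t : D t -> cabs (k t) <= 16 * cabs h ^+ 2 * B t.
    move=> Dt.
    have -> : k t = (cexp (h * L t) - 1 - h * L t) * (cexp (z0 * L t) * g t).
      by rewrite /k mulrDl cexpD; ring.
    rewrite cabsM; apply: le_trans (ler_wpM2r (c0 t) (cexp_taylor _)) _.
    rewrite -/(csum _).
    have h1 : csum (h * L t) ^+ 2 <= 4 * cabs h ^+ 2 * l t ^+ 2.
      have -> : 4 * cabs h ^+ 2 * l t ^+ 2 = (2 * cabs h * l t) ^+ 2 by ring.
      rewrite ler_pXn2r ?nnegrE ?csum_ge0 ?mulr_ge0 ?cabs_ge0//.
      apply: le_trans (csumM _ _) _; apply: ler_wpM2r; [exact: csum_ge0|exact: csum_cabs].
    have h2 : expR (csum (h * L t)) <= expR (e * l t) by rewrite ler_expR hl.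
    have h3 := hB t Dt.
    have E0 := expR_ge0 (e * l t).
    apply: (@le_trans _ _ (16 * cabs h ^+ 2 * (l t ^+ 2 * expR (e * l t) * cabs (cexp (z0 * L t) * g t)))).
      have -> : 16 * cabs h ^+ 2 * (l t ^+ 2 * expR (e * l t) * cabs (cexp (z0 * L t) * g t)) =
        4 * (4 * cabs h ^+ 2 * l t ^+ 2) * expR (e * l t) * cabs (cexp (z0 * L t) * g t) by ring.
      apply: ler_wpM2r => //; apply: ler_pM; rewrite ?mulr_ge0 ?sqr_ge0 ?expR_ge0 ?csum_ge0//.
      by rewrite ler_wpM2l.
    apply: ler_wpM2l; first by rewrite mulr_ge0// sqr_ge0.
    apply: le_trans h3; apply: ler_wpM2r => //; apply: ler_wpM2r => //.
    by rewrite lerDr.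
  have iB' : mu.-integrable D (EFin \o (fun t => 16 * cabs h ^+ 2 * B t)).
    exact: (integrableZl mD _ iB).
  have ik : cintble D k.
    apply: (cintble_dom mD _ iB' kB).
    by apply: cmeasB; [exact: cmeasB|apply: cmeasM; [exact: cmeas_cst|exact: cmeasM]].
  apply: le_trans (cabs_cintegral_le mD ik iB' kB) _.
  rewrite RintegralZl// le_eqVlt; apply/orP; left; apply/eqP; ring.
apply/fcvgP => r; rewrite ltcE /= => /andP[/eqP ri r0].
rewrite (_ : r = (complex.Re r)%:C); last by rewrite [LHS]complexE ri mulr0 addr0.
set IB := \int[mu]_(t in D) B t in IB0 est.
(* The first bound ensures [csum h <= e], since csum is at most twice the modulus; the second makes
   the quadratic estimate, divided by |h|, smaller than [r]. The summand 1 covers a vanishing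
   integral of [B]. *)
pose d := Num.min (e / 2) (complex.Re r / (32 * (IB + 1))).
have IB1 : 0 < 32 * (IB + 1) by rewrite mulr_gt0// ltr_wpDl.
have d0 : 0 < d by rewrite lt_min !divr_gt0.
apply/near_dnbhs0P; exists (d%:C : R[i]); first by rewrite ltcR.
move=> h; rewrite cabsE ltcR => hd h0.
rewrite cabsE ltcR.
have ha0 : 0 < cabs h by rewrite lt_def cabs_ge0 cabs_eq0 h0.
have he : csum h <= e.
  apply: le_trans (csum_cabs h) _.
  by move: hd; rewrite lt_min => /andP[hd _]; rewrite mulrC -ler_pdivlMr// ltW.
have := est h he.
set X := cintegral D _ - cintegral D _; set Y := cintegral D _ => XY.
have -> : Y - h^-1 * X = - (h^-1 * (X - h * Y)).
  by rewrite (mulrBr h^-1 X) (mulKf h0) opprB.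
rewrite cabsN cabsM.
rewrite cabsV.
rewrite mulrC ltr_pdivrMr//; apply: le_lt_trans XY _.
have hd2 : cabs h * (32 * (IB + 1)) < complex.Re r.
  by move: hd; rewrite lt_min => /andP[_]; rewrite ltr_pdivlMr.
apply: le_lt_trans (_ : cabs h * (32 * (IB + 1)) * cabs h < _); last by rewrite ltr_pM2r.
rewrite expr2; nra.
Qed.

End ComplexIntegrals.

Definition ktends (K : numFieldType) (g : K -> K) (a b : K) : Prop :=
  fcvg (nbhs a) g b.

Lemma ktendsP (K : numFieldType) (g : K -> K) (a b : K) :
  ktends g a b <-> forall e : K, 0 < e ->
    exists2 d : K, 0 < d & forall u, `|u - a| < d -> `|b - g u| < e.
Proof.
split=> [/fcvgP h e e0|h].
  have /nbhs_ballP[d /= d0 dP] := h e e0; exists d => // u ud; apply: dP.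
  by rewrite -ball_normE /= distrC.
apply/fcvgP => e e0; have [d d0 dP] := h e e0; apply/nbhs_ballP; exists d => // u.
by rewrite -ball_normE /= distrC; exact: dP.
Qed.

Lemma fcvg_comp (K : numFieldType) (T : Type) (F : set_system T) (f : T -> K)
    (a b : K) (g : K -> K) :
  fcvg F f a -> ktends g a b -> fcvg F (fun t => g (f t)) b.
Proof. exact: cvg_comp. Qed.

Lemma near_eq_fcvg (K : numFieldType) (T : Type) (F : set_system T) (FF : Filter F)
    (f g : T -> K) (a : K) :
  (\forall t \near F, f t = g t) -> fcvg F f a -> fcvg F g a.
Proof. by move=> fg; apply: cvg_trans; exact: near_eq_cvg. Qed.

Lemma fcvgD (K : numFieldType) (T : Type) (F : set_system T) (FF : Filter F)
    (f g : T -> K) (a b : K) :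
  fcvg F f a -> fcvg F g b -> fcvg F (fun t => f t + g t) (a + b).
Proof. exact: cvgD. Qed.

Lemma fcvgM (K : numFieldType) (T : Type) (F : set_system T) (FF : Filter F)
    (f g : T -> K) (a b : K) :
  fcvg F f a -> fcvg F g b -> fcvg F (fun t => f t * g t) (a * b).
Proof. exact: cvgM. Qed.

Lemma fcvg_cst (K : numFieldType) (T : Type) (F : set_system T) (FF : Filter F)
    (a : K) : fcvg F (fun=> a) a.
Proof. exact: cvg_cst. Qed.

Lemma cvg_cpart (R : realType) (T : Type) (F : set_system T) (FF : Filter F)
    (h : T -> R[i]) (z : R[i]) :
  fcvg F h z <-> forall b, cpart b (h t) @[t --> F] --> cpart b z.
Proof.
split=> [/cvg_ReIm[hr hi] [] //|h_]; apply/cvg_ReIm.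
by split; [exact: (h_ false)|exact: (h_ true)].
Qed.

(** * Complex functions of a real parameter *)

Section RealParameter.
Variable R : realType.
Implicit Types (f g w : R -> R[i]) (F : R[i] -> R[i]) (t : R).

Definition ccont f t := fcvg (nbhs t) f (f t).

Definition cder f t (d : R[i]) :=
  forall b, is_derive t (1:R) (fun u => cpart b (f u)) (cpart b d).

Lemma cderP f t d :
  cder f t d <-> fcvg (0:R)^' (fun h : R => (h^-1)%:C * (f (h + t) - f t)) d.
Proof.
have E b h : cpart b ((h^-1)%:C * (f (h + t) - f t)) =
    h^-1 * (cpart b (f (h + t)) - cpart b (f t)).
  by rewrite cpartM !cpartB; case: b => /=; ring.
have D b : is_derive t (1:R) (fun u => cpart b (f u)) (cpart b d) <->
    (h^-1 * (cpart b (f (h + t)) - cpart b (f t)) @[h --> (0:R)^'] --> cpart b d).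
  split=> [[dd <-]|fd].
    by move: dd; rewrite /derivable /derive /=; under eq_fun do rewrite [_ *: 1]mulr1.
  have fd' : h^-1 *: (((fun u => cpart b (f u)) \o shift t) (h *: (1:R)) - cpart b (f t))
      @[h --> (0:R)^'] --> (cpart b d : R).
    by under eq_fun do rewrite /= [_ *: 1]mulr1.
  by apply: DeriveDef; [apply/cvg_ex; exists (cpart b d)|exact/cvg_lim].
split=> [fd|/cvg_cpart fd b].
  by apply/cvg_cpart => b; under eq_fun do rewrite E; exact/D/fd.
by apply/D; under eq_fun do rewrite -E; exact: fd.
Qed.

Lemma cder_ccont f t d : cder f t d -> ccont f t.
Proof.
move=> fd; apply/cvg_cpart => b.
by apply/differentiable_continuous/derivable1_diffP; have [] := fd b.
Qed.

Lemma ccont_part f t b : ccont f t -> {for t, continuous (fun u => cpart b (f u))}.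
Proof. by move=> /cvg_cpart; apply. Qed.

Lemma ccontM f g t : ccont f t -> ccont g t -> ccont (fun u => f u * g u) t.
Proof. exact: fcvgM. Qed.

Lemma ccontD f g t : ccont f t -> ccont g t -> ccont (fun u => f u + g u) t.
Proof. exact: fcvgD. Qed.

Lemma ccont_cst (z : R[i]) t : ccont (fun=> z) t.
Proof. exact: fcvg_cst. Qed.

Lemma ccont_comp F w t : ccont w t -> ktends F (w t) (F (w t)) ->
  ccont (fun u => F (w u)) t.
Proof. exact: fcvg_comp. Qed.

Lemma cderM f g t d e : cder f t d -> cder g t e ->
  cder (fun u => f u * g u) t (d * g t + f t * e).
Proof.
move=> fd ge [].
  rewrite (_ : (fun u => _) = (fun u => cpart false (f u)) * (fun u => cpart true (g u)) +
     (fun u => cpart true (f u)) * (fun u => cpart false (g u))); last first.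
    by apply/funext => u; rewrite cpartM.
  apply: is_derive_eq (is_deriveD (is_deriveM (fd false) (ge true))
    (is_deriveM (fd true) (ge false))) _.
  by rewrite cpartD !cpartM /GRing.scale /=; ring.
rewrite (_ : (fun u => _) = (fun u => cpart false (f u)) * (fun u => cpart false (g u)) -
   (fun u => cpart true (f u)) * (fun u => cpart true (g u))); last first.
  by apply/funext => u; rewrite cpartM.
apply: is_derive_eq (is_deriveB (is_deriveM (fd false) (ge false))
  (is_deriveM (fd true) (ge true))) _.
by rewrite cpartD !cpartM /GRing.scale /=; ring.
Qed.

Lemma cder_cst (z : R[i]) t : cder (fun=> z) t 0.
Proof. by move=> b; rewrite (_ : cpart b 0 = 0); [exact: is_derive_cst|case: b]. Qed.

Lemma cder_eq f t d d' : cder f t d -> d = d' -> cder f t d'.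
Proof. by move=> ? <-. Qed.

(* Caratheodory's form of differentiability avoids dividing by increments of w,
   which may vanish. *)
Lemma cder_comp F w t (d e : R[i]) : kder F (w t) d -> cder w t e ->
  cder (fun u => F (w u)) t (d * e).
Proof.
move=> Fd wd; apply/cderP.
pose q (u : R[i]) : R[i] := if u == 0 then d else u^-1 * (F (u + w t) - F (w t)).
have qd : ktends q 0 d.
  apply/ktendsP => r r0; have /fcvgP/(_ r r0)/near_dnbhs0P[k k0 kP] := Fd.
  exists k => // u; rewrite subr0 => uk.
  rewrite /q; case: eqVneq => [_|u0]; first by rewrite subrr normr0.
  exact: kP.
have /cderP wd' := wd.
have wc : fcvg (0:R)^' (fun h : R => w (h + t) - w t) 0.
  have h0 : fcvg (0:R)^' (fun h : R => h%:C) (0 : R[i]).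
    by apply: cvg_real_complex; exact: cvg_within.
  have : fcvg (0:R)^' (fun h : R => h%:C * ((h^-1)%:C * (w (h + t) - w t))) (0 * e).
    exact: (fcvgM _ h0 wd').
  rewrite mul0r; apply: near_eq_fcvg.
  near=> h; rewrite mulrA -rmorphM mulfV ?rmorph1 ?mul1r//.
  by near: h; exact: nbhs_dnbhs_neq.
rewrite (_ : (fun h : R => _) = fun h : R =>
   q (w (h + t) - w t) * ((h^-1)%:C * (w (h + t) - w t))).
  exact: (fcvgM _ (fcvg_comp wc qd) wd').
apply/funext => h; rewrite /q; case: eqVneq => [E|ne].
  by rewrite E mulr0 mulr0 (_ : w (h + t) = w t) ?subrr ?mulr0//; apply/eqP; rewrite -subr_eq0 E.
by rewrite subrK [RHS]mulrC -mulrA (mulVKf ne).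
Unshelve. all: by end_near. Qed.

End RealParameter.

(** * The contour integrands in polar coordinates *)

Section PolarDerivatives.
Variable R : realType.
Implicit Types (F : R[i] -> R[i]) (t phi : R) (z : R[i]).

Lemma cder_cexp (w : R -> R[i]) t (d : R[i]) :
  cder w t d -> cder (fun u => cexp (w u)) t (d * cexp (w t)).
Proof.
move=> wd.
have de : is_derive t (1:R) (fun u => expR (cpart false (w u)))
    (expR (cpart false (w t)) * cpart false d).
  exact: (is_derive1_comp (is_derive_expR (cpart false (w t))) (wd false)).
have dc : is_derive t (1:R) (fun u => cos (cpart true (w u)))
    (- sin (cpart true (w t)) * cpart true d).
  exact: (is_derive1_comp (is_derive_cos (cpart true (w t))) (wd true)).
have ds : is_derive t (1:R) (fun u => sin (cpart true (w u)))
    (cos (cpart true (w t)) * cpart true d).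
  exact: (is_derive1_comp (is_derive_sin (cpart true (w t))) (wd true)).
move=> [].
  by apply: is_derive_eq (is_deriveM de ds) _; rewrite cpartM /GRing.scale /=; ring.
by apply: is_derive_eq (is_deriveM de dc) _; rewrite cpartM /GRing.scale /=; ring.
Qed.

Lemma cder_ray phi t : cder (fun u => polar u phi) t (polar 1 phi).
Proof.
move=> b; rewrite (_ : (fun u => _) = (cpart b (polar 1 phi)) \*: (id : R -> R)).
  by apply: is_derive_eq; rewrite /GRing.scale /= mulr1.
by apply/funext => u; rewrite /GRing.scale /=; case: b; rewrite /= ?mul1r mulrC.
Qed.

Lemma cder_circle phi t : cder (polar t) phi ('i%C * polar t phi).
Proof.
move=> b; case: b => /=.
  rewrite (_ : (fun u => _) = t \*: @sin R)//.
  apply: is_derive_eq (is_deriveZ _ (is_derive_sin _)) _; rewrite /GRing.scale /=; ring.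
rewrite (_ : (fun u => _) = t \*: @cos R)//.
apply: is_derive_eq (is_deriveZ _ (is_derive_cos _)) _; rewrite /GRing.scale /=; ring.
Qed.

Lemma cder_log_ray phi t : 0 < t -> cder (fun u => ln u +i* phi) t (t^-1)%:C.
Proof.
move=> t0 [] /=; first exact: is_derive_cst.
exact: is_derive1_ln.
Qed.

Lemma cder_log_circle phi (c : R) : cder (fun u => c +i* u) phi 'i%C.
Proof. by move=> [] /=; [exact: is_derive_id|exact: is_derive_cst]. Qed.

Lemma cder_polar_pow_ray phi t z : 0 < t ->
  cder (fun u => polar_pow u phi z) t (z * (t^-1)%:C * polar_pow t phi z).
Proof.
move=> t0; have := cderM (cder_cst z t) (cder_log_ray phi t0); rewrite mul0r add0r.
exact: cder_cexp.
Qed.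

Lemma cder_polar_pow_circle phi t z :
  cder (fun u => polar_pow t u z) phi (z * 'i%C * polar_pow t phi z).
Proof.
have := cderM (cder_cst z phi) (cder_log_circle phi (ln t)); rewrite mul0r add0r.
exact: cder_cexp.
Qed.

Lemma polarE t phi : polar t phi = t%:C * polar 1 phi.
Proof. by apply: cpart_inj => b; rewrite cpartM; case: b => /=; ring. Qed.

Lemma cabs_polar1 phi : cabs (polar 1 phi : R[i]) = 1.
Proof.
by rewrite /cabs normc_def /= !mul1r cos2Dsin2 sqrtr1.
Qed.

Lemma cabs_polar t phi : cabs (polar t phi : R[i]) = `|t|.
Proof. by rewrite polarE cabsM cabs_real cabs_polar1 mulr1. Qed.

Lemma cabs_i : cabs ('i%C : R[i]) = 1.
Proof. by rewrite /cabs normc_def /= expr0n /= expr1n add0r sqrtr1. Qed.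

Definition ray_integrand phi z F t : R[i] :=
  polar_pow t phi z * F (polar t phi) * polar 1 phi.

Definition circle_integrand t z F phi : R[i] :=
  polar_pow t phi z * F (polar t phi) * ('i%C * polar t phi).

(* The common value of the derivative of circle_integrand in t and of that of
   ray_integrand in phi, which is Cauchy's theorem in polar coordinates. *)
Definition sector_integrand z F (F' : R[i] -> R[i]) t phi : R[i] :=
  'i%C * polar 1 phi * polar_pow t phi z *
  ((z + 1) * F (polar t phi) + polar t phi * F' (polar t phi)).

Lemma cder_circle_integrand z F F' t phi : 0 < t ->
  kder F (polar t phi) (F' (polar t phi)) ->
  cder (fun u => circle_integrand u z F phi) t (sector_integrand z F F' t phi).
Proof.
move=> t0 Fd.
have h := cderM (cderM (cder_polar_pow_ray phi z t0) (@cder_comp _ F (fun u => polar u phi) t _ _ Fd (cder_ray phi t)))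
  (cderM (cder_cst 'i%C t) (cder_ray phi t)).
apply: cder_eq h _; rewrite /sector_integrand mul0r add0r.
have -> : polar t phi = t%:C * polar 1 phi by exact: polarE.
have tt : (t^-1)%:C * t%:C = 1 :> R[i] by rewrite -rmorphM mulVf ?gt_eqF// rmorph1.
set e := polar 1 phi; set p := polar_pow t phi z; set Fv := F _; set Fv' := F' _.
transitivity (z * ((t^-1)%:C * t%:C) * p * Fv * ('i%C * e) +
   p * Fv' * e * ('i%C * (t%:C * e)) + p * Fv * ('i%C * e)); first by ring.
by rewrite tt; ring.
Qed.

Lemma cder_ray_integrand z F F' t phi :
  kder F (polar t phi) (F' (polar t phi)) ->
  cder (fun u => ray_integrand u z F t) phi (sector_integrand z F F' t phi).
Proof.
move=> Fd.
have h := cderM (cderM (cder_polar_pow_circle phi t z) (cder_comp Fd (cder_circle phi t)))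
  (cder_circle phi 1).
apply: cder_eq h _; rewrite /sector_integrand; ring.
Qed.

Lemma ccont_sector_integrand z F F' t phi :
  kder F (polar t phi) (F' (polar t phi)) ->
  ktends F' (polar t phi) (F' (polar t phi)) ->
  ccont (sector_integrand z F F' t) phi.
Proof.
move=> Fd cF'.
have cp : ccont (polar t) phi := cder_ccont (cder_circle phi t).
apply: ccontM.
  apply: ccontM; last exact: cder_ccont (cder_polar_pow_circle phi t z).
  by apply: ccontM; [exact: ccont_cst|exact: cder_ccont (cder_circle phi 1)].
apply: ccontD.
  apply: ccontM; first exact: ccont_cst.
  exact: cder_ccont (cder_comp Fd (cder_circle phi t)).
exact: (ccontM cp (ccont_comp cp cF')).
Qed.

Lemma ccont_circle_integrand t z F phi d : kder F (polar t phi) d ->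
  ccont (circle_integrand t z F) phi.
Proof.
move=> Fd.
have c1 := cder_ccont (cder_polar_pow_circle phi t z).
have c2 := cder_ccont (cder_comp Fd (cder_circle phi t)).
have c3 := cder_ccont (cder_circle phi t).
have h := ccontM (ccontM c1 c2) (ccontM (@ccont_cst R _ phi) c3).
exact: h.
Qed.

Lemma cabs_polar_pow t phi z :
  cabs (polar_pow t phi z) <= expR (csum z * (`|ln t| + `|phi|)).
Proof.
rewrite /polar_pow cabs_cexp ler_expR; apply: le_trans (ler_norm _) _.
apply: (@le_trans _ _ (csum (z * (ln t +i* phi)))); first by rewrite lerDl.
exact: csumM.
Qed.

End PolarDerivatives.

(** * Cauchy's theorem on annular sectors *)

Section SectorCauchy.
Variable R : realType.
Local Notation mu := (@lebesgue_measure R).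
Local Notation TR := (measurableTypeR R).

Lemma Rintegral_FTC2 (f F : R -> R) (a b : R) : a < b ->
  (forall x : R, a <= x <= b -> is_derive x (1:R) F (f x)) ->
  (forall x : R, a <= x <= b -> {for x, continuous f}) ->
  \int[mu]_(x in `[a, b]) f x = F b - F a.
Proof.
move=> ab dF cf.
have cF (x : R) : a <= x <= b -> {for x, continuous F}.
  by move=> xab; apply/differentiable_continuous/derivable1_diffP; have [] := dF x xab.
have aab : a <= a <= b by rewrite lexx ltW.
have bab : a <= b <= b by rewrite lexx ltW.
rewrite /Rintegral (@continuous_FTC2 _ f F a b ab).
- by rewrite -EFinB.
- apply: continuous_in_subspaceT => x; rewrite inE /= in_itv /= => xab.
  exact: cf.
- split.
  + by move=> x; rewrite in_itv/= => /andP[ax xb]; have [] := dF x _; rewrite ?ltW.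
  + exact: cvg_at_right_filter (cF a aab).
  + exact: cvg_at_left_filter (cF b bab).
- move=> x; rewrite in_itv/= => /andP[ax xb].
  by have [_] := dF x (introT andP (conj (ltW ax) (ltW xb))); rewrite derive1E.
Qed.

Lemma norm_between (a x b : R) : a <= x -> x <= b -> `|x| <= `|a| + `|b|.
Proof.
move=> ax xb.
have a1 : - `|a| <= a by rewrite lerNl -normrN ler_norm.
have b1 : b <= `|b| by exact: ler_norm.
have a0 : 0 <= `|a| by []. have b0 : 0 <= `|b| by [].
by rewrite ler_norml; apply/andP; split; lra.
Qed.

Lemma cmeas_ccont (a b : R) (h : R -> R[i]) :
  (forall t, a <= t <= b -> ccont h t) -> cmeas (`[a, b] : set TR) h.
Proof.
move=> ch c; apply: subspace_continuous_measurable_fun => //.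
apply: continuous_in_subspaceT => x; rewrite inE /= in_itv /= => xab.
exact: ccont_part (ch x xab).
Qed.

Lemma cintble_ccont (a b : R) (h : R -> R[i]) :
  (forall t, a <= t <= b -> ccont h t) -> cintble (`[a, b] : set TR) h.
Proof.
move=> ch c; apply: continuous_compact_integrable; first exact: segment_compact.
apply: continuous_in_subspaceT => x; rewrite inE /= in_itv /= => xab.
exact: ccont_part (ch x xab).
Qed.

Variables (F F' : R[i] -> R[i]) (r B theta : R) (z : R[i]).
Hypothesis dF : forall w, cabs w < r -> kder F w (F' w).
Hypothesis cF' : forall w, cabs w < r -> ktends F' w (F' w).
Hypothesis F_bd : forall w, cabs w < r -> cabs (F w) <= B.
Hypothesis F'_bd : forall w, cabs w < r -> cabs (F' w) <= B.

Let I : set TR := `[theta - 2 * pi, theta].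

Let pi2 : theta - 2 * pi < theta.
Proof. by rewrite ltrBlDr ltrDl mulr_gt0// pi_gt0. Qed.

Let in_disc t phi : 0 < t < r -> cabs (polar t phi : R[i]) < r.
Proof. by move=> /andP[t0 tr]; rewrite cabs_polar gtr0_norm. Qed.

Let circle t := cintegral I (circle_integrand t z F).

(** Differentiation under the integral in the radius produces [sector_integrand]. This is also the
    angular derivative of the ray integrand, so its integral over the angle is the difference of the
    two boundary values. *)
Lemma circle_integral_derive t b : 0 < t < r ->
  is_derive t (1:R) (fun u => cpart b (circle u))
    (cpart b (ray_integrand theta z F t) - cpart b (ray_integrand (theta - 2 * pi) z F t)).
Proof.
move=> t0r; have /andP[t0 tr] := t0r.
(* A window around [t] inside the disc and away from 0, on which the logarithm of the radius stays
   bounded. *)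
pose u := t / 2; pose v := (t + r) / 2.
have u0 : 0 < u by rewrite divr_gt0.
have ut : u < t by rewrite /u; lra.
have tv : t < v by rewrite /v; lra.
have vr : v < r by rewrite /v; lra.
have uvr s : s \in `]u, v[ -> 0 < s < r.
  by rewrite in_itv/= => /andP[us sv]; rewrite (lt_trans u0 us) (lt_trans sv vr).
have tuv : `]u, v[%classic t by rewrite /= in_itv/= ut tv.
pose k s phi := cpart b (circle_integrand s z F phi).
have dk s phi : s \in `]u, v[ -> is_derive s (1:R) (k ^~ phi) (cpart b (sector_integrand z F F' s phi)).
  move=> /uvr suv; have /andP[s0 _] := suv.
  exact: (cder_circle_integrand z s0 (dF (in_disc phi suv))).
have B0 : 0 <= B.
  by apply: le_trans (cabs_ge0 _) (F_bd (w := 0) _); rewrite cabs0 (lt_trans t0 tr).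
pose C := expR (csum z * (`|ln u| + `|ln v| + (`|theta| + 2 * pi))) *
   (cabs (z + 1) * B + r * B).
have pi0 : 0 <= 2 * pi :> R by rewrite mulr_ge0// pi_ge0.
have C0 : 0 <= C.
  rewrite mulr_ge0 ?expR_ge0// addr_ge0// mulr_ge0 ?cabs_ge0//.
  by rewrite ltW// (lt_trans t0).
have Cb s phi : `]u, v[%classic s -> I phi -> `|partial1of2 k s phi| <= C.
  move=> suv; rewrite /I /= in_itv/= => /andP[p1 p2].
  have sr := uvr s suv; have /andP[s0 s1] := sr.
  rewrite partial1of2E; have [_ ->] := dk s phi suv.
  apply: le_trans (cabs_part _ _) _.
  rewrite /sector_integrand !cabsM cabs_i cabs_polar1 mul1r mul1r.
  apply: ler_pM; rewrite ?cabs_ge0//.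
    apply: le_trans (cabs_polar_pow _ _ _) _; rewrite ler_expR.
    apply: ler_wpM2l; first exact: csum_ge0.
    move: suv; rewrite /= in_itv/= => /andP[us sv].
    apply: lerD.
      have l1 : ln u <= ln s by rewrite ler_ln ?posrE// ltW.
      have l2 : ln s <= ln v by rewrite ler_ln ?posrE ?ltW// (lt_trans u0 (lt_trans ut tv)).
      exact: norm_between.
    have t1 : theta <= `|theta| by exact: ler_norm.
    have t2 : - `|theta| <= theta by rewrite lerNl -normrN ler_norm.
    by rewrite ler_norml; apply/andP; split; lra.
  apply: le_trans (cabsD _ _) _; apply: lerD; rewrite cabsM.
    by apply: ler_wpM2l; [exact: cabs_ge0|apply: F_bd; exact: in_disc].
  apply: ler_pM; rewrite ?cabs_ge0//; first by rewrite ltW// in_disc.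
  by apply: F'_bd; exact: in_disc.
have ik s : `]u, v[%classic s -> mu.-integrable I (EFin \o k s).
  move=> suv; have sr := uvr s suv.
  have ci : cintble I (circle_integrand s z F).
    apply: cintble_ccont => phi _.
    exact: ccont_circle_integrand (dF (in_disc phi sr)).
  exact: (ci b).
have iC : mu.-integrable I (EFin \o (fun=> C)).
  apply: (@continuous_compact_integrable R (fun=> C) I); first exact: segment_compact.
  by apply: continuous_in_subspaceT => x _; exact: cst_continuous.
have mI : measurable I by exact: measurable_itv.
have dk' s phi : `]u, v[%classic s -> I phi -> derivable (k ^~ phi) s 1.
  by move=> suv _; have [] := dk s phi suv.
have h1 := @derivable_under_integral R _ _ mu k I mI t u v tuv ik dk' (fun=> C) (fun=> C0) iC Cb.
have h2 := @differentiation_under_integral R _ _ mu k I mI t u v tuv ik dk' (fun=> C) (fun=> C0) iC Cb.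
rewrite (_ : (fun u0 => _) = fun x' => \int[mu]_(y in I) k x' y); last first.
  by apply/funext => s; rewrite cpart_cintegral.
apply: DeriveDef; first exact: h1.
rewrite -derive1E h2.
rewrite (@eq_Rintegral _ _ _ mu I (fun phi => cpart b (sector_integrand z F F' t phi))); last first.
  move=> phi _; rewrite partial1of2E; have tuv' : t \in `]u, v[ by [].
  by have [_ ->] := dk t phi tuv'.
have dr (phi : R) : theta - 2 * pi <= phi <= theta ->
    is_derive phi (1:R) (fun p => cpart b (ray_integrand p z F t))
      (cpart b (sector_integrand z F F' t phi)).
  by move=> _; exact: (cder_ray_integrand z (dF (in_disc phi t0r)) b).
have cr (phi : R) : theta - 2 * pi <= phi <= theta ->
    {for phi, continuous (fun p => cpart b (sector_integrand z F F' t p))}.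
  move=> _; have d := in_disc phi t0r.
  exact: (@ccont_part R _ _ b (@ccont_sector_integrand R z F F' t phi (dF d) (cF' d))).
exact: Rintegral_FTC2 pi2 dr cr.
Qed.

Lemma ccont_ray_integrand phi t : 0 < t < r -> ccont (ray_integrand phi z F) t.
Proof.
move=> t0r; have /andP[t0 tr] := t0r.
have c1 := cder_ccont (cder_polar_pow_ray phi z t0).
refine (ccontM (ccontM c1 _) (@ccont_cst R _ t)).
exact: cder_ccont (@cder_comp _ F (fun u => polar u phi) t _ _ (dF (in_disc phi t0r)) (cder_ray phi t)).
Qed.

(** The radial derivative is integrated from [a] to [b]. The two rays are kept apart because the
    arguments theta and theta - 2 pi use different determinations of mu^z. *)
Lemma sector_cauchy a b : 0 < a -> a < b -> b < r ->
  circle b - circle a =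
  cintegral `[a, b] (ray_integrand theta z F) -
  cintegral `[a, b] (ray_integrand (theta - 2 * pi) z F).
Proof.
move=> a0 ab br; apply: cpart_inj => c.
have abr t : a <= t <= b -> 0 < t < r.
  by move=> /andP[at_ tb]; rewrite (lt_le_trans a0 at_) (le_lt_trans tb br).
have ci phi : cintble (`[a, b] : set TR) (ray_integrand phi z F).
  by apply: cintble_ccont => t /abr; exact: ccont_ray_integrand.
have mI : measurable (`[a, b] : set TR) by exact: measurable_itv.
rewrite !cpartB !(cpart_cintegral _ `[a, b]%classic).
rewrite -(RintegralB mI (ci theta c) (ci (theta - 2 * pi) c)).
have dc (t : R) : a <= t <= b -> is_derive t (1:R) (fun u => cpart c (circle u))
    (cpart c (ray_integrand theta z F t) - cpart c (ray_integrand (theta - 2 * pi) z F t)).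
  by move=> /abr; exact: circle_integral_derive.
have cc (t : R) : a <= t <= b -> {for t, continuous (fun t =>
    cpart c (ray_integrand theta z F t) - cpart c (ray_integrand (theta - 2 * pi) z F t))}.
  move=> /abr t0r; apply: continuousB.
    by apply: (@ccont_part R (ray_integrand theta z F) t c); exact: ccont_ray_integrand.
  by apply: (@ccont_part R (ray_integrand (theta - 2 * pi) z F) t c); exact: ccont_ray_integrand.
exact/esym/(Rintegral_FTC2 ab dc cc).
Qed.

End SectorCauchy.

Section RayIntegrals.
Variable R : realType.
Local Notation mu := (@lebesgue_measure R).
Local Notation TR := (measurableTypeR R).

Lemma expR_ln_derive (p t : R) : 0 < t ->
  is_derive t (1:R) (fun u => expR (p * ln u)) (p * t^-1 * expR (p * ln t)).
Proof.
move=> t0.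
have d1 : is_derive t (1:R) (p \*: @ln R) (p *: t^-1) by apply: is_deriveZ; exact: is_derive1_ln.
have := is_derive1_comp (is_derive_expR ((p \*: @ln R) t)) d1.
by move=> h; apply: is_derive_eq h _; rewrite /GRing.scale /= mulrC.
Qed.

Lemma cvg_ln_pinfty : @ln R t @[t --> +oo] --> +oo.
Proof.
apply/cvgryPge => A; near=> t.
rewrite -(expRK A) ler_ln ?posrE ?expR_gt0//; near: t; exact: nbhs_pinfty_ge.
Unshelve. all: by end_near. Qed.

(** The power t^p, with antiderivative t^(p+1)/(p+1), which tends to 0 at infinity. *)
Lemma integrable_expR_ln (p rho : R) : p < -1 -> 0 < rho ->
  mu.-integrable `[rho, +oo[ (EFin \o (fun t => expR (p * ln t))).
Proof.
move=> p1 r0; have p0 : p + 1 < 0 by lra.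
have ct (t : R) : rho <= t -> {for t, continuous (fun t => expR (p * ln t))}.
  move=> rt; apply/differentiable_continuous/derivable1_diffP.
  by have [] := expR_ln_derive p (lt_le_trans r0 rt).
have dF (t : R) : rho <= t ->
    is_derive t (1:R) (fun u => (p + 1)^-1 * expR ((p + 1) * ln u)) (expR (p * ln t)).
  move=> rt; have t0 := lt_le_trans r0 rt.
  have h := is_deriveZ (p + 1)^-1 (expR_ln_derive (p + 1) t0).
  apply: is_derive_eq h _; rewrite /GRing.scale /= !mulrA mulVf ?lt_eqF// mul1r.
  rewrite mulrDl mul1r expRD lnK ?posrE// mulrCA mulVf ?gt_eqF// mulr1//.
have cw : {within `[rho, +oo[, continuous (fun t => expR (p * ln t))}.
  apply: continuous_in_subspaceT => x; rewrite inE /= in_itv /= andbT => rx.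
  exact: ct.
apply/integrableP; split.
  apply/measurable_EFinP; apply: subspace_continuous_measurable_fun => //.
under eq_integral do rewrite /= ger0_norm ?expR_ge0//.
rewrite (@ge0_continuous_FTC2y R (fun t => expR (p * ln t))
  (fun u => (p + 1)^-1 * expR ((p + 1) * ln u)) rho 0).
- by rewrite -EFinB ltry.
- by move=> x _; exact: expR_ge0.
- exact: cw.
- rewrite -(mulr0 (p + 1)^-1); apply: cvgM; first exact: cvg_cst.
  have -> : (fun x : R => expR ((p + 1) * ln x)) = (fun x => expR (- (- (p + 1) * ln x))).
    by apply/funext => x; rewrite mulNr opprK.
  apply: (@cvg_comp _ _ _ (fun x : R => - (p + 1) * ln x) (fun y => expR (- y)) _ +oo).
    apply: gt0_cvgMry; last exact: cvg_ln_pinfty.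
    by rewrite oppr_gt0.
  exact: cvgr_expR.
- by move=> x rx; have [] := dF x (ltW rx).
- have cF : {for rho, continuous (fun u => (p + 1)^-1 * expR ((p + 1) * ln u))}.
    apply/differentiable_continuous/derivable1_diffP.
    by have [] := dF rho (lexx _).
  exact: cvg_at_right_filter cF.
- move=> x; rewrite in_itv/= andbT => rx.
  by have [_] := dF x (ltW rx); rewrite derive1E.
Qed.

End RayIntegrals.

(** * Contour integrals as functions of the exponent *)

Section ContourLog.
Variable R : realType.
Local Notation mu := (@lebesgue_measure R).
Local Notation TR := (measurableTypeR R).

Lemma eq_cintegral (D : set R) (h g : R -> R[i]) :
  (forall t, D t -> h t = g t) -> cintegral D h = cintegral D g.
Proof.
move=> hg; rewrite /cintegral; congr (_ +i* _);
  by apply: eq_Rintegral => t; rewrite inE => /hg ->.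
Qed.

Lemma cintegral_itvS (h : R -> R[i]) (a b : R) : a < b ->
  cintble (`[a, +oo[ : set TR) h ->
  cintegral `[a, +oo[ h = cintegral `[a, b] h + cintegral `[b, +oo[ h.
Proof.
move=> ab ih; apply: cpart_inj => c.
rewrite cpartD !(cpart_cintegral c).
have := @Rintegral_itvB R (fun t => cpart c (h t)) (BLeft a) +oo%O b (ih c).
rewrite bnd_simp => /(_ (ltW ab) isT) E.
rewrite -(@Rintegral_itv_obnd_cbnd R b +oo%O (fun t => cpart c (h t))).
  by rewrite -E addrC subrK.
apply: (integrableS _ _ _ (ih c)) => //.
by move=> t /=; rewrite !in_itv/= !andbT => /ltW; apply: le_trans; exact: ltW.
Qed.

Lemma cmeas_ccont_ray (a : R) (h : R -> R[i]) :
  (forall t, a <= t -> ccont h t) -> cmeas (`[a, +oo[ : set TR) h.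
Proof.
move=> ch c; apply: subspace_continuous_measurable_fun => //.
apply: continuous_in_subspaceT => x; rewrite inE /= in_itv /= andbT => xa.
exact: ccont_part (ch x xa).
Qed.

(** Both rays carry the same points, so assumptions on F along one serve the other; only [polar_pow]
    tells them apart. *)
Lemma polar_period (t theta : R) : polar t (theta - 2 * pi) = polar t theta :> R[i].
Proof.
have [c s] : cos (theta - 2 * pi) = cos theta /\ sin (theta - 2 * pi) = sin theta.
  have {2 4}-> : theta = (theta - 2 * pi) + pi *+ 2.
    by rewrite -[pi *+ 2]mulr_natl subrK.
  by rewrite cosD2pi sinD2pi.
by rewrite /polar c s.
Qed.

(** From e^x >= (1 + x/2)^2 >= 1 + x^2/4 at x = e l; it trades logarithms for a small power of t. *)
Lemma one_sqr_le_expR (e l : R) : 0 < e -> 0 <= l ->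
  1 + l ^+ 2 <= (1 + 4 / e ^+ 2) * expR (e * l).
Proof.
move=> e0 l0.
have h : 1 + e ^+ 2 * l ^+ 2 / 4 <= expR (e * l).
  have -> : e * l = e * l / 2 + e * l / 2 by lra.
  have h1 : 1 + e * l / 2 <= expR (e * l / 2) by exact: expR_ge1Dx.
  have h0 : 0 <= e * l / 2 by rewrite divr_ge0// mulr_ge0// ltW.
  rewrite expRD; apply: le_trans (_ : (1 + e * l / 2) * (1 + e * l / 2) <= _).
    nra.
  by apply: ler_pM => //; rewrite addr_ge0.
have e2 : 0 < e ^+ 2 by rewrite exprn_gt0.
have c0 : 0 <= 4 / e ^+ 2 by rewrite divr_ge0// ltW.
apply: le_trans (ler_wpM2l _ h); last by rewrite addr_ge0.
have -> : (1 + 4 / e ^+ 2) * (1 + e ^+ 2 * l ^+ 2 / 4) =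
  1 + 4 / e ^+ 2 + e ^+ 2 * l ^+ 2 / 4 + l ^+ 2 by field; rewrite gt_eqF.
have : 0 <= e ^+ 2 * l ^+ 2 / 4 by rewrite divr_ge0// mulr_ge0// sqr_ge0.
move: (sqr_ge0 l) c0; lra.
Qed.

Lemma cmeas_log_ray (rho phi : R) : 0 < rho ->
  cmeas (`[rho, +oo[ : set TR) (fun t => ln t +i* phi).
Proof.
move=> r0; apply: cmeas_ccont_ray => t rt.
exact: cder_ccont (cder_log_ray phi (lt_le_trans r0 rt)).
Qed.

Section Ray.
Variables (F : R[i] -> R[i]) (phi rho C : R).
Hypothesis rho0 : 0 < rho.
Hypothesis F_cont : forall t : R, 0 < t -> ccont (fun u => F (polar u phi)) t.
Hypothesis F_decay : forall t, rho <= t -> cabs (F (polar t phi)) <= C * expR (- 2 * ln t).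

Let g t := F (polar t phi) * polar 1 phi.
Let D : set TR := `[rho, +oo[.

Let mD : measurable D. Proof. exact: measurable_itv. Qed.

Let mg : cmeas D g.
Proof.
apply: cmeas_ccont_ray => t rt.
refine (ccontM (F_cont _) (@ccont_cst R _ t)).
exact: lt_le_trans rho0 rt.
Qed.

Lemma ray_dominated (z : R[i]) : complex.Re z < 1 ->
  exists e B, [/\ 0 < e, mu.-integrable D (EFin \o B) &
    forall t, D t -> (1 + csum (ln t +i* phi) ^+ 2) * expR (e * csum (ln t +i* phi)) *
       cabs (cexp (z * (ln t +i* phi)) * g t) <= B t].
Proof.
(* Two factors exp(e l), one from the statement and one from [one_sqr_le_expR], cost the power
   t^(2e), and t^(Re z - 2) comes from the integrand. With this [e] the exponent [p] is (Re z -
   3)/2, which is below -1 exactly when Re z < 1. *)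
move=> z1; pose e := (1 - complex.Re z) / 4.
have e0 : 0 < e by rewrite divr_gt0// subr_gt0.
pose K := (1 + 4 / e ^+ 2) * expR (4 * e * `|ln rho| + 2 * e * `|phi| + `|complex.Im z * phi|) * C.
pose p := 2 * e + complex.Re z - 2.
have p1 : p < -1 by rewrite /p /e; lra.
exists e, (fun t => K * expR (p * ln t)); split => //.
  exact: (integrableZl mD _ (integrable_expR_ln p1 rho0)).
move=> t; rewrite /D /= in_itv/= andbT => rt; have t0 := lt_le_trans rho0 rt.
set l := csum _; have l0 : 0 <= l by exact: csum_ge0.
have C0 : 0 <= C.
  have := le_trans (cabs_ge0 _) (F_decay rt).
  by rewrite pmulr_lge0// expR_gt0.
(* The logarithm may be negative if rho < 1, but it is bounded below by ln rho; hence the constant 4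
   e |ln rho| in [K]. *)
have lt_ : `|ln t| <= ln t + 2 * `|ln rho|.
  have h1 : ln rho <= ln t by rewrite ler_ln.
  have h2 : - `|ln rho| <= ln rho by rewrite lerNl -normrN ler_norm.
  have h3 : 0 <= `|ln rho| by [].
  by rewrite ler_norml; apply/andP; split; lra.
have cg : cabs (cexp (z * (ln t +i* phi)) * g t) <=
    expR (complex.Re z * ln t + `|complex.Im z * phi|) * (C * expR (- 2 * ln t)).
  rewrite cabsM cabs_cexp /g cabsM cabs_polar1 mulr1.
  apply: ler_pM; rewrite ?expR_ge0 ?cabs_ge0//; last exact: F_decay.
  by rewrite ler_expR; case: (z) => a b /=; rewrite lerD2l -normrN ler_norm.
have h1 := one_sqr_le_expR e0 l0.
have E0 : 0 <= expR (e * l) by exact: expR_ge0.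
apply: le_trans (ler_pM _ (cabs_ge0 _) (ler_wpM2r E0 h1) cg) _.
  by rewrite mulr_ge0// addr_ge0// sqr_ge0.
rewrite /K.
have c0 : 0 <= 1 + 4 / e ^+ 2 by rewrite addr_ge0// divr_ge0// sqr_ge0.
set X := 1 + _ in c0 *.
rewrite [X in X <= _](_ : _ = (X * C) * (expR (e * l) * expR (e * l) *
   expR (complex.Re z * ln t + `|complex.Im z * phi|) * expR (- 2 * ln t))); last by ring.
rewrite [leRHS](_ : _ = (X * C) * (expR (4 * e * `|ln rho| + 2 * e * `|phi| + `|complex.Im z * phi|) * expR (p * ln t))); last by ring.
apply: ler_wpM2l; first exact: mulr_ge0.
rewrite -!expRD ler_expR /p /l /csum /=.
by move: (ler_wpM2l (ltW e0) lt_); nra.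
Qed.

Lemma cintble_ray (z : R[i]) : complex.Re z < 1 -> cintble D (ray_integrand phi z F).
Proof.
move=> /ray_dominated[e [B [e0 iB hB]]].
apply: (cintble_dom mD _ iB).
  rewrite (_ : ray_integrand phi z F = fun t => cexp (z * (ln t +i* phi)) * g t); last first.
    by apply/funext => t; rewrite /ray_integrand /polar_pow mulrA.
  exact: (cmeasM (cmeas_cexp (cmeasM (@cmeas_cst R D z) (cmeas_log_ray phi rho0))) mg).
move=> t Dt; rewrite /ray_integrand /polar_pow -mulrA; apply: le_trans (hB t Dt).
rewrite ler_peMl ?cabs_ge0// mulr_ege1 ?lerDl ?sqr_ge0//.
by rewrite -expR0 ler_expR mulr_ge0 ?csum_ge0// ltW.
Qed.

Lemma kder_ray (z : R[i]) : complex.Re z < 1 ->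
  exists d, kder (fun w => ray_integral phi rho w F) z d.
Proof.
move=> /ray_dominated[e [B [e0 iB hB]]].
have h := cintegral_cexp_derive mD (cmeas_log_ray phi rho0) mg e0 iB hB.
suff -> : (fun w => ray_integral phi rho w F) = (fun w => cintegral D (fun t => cexp (w * (ln t +i* phi)) * g t)).
  by eexists; exact: h.
apply/funext => w; apply: eq_cintegral => t _.
by rewrite /polar_pow /g mulrA.
Qed.

End Ray.

Section Circle.
Variables (F : R[i] -> R[i]) (theta rho C : R).
Hypothesis F_cont : forall phi : R, ccont (fun u => F (polar rho u)) phi.
Hypothesis F_bd : forall phi, cabs (F (polar rho phi)) <= C.

Let g phi := F (polar rho phi) * ('i%C * polar rho phi).
Let D : set TR := `[theta - 2 * pi, theta].

Lemma kder_circle (z : R[i]) :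
  exists d, kder (fun w => circle_integral theta rho w F) z d.
Proof.
have mD : measurable D by exact: measurable_itv.
have mL : cmeas D (fun phi => ln rho +i* phi).
  by apply: cmeas_ccont => t _; exact: cder_ccont (cder_log_circle t (ln rho)).
have mg : cmeas D g.
  apply: cmeas_ccont => t _; refine (ccontM (@F_cont t) _).
  exact: (ccontM (@ccont_cst R _ t) (cder_ccont (cder_circle t rho))).
pose l := `|ln rho| + (`|theta| + 2 * pi).
pose B := (1 + l ^+ 2) * expR l * (expR (csum z * l) * (C * `|rho|)).
have iB : mu.-integrable D (EFin \o (fun=> B)).
  apply: (@continuous_compact_integrable R (fun=> B) D); first exact: segment_compact.
  by apply: continuous_in_subspaceT => x _; exact: cst_continuous.
have hB t : D t -> (1 + csum (ln rho +i* t) ^+ 2) * expR (1 * csum (ln rho +i* t)) *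
    cabs (cexp (z * (ln rho +i* t)) * g t) <= B.
  rewrite /D /= in_itv/= => /andP[t1 t2].
  have tl : csum (ln rho +i* t) <= l.
    rewrite /csum /=; apply: lerD => //.
    have h1 : theta <= `|theta| by exact: ler_norm.
    have h2 : - `|theta| <= theta by rewrite lerNl -normrN ler_norm.
    have h3 : 0 <= pi :> R by exact: pi_ge0.
    by rewrite ler_norml; apply/andP; split; lra.
  have c0 := csum_ge0 (ln rho +i* t).
  rewrite mul1r /B; apply: ler_pM; rewrite ?cabs_ge0//.
  - by rewrite mulr_ge0 ?expR_ge0// addr_ge0// sqr_ge0.
  - apply: ler_pM; rewrite ?expR_ge0 ?ler_expR// ?addr_ge0 ?sqr_ge0//.
    by rewrite lerD2l ler_pXn2r ?nnegrE// (le_trans c0).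
  - rewrite cabsM /g !cabsM cabs_i mul1r cabs_polar.
    apply: ler_pM; rewrite ?mulr_ge0 ?cabs_ge0//.
      apply: le_trans (cabs_polar_pow rho t z) _.
      by rewrite ler_expR ler_wpM2l// csum_ge0.
    exact: ler_wpM2r.
have h := cintegral_cexp_derive mD mL mg ltr01 iB hB.
suff -> : (fun w => circle_integral theta rho w F) = (fun w => cintegral D (fun t => cexp (w * (ln rho +i* t)) * g t)).
  by eexists; exact: h.
apply/funext => w; apply: eq_cintegral => t _.
by rewrite -mulrA.
Qed.

End Circle.

End ContourLog.

(** * Uniqueness, linearity and existence of the derivative at z = 0 *)

Section LogDerivative.
Variable R : realType.
Local Notation mu := (@lebesgue_measure R).
Local Notation TR := (measurableTypeR R).
Implicit Types (F H : R[i] -> R[i]) (theta : R) (d e : R[i]).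

Lemma kderD (K : numFieldType) (f g : K -> K) (z a b : K) :
  kder f z a -> kder g z b -> kder (fun w => f w + g w) z (a + b).
Proof. by move=> /kderP fd /kderP gd; apply/kderP; exact: is_deriveD. Qed.

Lemma kderZ (K : numFieldType) (f : K -> K) (z a c : K) :
  kder f z a -> kder (fun w => c * f w) z (c * a).
Proof. by move=> /kderP fd; apply/kderP; exact: (is_deriveZ c fd). Qed.

Lemma kderN (K : numFieldType) (f : K -> K) (z a : K) :
  kder f z a -> kder (fun w => - f w) z (- a).
Proof. by move=> /kderP fd; apply/kderP; exact: is_deriveN. Qed.

Lemma derivable_kder (K : numFieldType) (f : K -> K) (z : K) :
  @derivable K K^o K^o f z 1 <-> exists d : K, kder f z d.
Proof.
split=> [h|[d /kderP[]]//].
by exists (@derive K K^o K^o f z 1); apply/kderP; exact: (DeriveDef h erefl).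
Qed.

(** Vanishing is known along points tending to 0 and not at 0 itself: differentiability first forces
    D 0 = 0, and then the quotients along these points are 0. *)
Lemma kder0_along (K : numFieldType) (T : Type) (S : set_system T) (SS : ProperFilter S)
    (D : K -> K) (s : T -> K) (d : K) : fcvg S s 0 ->
  (\forall t \near S, s t != 0) -> (\forall t \near S, D (s t) = 0) ->
  kder D 0 d -> d = 0.
Proof.
move=> s0 s_neq0 Ds dD.
have q : fcvg S (fun t => (s t)^-1 * (- D 0)) d.
  apply/fcvgP => e e0; have /fcvgP/(_ e e0)/near_dnbhs0P[k k0 kP] := dD.
  have /fcvgP/(_ k k0) := s0; apply: filterS3 s_neq0 Ds => t t0 Dt.
  by rewrite sub0r normrN => /kP /(_ t0); rewrite addr0 Dt sub0r.
have D0 : D 0 = 0.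
  apply: oppr_inj; rewrite oppr0.
  have h : fcvg S (fun t => s t * ((s t)^-1 * (- D 0))) (0 * d) by exact: (fcvgM _ s0 q).
  rewrite mul0r in h.
  have h' : fcvg S (fun=> - D 0) 0.
    by apply: near_eq_fcvg h; apply: filterS s_neq0 => t t0; rewrite mulVKf.
  exact: (@fcvg_unique K T S SS _ _ _ (@fcvg_cst K T S SS (- D 0)) h').
move: q; rewrite D0 oppr0; under eq_fun do rewrite mulr0.
by move=> h; exact: (@fcvg_unique K T S SS _ _ _ h (@fcvg_cst K T S SS 0)).
Qed.

Definition contour_cintble theta rho (z : R[i]) F :=
  [/\ cintble (`[rho, +oo[ : set TR) (ray_integrand theta z F),
      cintble (`[rho, +oo[ : set TR) (ray_integrand (theta - 2 * pi) z F) &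
      cintble (`[theta - 2 * pi, theta] : set TR) (circle_integrand rho z F)].

Lemma contour_integralE theta rho z F : contour_integral theta rho z F =
  - cintegral `[rho, +oo[ (ray_integrand theta z F)
  - cintegral `[theta - 2 * pi, theta] (circle_integrand rho z F)
  + cintegral `[rho, +oo[ (ray_integrand (theta - 2 * pi) z F).
Proof. by []. Qed.

Lemma contour_integralD theta rho z F H :
  contour_cintble theta rho z F -> contour_cintble theta rho z H ->
  contour_integral theta rho z (fun w => F w + H w) =
    contour_integral theta rho z F + contour_integral theta rho z H /\
  contour_cintble theta rho z (fun w => F w + H w).
Proof.
move=> [F1 F2 F3] [H1 H2 H3].
have rD phi : ray_integrand phi z (fun w => F w + H w) =
    fun t => ray_integrand phi z F t + ray_integrand phi z H t.
  by apply/funext => t; rewrite /ray_integrand mulrDr mulrDl.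
have cD : circle_integrand rho z (fun w => F w + H w) =
    fun t => circle_integrand rho z F t + circle_integrand rho z H t.
  by apply/funext => t; rewrite /circle_integrand mulrDr mulrDl.
have mI a b : measurable ([set` Interval a b] : set TR) by exact: measurable_itv.
split; last by split; rewrite ?rD ?cD; exact: cintbleD.
rewrite !contour_integralE !rD cD (cintegralD (mI _ _) F1 H1).
rewrite (cintegralD (mI _ _) F2 H2) (cintegralD (mI _ _) F3 H3); ring.
Qed.

Lemma contour_integralZ theta rho z F (c : R[i]) : contour_cintble theta rho z F ->
  contour_integral theta rho z (fun w => c * F w) = c * contour_integral theta rho z F /\
  contour_cintble theta rho z (fun w => c * F w).
Proof.
move=> [F1 F2 F3].
have rD phi : ray_integrand phi z (fun w => c * F w) = fun t => c * ray_integrand phi z F t.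
  by apply/funext => t; rewrite /ray_integrand; ring.
have cD : circle_integrand rho z (fun w => c * F w) = fun t => c * circle_integrand rho z F t.
  by apply/funext => t; rewrite /circle_integrand; ring.
have mI a b : measurable ([set` Interval a b] : set TR) by exact: measurable_itv.
split; last by split; rewrite ?rD ?cD; exact: cintbleZ.
rewrite !contour_integralE !rD cD (cintegralZ c (mI _ _) F1).
rewrite (cintegralZ c (mI _ _) F2) (cintegralZ c (mI _ _) F3); ring.
Qed.

(** Two extensions coincide for Re z < 0, through a radius small enough for both. Their derivatives
    at 0 are compared along the negative real axis. *)
Lemma is_dlog_unique theta F d e : is_dlog theta F d -> is_dlog theta F e -> d = e.
Proof.
move=> [d1 [G1 [d10 _ nG1 /kderP dG1]]] [d2 [G2 [d20 _ nG2 /kderP dG2]]].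
have G12 (z : R[i]) : complex.Re z < 0 -> G1 z - G2 z = 0.
  move=> z0; have [rho [h1 h2]] := @filter_ex R _ (at_right_proper_filter 0) _ (filterI nG1 nG2).
  by rewrite h1// h2// subrr.
pose D z := G1 z - G2 z.
have dD : kder D 0 (d - e) by exact: (kderD dG1 (kderN dG2)).
apply/eqP; rewrite -subr_eq0; apply/eqP.
have neg0 : fcvg (0:R)^'+ (fun s : R => (- s)%:C) 0.
  apply/cvg_cpart => -[] /=; first exact: cvg_cst.
  have h : {for (0 : R), continuous (fun s : R => - s)} by exact: opp_continuous.
  by have := cvg_at_right_filter h; rewrite oppr0.
apply: (@kder0_along _ _ _ (at_right_proper_filter 0) D (fun s : R => (- s)%:C) _ neg0 _ _ dD).
  near=> s; have s0 : 0 < s by near: s; exact: nbhs_right_gt.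
  by rewrite (inj_eq (@complexI R)) oppr_eq0 gt_eqF.
near=> s; have s0 : 0 < s by near: s; exact: nbhs_right_gt.
by rewrite /D G12//= oppr_lt0.
Unshelve. all: by end_near. Qed.

Lemma dlogE theta F d : is_dlog theta F d -> dlog theta F = d.
Proof.
move=> h; apply: xget_subset1 => //.
by move=> x y; exact: is_dlog_unique.
Qed.

(* Integrability makes the contour integrals additive in F. *)
Definition log_derivative theta F d :=
  is_dlog theta F d /\
  \forall rho \near (0:R)^'+, forall z : R[i], complex.Re z < 0 -> contour_cintble theta rho z F.

Lemma log_derivativeD theta F H d e :
  log_derivative theta F d -> log_derivative theta H e ->
  log_derivative theta (fun w => F w + H w) (d + e).
Proof.
move=> [[d1 [G1 [d10 D1 nG1 dG1]]] nF] [[d2 [G2 [d20 D2 nG2 dG2]]] nH]; split; last first.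
  by apply: filterS2 nF nH => rho hF hH z z0; have [] := contour_integralD (hF z z0) (hH z z0).
exists (Num.min d1 d2), (fun z => G1 z + G2 z); split.
- by rewrite lt_min d10.
- by move=> z; rewrite lt_min => /andP[/D1 h1 /D2 h2]; exact: derivableD.
- apply: filterS2 (filterI nG1 nG2) (filterI nF nH) => rho [h1 h2] [hF hH] z z0.
  have [-> _] := contour_integralD (hF z z0) (hH z z0).
  by rewrite h1// h2// -mulrDr.
- exact: is_deriveD.
Qed.

Lemma log_derivativeZ theta F (c : R[i]) d :
  log_derivative theta F d -> log_derivative theta (fun w => c * F w) (c * d).
Proof.
move=> [[d1 [G1 [d10 D1 nG1 dG1]]] nF]; split; last first.
  by apply: filterS nF => rho hF z z0; have [] := contour_integralZ c (hF z z0).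
exists d1, (fun z => c * G1 z); split; first exact: d10.
- move=> z /D1/derivable_kder[e he]; apply/derivable_kder.
  by exists (c * e); exact: kderZ.
- apply: filterS2 nG1 nF => rho h1 hF z z0.
  have [-> _] := contour_integralZ c (hF z z0).
  by rewrite h1// mulrCA.
- by move/kderP : dG1 => dG1; apply/kderP; exact: kderZ.
Qed.

Lemma dlog_sum (I : finType) theta (c : I -> R[i]) (F : I -> R[i] -> R[i]) (i0 : I) :
  (forall i, exists d, log_derivative theta (F i) d) ->
  dlog theta (fun w => \sum_i c i * F i w) = \sum_i c i * dlog theta (F i) /\
  exists d, log_derivative theta (fun w => \sum_i c i * F i w) d.
Proof.
move=> hF.
(* The base case of the sum is obtained as 0 times a member of the family, whence the index [i0]. *)
have h0 : log_derivative theta (fun=> 0) 0.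
  have [d hd] := hF i0.
  have := log_derivativeZ 0 hd; rewrite mul0r.
  by under eq_fun do rewrite mul0r.
suff h : log_derivative theta (fun w => \sum_i c i * F i w) (\sum_i c i * dlog theta (F i)).
  by split; [exact: dlogE h.1|exists (\sum_i c i * dlog theta (F i))].
have hs (s : seq I) : log_derivative theta (fun w => \sum_(i <- s) c i * F i w)
    (\sum_(i <- s) c i * dlog theta (F i)).
  elim: s => [|i s IH].
    by rewrite big_nil; under eq_fun do rewrite big_nil.
  rewrite big_cons; under eq_fun do rewrite big_cons.
  have [d hd] := hF i; apply: log_derivativeD => //.
  by rewrite (dlogE hd.1); exact: log_derivativeZ.
exact: hs.
Qed.

(** The contours of small radius only meet the ray and the disc. This discards the spectral
    parameters at which the resolvent takes default values. *)
Lemma eq_dlog theta F H (r : R) : 0 < r ->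
  (forall t, 0 < t -> F (polar t theta) = H (polar t theta)) ->
  (forall w, cabs w < r -> F w = H w) -> dlog theta F = dlog theta H.
Proof.
move=> r0 ray disc.
have ci rho z : 0 < rho < r -> contour_integral theta rho z F = contour_integral theta rho z H.
  move=> /andP[rho0 rhor]; rewrite !contour_integralE; congr (- _ - _ + _);
    apply: eq_cintegral => t /=; rewrite in_itv/=.
  - rewrite andbT /ray_integrand => rt; rewrite ray//; exact: lt_le_trans rho0 rt.
  - by rewrite /circle_integrand disc// cabs_polar gtr0_norm.
  - rewrite andbT /ray_integrand polar_period => rt; rewrite ray//; exact: lt_le_trans rho0 rt.
suff h : is_dlog theta F = is_dlog theta H.
  by rewrite /dlog h.
have nr : \forall rho \near (0:R)^'+, 0 < rho < r.
  near=> s; apply/andP; split; near: s; [exact: nbhs_right_gt|exact: nbhs_right_lt].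
apply/funext => d; apply/propext; split=> -[dl [G [dl0 DG nG dG]]];
  exists dl, G; split; [exact: dl0|exact: DG|idtac|exact: dG|exact: dl0|exact: DG|idtac|exact: dG];
  apply: filterS2 nr nG => rho hr hG z z0; rewrite hG//.
  by rewrite ci.
by rewrite -ci.
Unshelve. all: by end_near. Qed.

(* Cauchy's theorem on an annular sector makes the contour integral independent
   of its radius; the decay makes it holomorphic in z for Re z < 1. *)
Lemma has_log_derivative theta F (F' : R[i] -> R[i]) (r B C : R) : 0 < r ->
  (forall w, cabs w < r -> kder F w (F' w)) ->
  (forall w, cabs w < r -> ktends F' w (F' w)) ->
  (forall w, cabs w < r -> cabs (F w) <= B) ->
  (forall w, cabs w < r -> cabs (F' w) <= B) ->
  (forall t : R, 0 < t -> ccont (fun u => F (polar u theta)) t) ->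
  (\forall t \near +oo, cabs (F (polar t theta)) <= C * expR (- 2 * ln t)) ->
  exists d, log_derivative theta F d.
Proof.
move=> r0 dF cF' F_bd F'_bd cF [T [_ hT]].
(* The bound at infinity is extended down to any [rho], with a constant depending on [rho], by
   taking a maximum over the compact piece that remains. *)
have decay rho : 0 < rho -> exists C', forall t, rho <= t ->
    cabs (F (polar t theta)) <= C' * expR (- 2 * ln t).
  move=> rho0; pose T1 := Num.max rho (T + 1).
  have rT : rho <= T1 by rewrite le_max lexx.
  have TT : T < T1 by rewrite lt_max ltrDl ltr01 orbT.
  have T10 : 0 < T1 by exact: lt_le_trans rT.
  pose f t := csum (F (polar t theta)).
  have cf : {within `[rho, T1], continuous f}.
    apply: continuous_in_subspaceT => x; rewrite inE /= in_itv /= => /andP[xr _].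
    have cx := cF x (lt_le_trans rho0 xr).
    have nb b : {for (x : R), continuous (fun u : R => `|cpart b (F (polar u theta))|)}.
      apply: (@continuous_comp _ _ _ (fun u : R => cpart b (F (polar u theta)))
        (@Num.norm R R)); first exact: (@ccont_part R _ _ b cx).
      exact: norm_continuous.
    have := continuousD (nb false) (nb true); exact.
  have [c _ hc] := EVT_max rT cf.
  (* The factor T1^2 compensates t^-2 for t <= T1, so that M t^-2 still exceeds the maximum. *)
  pose M := Num.max 0 (f c) * expR (2 * ln T1).
  exists (Num.max C M) => t rt; have t0 := lt_le_trans rho0 rt.
  have [tT|tT] := ltP T1 t.
    apply: le_trans (hT t (lt_trans TT tT)) _; apply: ler_wpM2r; first exact: expR_ge0.
    by rewrite le_max lexx.
  apply: le_trans (cabs_le _) _; rewrite -/(csum _).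
  have ht : t \in `[rho, T1] by rewrite in_itv/= rt.
  apply: le_trans (hc t ht) _.
  apply: (@le_trans _ _ (M * expR (- 2 * ln t))); last first.
    by apply: ler_wpM2r; [exact: expR_ge0|rewrite le_max lexx orbT].
  rewrite /M -mulrA -expRD; apply: le_trans (_ : Num.max 0 (f c) <= _).
    by rewrite le_max lexx orbT.
  rewrite ler_peMr ?le_max ?lexx//; apply: le_trans (expR_ge1Dx _); rewrite lerDl.
  have : ln t <= ln T1 by rewrite ler_ln.
  lra.
pose th' := theta - 2 * pi.
have cF2 t : 0 < t -> ccont (fun u => F (polar u th')) t.
  by move=> t0; under eq_fun do rewrite polar_period; exact: cF.
have decay2 rho : 0 < rho -> exists C', forall t, rho <= t ->
    cabs (F (polar t th')) <= C' * expR (- 2 * ln t).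
  by move=> /decay[C' hC]; exists C' => t; rewrite polar_period; exact: hC.
have in_disc t phi : 0 < t -> t < r -> cabs (polar t phi : R[i]) < r.
  by move=> t0 tr; rewrite cabs_polar gtr0_norm.
have ccirc rho phi : 0 < rho -> rho < r -> ccont (fun u => F (polar rho u)) phi.
  move=> rho0 rhor.
  exact: cder_ccont (cder_comp (dF _ (in_disc rho phi rho0 rhor)) (cder_circle phi rho)).
have int rho z : 0 < rho -> rho < r -> complex.Re z < 1 -> contour_cintble theta rho z F.
  move=> rho0 rhor z1; split.
  - by have [C' hC] := decay rho rho0; exact: cintble_ray hC _ _.
  - by have [C' hC] := decay2 rho rho0; exact: cintble_ray hC _ _.
  - apply: cintble_ccont => phi _.
    exact: ccont_circle_integrand (dF _ (in_disc rho phi rho0 rhor)).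
have der rho z : 0 < rho -> rho < r -> complex.Re z < 1 ->
    exists d, kder (fun w => contour_integral theta rho w F) z d.
  move=> rho0 rhor z1.
  have [C1 h1] := decay rho rho0; have [C2 h2] := decay2 rho rho0.
  have [d1 k1] := kder_ray rho0 cF h1 z1; have [d2 k2] := kder_ray rho0 cF2 h2 z1.
  have hb phi : cabs (F (polar rho phi)) <= B by apply: F_bd; exact: in_disc.
  have [d3 k3] := kder_circle theta (fun phi => ccirc rho phi rho0 rhor) hb z.
  eexists; exact: (kderD (kderD (kderN k1) (kderN k3)) k2).
have indep a b z : 0 < a -> a < b -> b < r -> complex.Re z < 1 ->
    contour_integral theta a z F = contour_integral theta b z F.
  move=> a0 ab br z1.
  have [I1 I2 _] := int a z a0 (lt_trans ab br) z1.
  rewrite !contour_integralE (cintegral_itvS ab I1) (cintegral_itvS ab I2).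
  have := sector_cauchy theta z dF cF' F_bd F'_bd a0 ab br.
  set P := cintegral `[a, b] (ray_integrand theta z F); set Q := cintegral `[a, b] _ => E.
  have -> : P = cintegral `[theta - 2 * pi, theta] (circle_integrand b z F) -
      cintegral `[theta - 2 * pi, theta] (circle_integrand a z F) + Q by rewrite E subrK.
  ring.
(* The holomorphic extension is the contour integral at the fixed radius r/2; all smaller radii
   agree with it by [indep]. *)
have r2 : 0 < r / 2 by rewrite divr_gt0.
have r2r : r / 2 < r by rewrite ltr_pdivrMr// mulr_natr mulr2n ltrDl.
have nr : \forall rho \near (0:R)^'+, 0 < rho < r / 2.
  near=> s; apply/andP; split; near: s; [exact: nbhs_right_gt|exact: nbhs_right_lt].
have [d hd] := der (r / 2) 0 r2 r2r ltr01.
pose c : R[i] := 'i%C / (2 * pi)%:C.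
exists (c * d); split.
  exists 1, (fun z => c * contour_integral theta (r / 2) z F); split; first exact: ltr01.
  - move=> z z1; have [e he] := der (r / 2) z r2 r2r z1; apply/derivable_kder.
    by exists (c * e); exact: kderZ.
  - apply: filterS nr => rho /andP[rho0 rho2] z z0; congr (_ * _); apply/esym.
    exact: indep rho0 rho2 r2r (lt_trans z0 ltr01).
  - by apply/kderP; exact: kderZ.
apply: filterS nr => rho /andP[rho0 rho2] z z0.
exact: int rho0 (lt_trans rho2 r2r) (lt_trans z0 ltr01).
Unshelve. all: by end_near. Qed.

End LogDerivative.

(** * Dependence on the spectral parameter *)

Lemma scalar_mx_cvg (K : numFieldType) (N : nat) (T : Type) (F : set_system T)
    (FF : Filter F) (f : T -> K) (a : K) :
  fcvg F f a -> mx_cvg F (fun x => (f x)%:M : 'M[K]_N) a%:M.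
Proof.
move=> fa i j; rewrite mxE; under eq_fun do rewrite mxE.
case: (i == j); last by rewrite !mulr0n; exact: cvg_cst.
by rewrite mulr1n; under eq_fun do rewrite mulr1n; exact: fa.
Qed.

Lemma resolvent_pencil_cvg (K : numFieldType) (N : nat) (T : Type) (F : set_system T)
    (FF : Filter F) (f : T -> K) (S : 'M[K]_N) (mu : K) :
  S - mu%:M \in unitmx -> fcvg F f mu ->
  mx_cvg F (fun x => invmx (S - (f x)%:M)) (invmx (S - mu%:M)).
Proof.
move=> u fmu; apply: (mx_cvgV _ _ u); apply: mx_cvgB; first exact: mx_cvg_cst.
exact: scalar_mx_cvg.
Qed.

Lemma resolvent_unit_disc (K : numFieldType) (N : nat) (S : 'M[K]_N) : S \in unitmx ->
  exists2 d : K, (forall w, `|w| < d -> S - w%:M \in unitmx) & 0 < d.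
Proof.
move=> u.
have h : mx_cvg (nbhs (0 : K)) (fun w => S - w%:M) (S - 0%:M).
  by apply: mx_cvgB; [exact: mx_cvg_cst|apply: scalar_mx_cvg; exact: cvg_id].
rewrite raddf0 subr0 in h.
have h' := mx_cvg_unit (nbhs_filter (0 : K)) h u.
have /nbhs_ballP[d /= d0 dP] : nbhs (0 : K) (fun w => S - w%:M \in unitmx) by exact: h'.
by exists d => // w wd; apply: dP; rewrite /ball /= sub0r normrN.
Qed.

Definition mx_kder (K : numFieldType) (p q : nat) (f : K -> 'M[K]_(p, q)) (z : K) d :=
  mx_der (0 : K)^' (fun h => h^-1) (fun h => f (h + z)) (f z) d.

Lemma mx_kder_entry (K : numFieldType) (p q : nat) (f : K -> 'M[K]_(p, q)) (z : K) d i j :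
  mx_kder f z d -> kder (fun w => f w i j) z (d i j).
Proof.
move=> [_ /(_ i j)]; under eq_fun do rewrite !mxE.
exact.
Qed.

Lemma resolvent_pencil_der (K : numFieldType) (N : nat) (S : 'M[K]_N) (mu : K) :
  mx_kder (fun w => S - w%:M) mu (- 1%:M).
Proof.
have n0 : \forall h \near (0 : K)^', h != 0 by exact: nbhs_dnbhs_neq.
apply: mx_der_continuous.
- by apply: filterS n0 => h; rewrite invr_eq0.
- rewrite (_ : (fun h : K => h^-1^-1) = id); last by apply/funext => h; rewrite invrK.
  exact: nbhs_dnbhs.
- apply: (@near_eq_mx_cvg _ _ _ _ _ _ (fun=> - 1%:M)); last exact: mx_cvg_cst.
  apply: filterS n0 => h h0.
  have -> : (h + mu)%:M = h%:M + mu%:M :> 'M[K]_N by exact: raddfD.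
  rewrite opprB addrA opprD addrA subrK addrAC subrr add0r.
  by rewrite scalerN scale_scalar_mx mulVf.
Qed.

Section MatrixHolomorphic.
Variable K : numFieldType.

Lemma mx_kder_cst p q (a : 'M[K]_(p, q)) z : mx_kder (fun=> a) z 0.
Proof. exact: mx_der_cst. Qed.

Lemma mx_kderD p q (f g : K -> 'M[K]_(p, q)) z d e :
  mx_kder f z d -> mx_kder g z e -> mx_kder (fun w => f w + g w) z (d + e).
Proof. exact: mx_derD. Qed.

Lemma mx_kderM p q r (f : K -> 'M[K]_(p, q)) (g : K -> 'M[K]_(q, r)) z d e :
  mx_kder f z d -> mx_kder g z e ->
  mx_kder (fun w => f w *m g w) z (d *m g z + f z *m e).
Proof. exact: mx_derM. Qed.

Lemma mx_kderZ p q (c : K) (f : K -> 'M[K]_(p, q)) z d :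
  mx_kder f z d -> mx_kder (fun w => c *: f w) z (c *: d).
Proof. exact: mx_derZ. Qed.

Lemma resolvent_kder N (S : 'M[K]_N) (mu : K) : S - mu%:M \in unitmx ->
  mx_kder (fun w => invmx (S - w%:M)) mu (invmx (S - mu%:M) *m invmx (S - mu%:M)).
Proof.
move=> u; have h := mx_derV _ u (resolvent_pencil_der S mu).
rewrite (_ : _ *m _ = - (invmx (S - mu%:M) *m - 1%:M *m invmx (S - mu%:M))); first exact: h.
by rewrite mulmxN mulNmx opprK mulmx1.
Qed.

End MatrixHolomorphic.

(** Formal derivative in mu: that of (S - mu)^-1 is its square, and coefficients are constant. *)
Fixpoint tmuderiv (R : realType) (n : nat) (t : sterm R n) : sterm R n :=
  match t with
  | SRho => SMul SRho SRho
  | SCoef _ _ => SZero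
  | SZero => SZero
  | SAdd a b => SAdd (tmuderiv a) (tmuderiv b)
  | SMul a b => SAdd (SMul (tmuderiv a) b) (SMul a (tmuderiv b))
  | SScale c a => SScale c (tmuderiv a)
  end.

Section SpectralParameter.
Variables (R : realType) (n N : nat) (S : 'M[R[i]]_N).
Variable l : mindex n -> seq 'I_n -> 'M[R[i]]_N.
Implicit Types (t : sterm R n) (mu : R[i]).

Let rho mu := invmx (S - mu%:M).
Let val t mu := teval (rho mu) l t.

Lemma teval_mu_cvg (T : Type) (F : set_system T) (FF : Filter F) (f : T -> R[i]) mu t :
  S - mu%:M \in unitmx -> fcvg F f mu -> mx_cvg F (fun x => val t (f x)) (val t mu).
Proof.
move=> u fmu.
have hr : mx_cvg F (fun x => rho (f x)) (rho mu).
  exact: (resolvent_pencil_cvg _ u fmu).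
elim: t => [|g s| |a IHa b IHb|a IHa b IHb|c a IHa]; rewrite /val /=.
- exact: hr.
- exact: (@mx_cvg_cst _ _ _ FF _ _ (l g s)).
- exact: (@mx_cvg_cst _ _ _ FF _ _ 0).
- exact: (mx_cvgD _ IHa IHb).
- exact: (mx_cvgM _ IHa IHb).
- exact: (mx_cvgZ _ (@fcvg_cst _ _ _ FF c) IHa).
Qed.

Lemma teval_mu_der mu t : S - mu%:M \in unitmx ->
  mx_kder (val t) mu (val (tmuderiv t) mu).
Proof.
move=> u.
elim: t => [|g s| |a IHa b IHb|a IHa b IHb|c a IHa].
- exact: (resolvent_kder u).
- exact: (mx_kder_cst (l g s) mu).
- exact: (mx_kder_cst 0 mu).
- exact: (mx_kderD IHa IHb).
- exact: (mx_kderM IHa IHb).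
- exact: (mx_kderZ c IHa).
Qed.

Lemma mx_cvg_bounded (T : Type) (F : set_system T) (FF : Filter F) (p q : nat)
    (f : T -> 'M[R[i]]_(p, q)) a i j : mx_cvg F f a ->
  \forall x \near F, cabs (f x i j) <= cabs (a i j) + 1.
Proof.
move=> fa; have /fcvgP/(_ 1 ltr01) := fa i j; apply: filterS => x.
rewrite cabsE ltcR => h.
rewrite -[f x i j](subrK (a i j)) addrC; apply: le_trans (cabsD _ _) _.
by rewrite lerD2l cabsB ltW.
Qed.

Lemma cvg_inv_pinfty : fcvg +oo%R (fun s : R => (s^-1)%:C) (0 : R[i]).
Proof.
have h : (s^-1 : R) @[s --> +oo] --> (0 : R).
  apply/gtr0_cvgV0 => //; first exact: nbhs_pinfty_gt.
exact: (cvg_real_complex _ h).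
Qed.

Let pF : Filter (pinfty_nbhs R). Proof. exact: proper_pinfty_nbhs. Qed.

(** With mu = s e^(i theta), s (S - mu)^-1 = (S/s - e^(i theta))^-1. The limit keeps the term
    [0 *: S] delivered by the limit of S/s. *)
Lemma rho_ray_cvg theta : mx_cvg +oo%R (fun s : R => s%:C *: rho (polar s theta))
  (invmx (0 *: S - (polar 1 theta)%:M)).
Proof.
have p0 : polar 1 theta != 0 :> R[i] by rewrite -cabs_eq0 cabs_polar1 oner_eq0.
have u0 : 0 *: S - (polar 1 theta)%:M \in unitmx.
  by rewrite scale0r sub0r -rmorphN unitmxE det_scalar unitrX// unitfE oppr_eq0.
have h1 : mx_cvg +oo%R (fun s : R => (s^-1)%:C *: S) (0 *: S).
  exact: (mx_cvgZ pF cvg_inv_pinfty (@mx_cvg_cst _ _ _ pF _ _ S)).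
have h2 := mx_cvgB pF h1 (@mx_cvg_cst _ _ _ pF _ _ (polar 1 theta)%:M).
apply: near_eq_mx_cvg (mx_cvgV pF h2 u0).
apply: filterS2 (mx_cvg_unit pF h2 u0) (nbhs_pinfty_gt (num_real (0 : R))) => s us s_gt0.
have s0 : s%:C != 0 :> R[i] by rewrite (inj_eq (@complexI R)) gt_eqF.
rewrite /rho [polar s theta]polarE.
have -> : S - (s%:C * polar 1 theta)%:M = s%:C *: ((s^-1)%:C *: S - (polar 1 theta)%:M).
  by rewrite scalerBr scalerA fmorphV mulfV// scale1r scale_scalar_mx.
rewrite invmxZ; first by rewrite scalerA mulfV// scale1r.
by rewrite unitmxZ// unitfE.
Qed.

(** Each factor [SRho] absorbs one power of s, so a lower bound on their number bounds the decay
    along the ray. *)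
Lemma teval_ray_cvg theta t k : tdecay t k ->
  exists M, mx_cvg +oo%R (fun s : R => (s ^+ k)%:C *: val t (polar s theta)) M.
Proof.
elim: t k => [|g s| |a IHa b IHb|a IHa b IHb|c a IHa] k; rewrite /val /=.
(* Since [tdecay] is only a lower bound, k = 0 also occurs; there rho = s^-1 (s rho) tends to 0. *)
- case: k => [|[|//]] _; last by eexists; exact: rho_ray_cvg.
  have h := mx_cvgZ pF cvg_inv_pinfty (@rho_ray_cvg theta).
  exists (0 *: invmx (0 *: S - (polar 1 theta)%:M)).
  apply: near_eq_mx_cvg h; apply: filterS (nbhs_pinfty_gt (num_real (0 : R))) => s s0.
  by rewrite scalerA -rmorphM mulVf ?expr0// gt_eqF.
- move=> ->; exists (l g s); under [X in mx_cvg _ X]funext do rewrite expr0 scale1r.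
  exact: (@mx_cvg_cst _ _ _ pF _ _ (l g s)).
- move=> _; exists 0; under [X in mx_cvg _ X]funext do rewrite scaler0.
  exact: (@mx_cvg_cst _ _ _ pF _ _ 0).
- move=> [/IHa[M hM] /IHb[M' hM']]; exists (M + M').
  by under [X in mx_cvg _ X]funext do rewrite scalerDr; exact: (mx_cvgD pF hM hM').
- move=> [k1 [k2 [-> /IHa[M hM] /IHb[M' hM']]]]; exists (M *m M').
  under [X in mx_cvg _ X]funext do rewrite exprD rmorphM -scalerA scalemxAr scalemxAl.
  exact: (mx_cvgM pF hM hM').
- move=> /IHa[M hM]; exists (c *: M).
  under [X in mx_cvg _ X]funext do rewrite scalerA mulrC -scalerA.
  exact: (mx_cvgZ pF (@fcvg_cst _ _ _ pF c) hM).
Qed.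

Hypothesis S_unit : S \in unitmx.
Variable theta : R.
Hypothesis S_ray : forall t : R, 0 < t -> S - (polar t theta)%:M \in unitmx.

Lemma teval_ktends mu t i j : S - mu%:M \in unitmx ->
  ktends (fun w => val t w i j) mu (val t mu i j).
Proof.
move=> u; exact: (@teval_mu_cvg _ _ (nbhs_filter (mu : (R[i] : numFieldType))) id mu t u cvg_id i j).
Qed.

Lemma ktends_bounded_disc (f : R[i] -> R[i]) : ktends f 0 (f 0) ->
  exists2 r : R, 0 < r & forall w, cabs w < r -> cabs (f w) <= cabs (f 0) + 1.
Proof.
move=> /ktendsP/(_ 1 ltr01)[d]; rewrite ltcE /= => /andP[/eqP di d0] dP.
have dE : d = (complex.Re d)%:C by rewrite [LHS]complexE di mulr0 addr0.
exists (complex.Re d) => // w wd.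
have := dP w; rewrite subr0 dE !cabsE !ltcR => /(_ wd) h.
rewrite -[f w](subrK (f 0)) addrC; apply: le_trans (cabsD _ _) _.
by rewrite lerD2l cabsB ltW.
Qed.

Lemma teval_log_derivative t i j : tdecay t 2 ->
  exists d, log_derivative theta (fun mu => val t mu i j) d.
Proof.
move=> td.
have S0 : S - 0%:M \in unitmx by rewrite raddf0 subr0.
have [d dP] := resolvent_unit_disc S_unit.
rewrite ltcE /= => /andP[/eqP di d0].
have dE : d = (complex.Re d)%:C by rewrite [LHS]complexE di mulr0 addr0.
have uS w : cabs w < complex.Re d -> S - w%:M \in unitmx.
  by move=> wd; apply: dP; rewrite dE cabsE ltcR.
have [r1 r10 b1] := ktends_bounded_disc (@teval_ktends 0 t i j S0).
have [r2 r20 b2] := ktends_bounded_disc (@teval_ktends 0 (tmuderiv t) i j S0).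
set B1 := cabs _ + 1 in b1; set B2 := cabs _ + 1 in b2.
pose r := Num.min (complex.Re d) (Num.min r1 r2).
have rP w : cabs w < r -> [/\ cabs w < complex.Re d, cabs w < r1 & cabs w < r2].
  by rewrite !lt_min => /andP[-> /andP[-> ->]].
have [M hM] := teval_ray_cvg theta td.
have FB := mx_cvg_bounded pF i j hM.
apply: (@has_log_derivative R theta _ (fun mu => val (tmuderiv t) mu i j) r
  (Num.max B1 B2) (cabs (M i j) + 1)).
- by rewrite !lt_min d0 r10.
- by move=> w /rP[h _ _]; exact: mx_kder_entry (teval_mu_der t (uS w h)).
- by move=> w /rP[h _ _]; exact: (@teval_ktends w (tmuderiv t) i j (uS w h)).
- by move=> w /rP[_ h _]; apply: le_trans (b1 w h) _; rewrite le_max lexx.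
- by move=> w /rP[_ _ h]; apply: le_trans (b2 w h) _; rewrite le_max lexx orbT.
- move=> s s0; exact: (ccont_comp (cder_ccont (cder_ray theta s)) (@teval_ktends _ t i j (S_ray s0))).
- apply: filterS2 FB (nbhs_pinfty_gt (num_real (0 : R))) => s h s0.
  move: h; rewrite mxE cabsM cabs_real gtr0_norm ?exprn_gt0// => h.
  have -> : expR (-2 * ln s) = (s ^+ 2)^-1.
    by rewrite mulNr expRN expRM_natl lnK.
  by rewrite ler_pdivlMr ?exprn_gt0// mulrC.
Qed.

End SpectralParameter.

(** * Integration over spheres *)

(* Unlike integralZl these do not assume measurability. *)
Section NonmeasurableScaling.
Context (disp : measure_display) (T : measurableType disp) (R : realType).
Variable mu : {measure set T -> \bar R}.
Implicit Types (D : set T) (c : R).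

(** The integral is a supremum over simple functions below f, and c times such a function lies below
    c f. The converse inequality follows by applying this to c f with the factor c^-1. *)
Lemma ge0_integralZ_ge D (f : T -> \bar R) c : 0 < c -> (forall x, (0 <= f x)%E) ->
  (c%:E * (\int[mu]_(x in D) f x) <= \int[mu]_(x in D) (c%:E * f x))%E.
Proof.
move=> c0 f0; have cf0 x : D x -> (0 <= c%:E * f x)%E.
  by move=> _; rewrite mule_ge0// lee_fin ltW.
rewrite !ge0_integralE// -lee_pdivlMl//.
apply: ge_ereal_sup => _ /= [h hf <-].
rewrite lee_pdivlMl//; apply: ereal_sup_ubound => /=.
exists (scale_nnsfun h (ltW c0)); last exact: sintegralrM.
move=> x /=; have := hf x; rewrite !patchE; case: ifP => _ hx.
  by rewrite EFinM lee_pmul2l.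
by rewrite EFinM -[leRHS](mule0 c%:E) lee_pmul2l.
Qed.

Lemma ge0_integralZ D (f : T -> \bar R) c : 0 < c -> (forall x, (0 <= f x)%E) ->
  (\int[mu]_(x in D) (c%:E * f x) = c%:E * \int[mu]_(x in D) f x)%E.
Proof.
move=> c0 f0; apply/eqP; rewrite eq_le ge0_integralZ_ge// andbT.
have cf0 x : (0 <= c%:E * f x)%E by rewrite mule_ge0// lee_fin ltW.
have ci : 0 < c^-1 by rewrite invr_gt0.
rewrite -lee_pdivrMl//; apply: le_trans (ge0_integralZ_ge _ ci cf0) _.
rewrite le_eqVlt; apply/orP; left; apply/eqP; apply: eq_integral => x _.
by rewrite muleA -EFinM mulVf ?mul1e// gt_eqF.
Qed.

Lemma RintegralZ D (f : T -> R) c :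
  \int[mu]_(x in D) (c * f x) = c * \int[mu]_(x in D) f x.
Proof.
have pos k g : 0 < k -> \int[mu]_(x in D) (k * g x) = k * \int[mu]_(x in D) g x.
  move=> k0; rewrite /Rintegral.
  have E : (\int[mu]_(x in D) (k * g x)%:E = k%:E * \int[mu]_(x in D) (g x)%:E)%E.
    rewrite integralE [in RHS]integralE.
    have -> : (fun x => (k * g x)%:E) = (fun x => (k%:E * (g x)%:E)%E) by [].
    rewrite ge0_funeposM ?ltW// ge0_funenegM ?ltW//.
    rewrite !ge0_integralZ//.
    set a := (\int[mu]_(_ in _) _^\+ _)%E; set b := (\int[mu]_(_ in _) _^\- _)%E.
    have : (0 <= a)%E by exact: integral_ge0.
    have : (0 <= b)%E by exact: integral_ge0.
    (* Without integrability either part may be infinite; the identity holds in the extended reals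
       in each case. *)
    case: a b => [a| |] [b| |] //= _ _; rewrite ?gt0_muley ?gt0_muleNy ?lte_fin//=.
      by rewrite -EFinM -!EFinD -EFinM mulrDr mulrN.
  by rewrite E; case: (\int[mu]_(x in D) _)%E => [s| |]; rewrite ?mulr0//=
     ?gt0_muley ?gt0_muleNy ?lte_fin//= mulr0.
have neg g : \int[mu]_(x in D) (- g x) = - \int[mu]_(x in D) g x.
  rewrite /Rintegral integralE [in RHS]integralE.
  have -> : (fun x => (- g x)%:E) = (\- (EFin \o g))%E by [].
  rewrite funeposN funenegN.
  set a := (\int[mu]_(_ in _) _^\- _)%E; set b := (\int[mu]_(_ in _) _^\+ _)%E.
  have : (0 <= a)%E by exact: integral_ge0.
  have : (0 <= b)%E by exact: integral_ge0.
  by case: a b => [a| |] [b| |] //= _ _; rewrite ?oppr0 ?opprB.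
have [c0|c0|->] := ltrgt0P c; first exact: pos.
  have E : (fun x => c * f x) = (fun x => - (- c * f x)) by apply/funext => x; rewrite mulNr opprK.
  by rewrite E neg pos ?oppr_gt0// mulNr opprK.
by under eq_Rintegral do rewrite mul0r; rewrite mul0r /Rintegral integral0.
Qed.

End NonmeasurableScaling.

Section SphereIntegral.
Variable R : realType.

Lemma eucl_row_mx k (a : R) (w : 'rV[R]_k) :
  eucl (row_mx a%:M w : 'rV[R]_(1 + k)) = Num.sqrt (a ^+ 2 + eucl w ^+ 2).
Proof.
rewrite /eucl big_split_ord /= big_ord1 row_mxEl mxE eqxx mulr1n sqr_sqrtr; last first.
  by apply: sumr_ge0 => i _; exact: sqr_ge0.
by congr (Num.sqrt (_ + _)); apply: eq_bigr => i _; rewrite row_mxEr.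
Qed.

Lemma eq_sphere_integral n (f g : 'rV[R]_n -> R) :
  (forall xi, eucl xi = 1 -> f xi = g xi) -> sphere_integral f = sphere_integral g.
Proof.
case: n f g => [//|k]; elim: k => [|k IH] f g fg.
  have e1 (c : R) : c ^+ 2 = 1 -> eucl (const_mx c : 'rV[R]_1) = 1.
    by move=> c1; rewrite /eucl big_ord1 mxE c1 sqrtr1.
  by rewrite /= !fg// e1 ?expr1n ?sqrrN ?expr1n.
apply: eq_Rintegral => phi _; congr (_ * _); apply: IH => w w1; apply: fg.
by rewrite eucl_row_mx euclZ w1 mulr1 real_normK ?num_real// cos2Dsin2 sqrtr1.
Qed.

Lemma sphere_integralZ n (c : R) (f : 'rV[R]_n -> R) :
  sphere_integral (fun xi => c * f xi) = c * sphere_integral f.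
Proof.
case: n f => [|k] f; first by rewrite mulr0.
elim: k f => [|k IH] f /=; first by rewrite mulrDr.
rewrite -RintegralZ; apply: eq_Rintegral => phi _.
by rewrite [sphere_integralS _]IH mulrCA.
Qed.

Lemma sphere_integralC_i n (f : 'rV[R]_n -> R[i]) :
  sphere_integralC (fun xi => 'i%C * f xi) = 'i%C * sphere_integralC f.
Proof.
rewrite /sphere_integralC.
have -> : (fun xi => complex.Re ('i%C * f xi)) = (fun xi => -1 * complex.Im (f xi)).
  by apply/funext => xi; case: (f xi) => a b /=; ring.
have -> : (fun xi => complex.Im ('i%C * f xi)) = (fun xi => 1 * complex.Re (f xi)).
  by apply/funext => xi; case: (f xi) => a b /=; ring.
rewrite !sphere_integralZ; apply/eqP; rewrite eq_complex /=; apply/andP; split; apply/eqP; ring.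
Qed.

Lemma sphere_integralC_real n (c : R) (f : 'rV[R]_n -> R[i]) :
  sphere_integralC (fun xi => c%:C * f xi) = c%:C * sphere_integralC f.
Proof.
rewrite /sphere_integralC.
have -> : (fun xi => complex.Re (c%:C * f xi)) = (fun xi => c * complex.Re (f xi)).
  by apply/funext => xi; case: (f xi) => a b /=; ring.
have -> : (fun xi => complex.Im (c%:C * f xi)) = (fun xi => c * complex.Im (f xi)).
  by apply/funext => xi; case: (f xi) => a b /=; ring.
rewrite !sphere_integralZ; apply/eqP; rewrite eq_complex /=; apply/andP; split; apply/eqP; ring.
Qed.

(** A general complex factor would mix real and imaginary parts and require additivity of the
    integral. Since 1/(-2i) = i/2, repeated real scaling and multiplication by i suffice. *)
Lemma sphere_integralC_chiral n k (f : 'rV[R]_n -> R[i]) :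
  sphere_integralC (fun xi => ((- 2 * 'i%C) ^+ k)^-1 * f xi) =
  ((- 2 * 'i%C) ^+ k)^-1 * sphere_integralC f.
Proof.
have E : (- 2 * 'i%C)^-1 = (2^-1 : R)%:C * 'i%C :> R[i].
  apply: (mulIf (x := - 2 * 'i%C)).
    by rewrite mulf_neq0 ?oppr_eq0 ?pnatr_eq0// -cabs_eq0 cabs_i oner_eq0.
  rewrite mulVf; last by rewrite mulf_neq0 ?oppr_eq0 ?pnatr_eq0// -cabs_eq0 cabs_i oner_eq0.
  have h : (2^-1 : R)%:C = 2^-1 :> R[i] by rewrite fmorphV rmorph_nat.
  rewrite h mulrACA mulrN mulVf ?pnatr_eq0// mulN1r -expr2.
  by rewrite (_ : 'i%C ^+ 2 = -1) ?opprK//; exact: sqr_i.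
rewrite -exprVn E; elim: k f => [|k IH] f.
  by under eq_fun do rewrite expr0 mul1r; rewrite expr0 mul1r.
under eq_fun do rewrite exprSr -!mulrA.
by rewrite IH sphere_integralC_real sphere_integralC_i exprSr -!mulrA.
Qed.

End SphereIntegral.

(** * Comparison of the two residue densities *)

Section ResidueDensities.
Variables (R : realType) (n : nat) (n_even : ~~ odd n) (n_gt0 : (0 < n)%N).
Variables (E : 'I_n -> 'M[R[i]]_(spindim n)) (cE : clifford_family E).
Variables (m : nat) (A : opcoefs R n (spindim n)) (q : clifford_coefs R n).
Variables (L : opcoefs R n (formdim n)) (r theta : R).
Hypothesis r_gt0 : 0 < r.
Hypothesis sA : forall a, (mdeg a <= m)%N -> smoothM_on (euclball n r) (A a).
Hypothesis Aq : forall a x, (mdeg a <= m)%N -> euclball n r x ->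
  A a x = \sum_(I : {set 'I_n}) q a I x *: cliff_prod E I.
Hypothesis limL : is_rescaling_limit (euclball n r) m q L.
Hypothesis A_ray : forall xi, xi != 0 -> forall t : R, 0 <= t ->
  opsymbol m A 0 0 xi - (polar t theta)%:M \in unitmx.

Let top X := top_of_one (cliff_map E (@cform R n) X).

(** Expansion in matrix units gives the form in which [dlog_sum] applies, one function of mu per
    entry. *)
Lemma top_cliff_mapE X : top X = \sum_(p : 'I_(spindim n) * 'I_(spindim n))
  top (delta_mx p.1 p.2) * X p.1 p.2.
Proof.
rewrite {1}[X]matrix_sum_delta pair_big /top /= linear_sum /top_of_one summxE /=.
by apply: eq_bigr => p _; rewrite linearZ mxE mulrC.
Qed.

Lemma top_log_symbol x xi : euclball n r x -> eucl xi = 1 ->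
  top_of_one (log_symbol m theta L n x xi) =
  ((- 2 * 'i%C) ^+ n./2)^-1 * supertrace E (log_symbol m theta A n 0 xi).
Proof.
move=> Bx xi1; have xi0 : xi != 0.
  by apply: contra_eq_neq xi1 => ->; rewrite -(scale0r (0 : 'rV[R]_n)) euclZ normr0 mul0r eq_sym oner_eq0.
have B0 : euclball n r 0 by exact: euclball0.
set S := opsymbol m A 0 0 xi.
pose t := tresolvents m xi n n.
pose l g s := foldr (@pderivM R n (spindim n) (spindim n)) (A g) s 0.
pose val (mu : R[i]) := teval (invmx (S - mu%:M)) l t.
(* Here n > 0 enters: r_{-m} itself has a single factor (sigma_m - mu)^-1. *)
have td : tdecay t 2.
  by have := tdecay_tresolvents m xi (leqnn n); rewrite -lt0n n_gt0.
have resA mu : S - mu%:M \in unitmx -> resolvent m A n 0 xi mu = val mu.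
  by move=> u; rewrite (resolvent_tvalue_unit n sA B0 u).
have resL mu : S - mu%:M \in unitmx -> top_of_one (resolvent m L n x xi mu) = top (val mu).
  by move=> u; rewrite (resolvent_top n_even cE r_gt0 sA Aq limL u Bx) resA.
(* The ray L_theta contains its origin, so the Agmon condition at t = 0 makes the leading symbol
   invertible. *)
have S_unit : S \in unitmx.
  have p0 : polar 0 theta = 0 :> R[i] by rewrite /polar !mul0r.
  by have := A_ray xi0 (lexx 0); rewrite p0 raddf0 subr0.
have S_ray s : 0 < s -> S - (polar s theta)%:M \in unitmx by move=> /ltW; exact: A_ray.
have [d dP] := resolvent_unit_disc S_unit.
rewrite ltcE /= => /andP[/eqP di d0].
have dE : d = (complex.Re d)%:C by rewrite [LHS]complexE di mulr0 addr0.
have S_disc w : cabs w < complex.Re d -> S - w%:M \in unitmx.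
  by move=> wd; apply: dP; rewrite dE cabsE ltcR.
have key : dlog theta (fun mu => top_of_one (resolvent m L n x xi mu)) =
    top (\matrix_(k, j) dlog theta (fun mu => resolvent m A n 0 xi mu k j)).
  (* The two resolvents are compared only on the ray and near 0, where S - mu is known to be
     invertible. *)
  rewrite (@eq_dlog R theta _ (fun mu => top (val mu)) (complex.Re d) d0); first last.
  - by move=> w wd; rewrite resL// S_disc.
  - by move=> s s0; rewrite resL// S_ray.
  rewrite top_cliff_mapE.
  have s0 : (0 < spindim n)%N by rewrite expn_gt0.
  have hF (p : 'I_(spindim n) * 'I_(spindim n)) :
      exists e, log_derivative theta (fun mu => val mu p.1 p.2) e.
    exact: teval_log_derivative.
  have [E1 _] := dlog_sum (fun p => top (delta_mx p.1 p.2)) (Ordinal s0, Ordinal s0) hF.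
  rewrite (_ : (fun mu => top (val mu)) = fun mu =>
    \sum_(p : 'I_(spindim n) * 'I_(spindim n)) top (delta_mx p.1 p.2) * val mu p.1 p.2); last first.
    by apply/funext => mu; exact: top_cliff_mapE.
  rewrite E1; apply: eq_bigr => p _; congr (_ * _); rewrite mxE.
  apply: (@eq_dlog R theta _ _ (complex.Re d) d0).
    by move=> s /S_ray/resA ->.
  by move=> w /S_disc/resA ->.
rewrite (supertrace_top n_even cE) mulKf; last first.
  by rewrite expf_neq0// mulf_neq0 ?oppr_eq0 ?pnatr_eq0// -cabs_eq0 cabs_i oner_eq0.
rewrite /log_symbol xi1 invr1 scale1r linearZ /top_of_one !mxE; congr (_ * _).
exact: key.
Qed.

End ResidueDensities.

Lemma sphere_integralC_dim0 (R : realType) n (f : 'rV[R]_n -> R[i]) :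
  n = 0%N -> sphere_integralC f = 0.
Proof. by move=> n0; move: f; rewrite n0. Qed.

Lemma eq_sphere_integralC (R : realType) n (f g : 'rV[R]_n -> R[i]) :
  (forall xi, eucl xi = 1 -> f xi = g xi) -> sphere_integralC f = sphere_integralC g.
Proof.
by move=> fg; rewrite /sphere_integralC; congr (_ +i* _); apply: eq_sphere_integral => xi /fg ->.
Qed.

Lemma eigenvalueN_unitmx (F : fieldType) N (S : 'M[F]_N) (a : F) :
  ~~ eigenvalue S a -> S - a%:M \in unitmx.
Proof. by rewrite /eigenvalue negbK kermx_eq0 row_free_unit. Qed.

Theorem corollary6p10 (R : realType) (n : nat) (n_even : ~~ odd n)
    (M : spin_manifold R n) (p : M) (al0 : chart_ix M) (r : R)
    (Up : normal_chart p al0 r)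
    (m : nat) (m_gt0 : (0 < m)%N) (P : diffop M m)
    (q : clifford_coefs R n) (Pq : clifford_expansion P al0 q)
    (P_geometric : geometric_op (euclball n r) (frame M al0) m q)
    (theta : R) (P_agmon : agmon_angle P theta)
    (P_even : even_diffop P)
    (Plim : opcoefs R n (formdim n))
    (P_rescalable : is_rescaling_limit (euclball n r) m q Plim) :
  forall x, euclball n r x ->
    form_res_density m theta Plim x =
    ((- 2 * 'i%C) ^+ n./2)^-1 * sres_density (gen M) m theta (opcoef P al0) 0.
Proof.
move=> x Bx; rewrite /form_res_density /sres_density mulrCA; congr (_ * _).
(* For n = 0 the unit sphere is empty and both densities vanish. *)
have [n0|n_gt0] := posnP n; first by rewrite !(sphere_integralC_dim0 _ n0) mulr0.
have [[r_gt0 _ _ imgE] _] := Up.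
rewrite -sphere_integralC_chiral; apply: eq_sphere_integralC => xi xi1.
apply: (top_log_symbol n_even n_gt0 (@gen_clifford R n M) r_gt0 _ _ P_rescalable) => //.
- by move=> a am; have := opcoef_smooth P al0 am; rewrite imgE.
- by move=> a y am By; apply: Pq => //; rewrite imgE.
(* The point p has coordinate 0, so the leading-symbol part of the Agmon condition is used in the
   normal chart at 0. *)
- move=> eta eta0 t t0; apply: eigenvalueN_unitmx; apply: P_agmon.1 => //.
  by rewrite imgE; exact: euclball0.
Qed.
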